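(* Let $(X,d)$, $G$, $o$ be as in the context, and let $(\omega_n)_{n\ge 0}$ and $(\check\omega_n)_{n\ge0}$ be the forward and backward random walks generated by a non-elementary probability measure $\mu$ on $G$. (1) If $\mu$ has finite $p$-th moment for some $p>0$, then there exists $K>0$ such that for every $x\in X$, \[ \mathbb E\Big[\sup_{n\ge 0} (\omega_n o, x)_o^{\,p}\Big]<K,\qquad \mathbb E\Big[\sup_{n,n'\ge 0} (\check\omega_{n'} o,\omega_n o)_o^{\,2p}\Big]<K. \] (2) If $\mu$ has finite exponential moment, then there exist $\kappa,K>0$ such that for every $x\in X$, \[ \mathbb E\Big[\sup_{n\ge 0} e^{\kappa (x,\omega_n o)_o}\Big]<K,\qquad \mathbb E\Big[\sup_{n,n'\ge 0} e^{\kappa(\check\omega_{n'} o,\omega_n o)_o}\Big]<K. \]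
   Context: $(X,d)$ is a geodesic metric space (not necessarily proper or separable), $G$ is a countable group of isometries of $X$ containing two independent contracting isometries, and $o\in X$ is a fixed basepoint. For $A\subseteq X$ and $x\in X$, $\pi_A(x)=\{a\in A: d(x,a)=d(x,A)\}$. A set $A$ is $K$-contracting if $\pi_A(z)\ne\emptyset$ for all $z\in X$ and for all $x,y\in X$ with $d(x,y)\le d(x,A)-K$ one has $\operatorname{diam}(\pi_A(x)\cup\pi_A(y))\le K$. A $K$-quasigeodesic is a map $\gamma$ from an interval of $\mathbb R$ or a set of consecutive integers to $X$ with $|s-t|/K-K\le d(\gamma(s),\gamma(t))\le K|s-t|+K$; a $K$-contracting axis is a $K$-quasigeodesic whose image is $K$-contracting. An isometry $g$ is contracting if for some $K$ the orbit $n\in\mathbb Z\mapsto g^n o$ is a $K$-contracting axis. Bi-infinite sequences $(x_i)_{i\in\mathbb Z},(y_i)_{i\in\mathbb Z}$ are independent if for every $M>0$ the set $\{(n,m):d(x_n,y_m)<M\}$ is bounded; isometries $g,h$ are independent if their orbits $(g^n o)_n,(h^n o)_n$ are independent. A probability measure $\mu$ on $G$ is non-elementary if the semigroup generated by its support contains two independent contracting isometries. Let $(g_i)_{i\in\mathbb Z}$ be i.i.d. with law $\mu$; the forward walk is $\omega_0=\mathrm{id}$, $\omega_n=g_1\cdots g_n$, and the backward walk is $\check\omega_n=\check g_1\cdots\check g_n$ with $\check g_n=g_{-n+1}^{-1}$ (an independent random walk whose steps have law $g\mapsto\mu(g^{-1})$). $\mu$ has finite $p$-th moment if $\int d(o,go)^p\,d\mu(g)<\infty$,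 and finite exponential moment if $\int e^{c\,d(o,go)}d\mu(g)<\infty$ for some $c>0$. The Gromov product is $(y,z)_x=\tfrac12\big(d(x,y)+d(x,z)-d(y,z)\big)$. *)

(* Defs.v *)
From HB Require Import structures.
From mathcomp Require Import all_boot all_order all_algebra.
From mathcomp Require Import monoid.
From mathcomp Require Import all_classical all_reals all_analysis.
Set Implicit Arguments. Unset Strict Implicit. Unset Printing Implicit Defensive.
Import Order.TTheory GRing.Theory Num.Theory.
Local Open Scope classical_set_scope.
Local Open Scope ring_scope.

Section Geometry.
Variables (R : realType) (X : Type) (d : X -> X -> R).

Definition is_metric : Prop :=
  [/\ forall x y, d x y = 0 <-> x = y,
      forall x y, d x y = d y x &
      forall x y z, d x z <= d x y + d y z].

Definition geodesic_space : Prop :=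
  forall x y : X, exists gam : R -> X,
    [/\ gam 0 = x, gam (d x y) = y &
        forall s t, 0 <= s <= d x y -> 0 <= t <= d x y ->
          d (gam s) (gam t) = `|s - t| ].

Definition dist_set (x : X) (A : set X) : R := inf [set d x a | a in A].

Definition proj (A : set X) (x : X) : set X :=
  [set a | A a /\ d x a = dist_set x A].

(** A is K-contracting; "diam(S) <= K" is written out as a bound on all
    pairwise distances in S. *)
Definition contracting_set (K : R) (A : set X) : Prop :=
  (forall z, proj A z !=set0) /\
  forall x y, d x y <= dist_set x A - K ->
    forall a b, (proj A x `|` proj A y) a -> (proj A x `|` proj A y) b ->
      d a b <= K.

Definition quasigeodesicZ (K : R) (gam : int -> X) : Prop :=
  forall s t : int,
    `|(s - t)%:~R| / K - K <= d (gam s) (gam t) <= K * `|(s - t)%:~R| + K.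

Definition contracting_axisZ (K : R) (gam : int -> X) : Prop :=
  quasigeodesicZ K gam /\ contracting_set K (range gam).

Definition independent_seqs (x y : int -> X) : Prop :=
  forall M : R, 0 < M -> exists N : nat,
    forall n m : int, d (x n) (y m) < M -> (`|n| <= N)%N /\ (`|m| <= N)%N.

Definition gromov (x y z : X) : R := (d x y + d x z - d y z) / 2.

End Geometry.

Section Group.
Local Open Scope group_scope.
Variables (R : realType) (X : Type) (d : X -> X -> R) (G : groupType)
  (act : G -> X -> X) (o : X).

Definition isometric_faithful_action : Prop :=
  [/\ forall x, act 1 x = x,
      forall g h x, act (g * h) x = act g (act h x),
      forall g x y, d (act g x) (act g y) = d x y &
      forall g h, (forall x, act g x = act h x) -> g = h].

Definition zpow (g : G) (n : int) : G :=
  match n with Posz k => g ^+ k | Negz k => (g ^+ k.+1)^-1 end.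

Definition orbit_seq (g : G) : int -> X := fun n => act (zpow g n) o.

Definition contracting_isometry (g : G) : Prop :=
  exists K : R, 0 < K /\ contracting_axisZ d K (orbit_seq g).

Definition independent_isometries (g h : G) : Prop :=
  independent_seqs d (orbit_seq g) (orbit_seq h).

Inductive semigroup_gen (S : set G) : G -> Prop :=
  | sg_base g : S g -> semigroup_gen S g
  | sg_mul g h : semigroup_gen S g -> semigroup_gen S h -> semigroup_gen S (g * h).

Definition prob_mass (mu : G -> R) : Prop :=
  (forall g, (0 <= mu g)%R) /\ (\esum_(g in [set: G]) (mu g)%:E = 1)%E.

Definition support (mu : G -> R) : set G := [set g | (0 < mu g)%R].

Definition non_elementary (mu : G -> R) : Prop :=
  exists g h, [/\ semigroup_gen (support mu) g, semigroup_gen (support mu) h,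
    contracting_isometry g, contracting_isometry h & independent_isometries g h].

Definition finite_pth_moment (mu : G -> R) (p : R) : Prop :=
  (\esum_(g in [set: G]) (mu g * (d o (act g o)) `^ p)%:E < +oo)%E.

Definition finite_exp_moment (mu : G -> R) : Prop :=
  exists c : R, (0 < c)%R /\
    (\esum_(g in [set: G]) (mu g * expR (c * d o (act g o)))%:E < +oo)%E.

Fixpoint fwd_walk {T : Type} (g : int -> T -> G) (n : nat) (w : T) : G :=
  match n with
  | 0%N => 1
  | k.+1 => fwd_walk g k w * g (Posz k.+1) w
  end.

Fixpoint bwd_walk {T : Type} (g : int -> T -> G) (n : nat) (w : T) : G :=
  match n with
  | 0%N => 1
  | k.+1 => bwd_walk g k w * (g (- Posz k)%R w)^-1
  end.

End Group.

Definition iid_steps (R : realType) (dd : measure_display) (Omega : measurableType dd)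
  (P : probability Omega R) (G : Type) (mu : G -> R) (g : int -> Omega -> G) : Prop :=
  (forall (i : int) (a : G), measurable [set w | g i w = a]) /\
  (forall (s : seq int) (a : int -> G), uniq s ->
     P [set w | forall i, i \in s -> g i w = a i] = (\prod_(i <- s) mu (a i))%:E).

(* Main.v *)
(** Two independent contracting elements of the semigroup generated by the
    support of mu yield a finite alphabet of words, all of the same length and
    the same mu-weight, that play ping-pong: whatever comes before and after a
    random letter of the alphabet, at most one letter fails to align with it.
    Cut the walk into cells of this common length. A stack machine reads the
    cells that are letters and keeps those at which the path up to now is still
    aligned; the final stack cuts the path into nested half-spaces. Resampling
    the letters uniformly, a union bound over the possible histories of the
    machine shows that, off an event of probability exponentially small in k, at
    least three quarters of the letters among the first k cells survive forever,
    even when two steps of the walk are prescribed. The same applied to the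
    time-reversed walk gives three quarters of the letters that separate in
    the other direction, so two letters work for both. At such a letter the
    backward walk (or a fixed point x) and the forward walk have bounded Gromov
    product, whence the Gromov product at o is at most D plus the length of the
    path of the first k cells. Summing over k bounds the moments; for the
    exponent 2p one multiplies this bound by the one of the backward path, which
    is why two steps have to be prescribed. *)

Require Import Defs.
From HB Require Import structures.
From mathcomp Require Import all_boot all_order all_algebra.
From mathcomp Require Import monoid.
From mathcomp Require Import all_classical all_reals all_analysis.
From mathcomp Require Import measurable_realfun.
From mathcomp Require Import ring lra zify.
Import Order.TTheory GRing.Theory Num.Theory.
Local Open Scope classical_set_scope.
Local Open Scope ring_scope.

Local Notation proj := Defs.proj.
Local Notation support := Defs.support.

Set Implicit Arguments.
Unset Strict Implicit.
Unset Printing Implicit Defensive.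


(** * Contracting sets *)

(** All half-spaces are read off the projection index on the axis of one element [a]; the other
    element [b] only marks places: a letter is a power of [a] interrupted by one block of [b], and a
    misaligned point betrays where the block stands. The obstacle is that the fate of a letter
    depends on the letters on both sides of it. For a fixed history it becomes a list of tests, and
    a letter carries two independent labels: its suffix answers for the future, its prefix for the
    past. In the right order, each test pins down one label that the tests after it do not see.
    Histories weigh at most [6 ^ q], a gain of [2 ^ q] is wanted, and when more than a quarter of
    [q] letters is lost, at least [q / 8] are lost for the same reason; hence [12 ^ 8] prefixes and
    as many suffixes. Probability enters through translations of the labels in a finite window of
    cells, which preserve its mass. The exponential moment involves all steps at once and is out of
    reach of prescribed steps: there an AM-GM inequality separates the rare event from the path
    length. *)

Section Contraction.
Variables (R : realType) (X : Type) (d : X -> X -> R).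
Hypotheses (dM : is_metric d) (dG : geodesic_space d).

Lemma dxx x : d x x = 0. Proof. by case: dM => /(_ x x) [_ ->]. Qed.
Lemma dC x y : d x y = d y x. Proof. by case: dM. Qed.
Lemma dtri y x z : d x z <= d x y + d y z. Proof. by case: dM. Qed.
Lemma d0_eq x y : d x y = 0 -> x = y. Proof. by case: dM => /(_ x y) []. Qed.
Lemma d_ge0 x y : 0 <= d x y.
Proof. have := dtri y x x; rewrite dxx (dC y x); lra. Qed.

Lemma gromov_ge0 x y z : 0 <= gromov d x y z.
Proof. by have := dtri x y z; rewrite /gromov (dC y x); lra. Qed.

Lemma gromov_le_dr x y z : gromov d x y z <= d x z.
Proof. by have := dtri z x y; rewrite /gromov (dC z y); lra. Qed.

Lemma gromovC x y z : gromov d x y z = gromov d x z y.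
Proof. by rewrite /gromov (dC y z); lra. Qed.

Lemma gromov_le_base p x y z : gromov d x y z <= gromov d p y z + d x p.
Proof. by have := dtri p x y; have := dtri p x z; rewrite /gromov; lra. Qed.

Lemma dist_set_le A x a : A a -> dist_set d x A <= d x a.
Proof.
move=> Aa; apply: ge_inf; last by exists a.
by exists 0 => _ [b _ <-]; exact: d_ge0.
Qed.

Lemma proj_le A x a b : proj d A x a -> A b -> d x a <= d x b.
Proof. by move=> [_ ->]; exact: dist_set_le. Qed.

Lemma proj_self A x a : A x -> proj d A x a -> a = x.
Proof.
move=> Ax pa; apply/esym/d0_eq; have := proj_le pa Ax.
by rewrite dxx; have := d_ge0 x a; lra.
Qed.

Lemma proj_self_in A x : A x -> proj d A x !=set0 -> proj d A x x.
Proof. by move=> Ax [a pa]; rewrite -{2}(proj_self Ax pa). Qed.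

Lemma geodesic_points x y : exists gam : R -> X, forall t : R, 0 <= t <= d x y ->
  [/\ d x (gam t) = t, d y (gam t) = d x y - t &
      forall s : R, t <= s <= d x y -> d (gam t) (gam s) = s - t].
Proof.
have [gam [g0 g1 gd]] := dG x y; exists gam => t t01.
have /andP[t0 t1] := t01.
have l0 : 0 <= (0 : R) <= d x y by rewrite lexx d_ge0.
have l1 : 0 <= d x y <= d x y by rewrite lexx d_ge0.
split.
- by have := gd 0 t l0 t01; rewrite g0 sub0r normrN ger0_norm.
- by have := gd (d x y) t l1 t01; rewrite g1 ger0_norm ?subr_ge0.
- move=> s /andP[ts s1]; have s01 : 0 <= s <= d x y.
    by rewrite s1 (le_trans t0 ts).
  by have := gd s t s01 t01; rewrite dC ger0_norm ?subr_ge0.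
Qed.

Variables (K : R) (A : set X).
Hypotheses (K1 : 1 <= K) (AK : contracting_set d K A).

Lemma proj_step x y a b : proj d A x a -> proj d A y b ->
  d x y <= d x a - K -> d a b <= K.
Proof.
move=> pa pb xy; apply: (AK.2 x y); first by rewrite -pa.2.
- by left.
- by right.
Qed.

(** Within [K] of [A] the bound forces [y = x], and two projections of such a point are less than
    [2 * K] apart; farther away this is one contraction step. *)
Lemma proj_retreat x y a b :
  proj d A x a -> proj d A y b -> d x y <= Num.max 0 (d x a - K) ->
  d a b <= 2 * K.
Proof.
have k1 := K1; move=> pa pb; have [xa|xa] := leP 0 (d x a - K) => xy.
  by have := proj_step pa pb xy; lra.
have /d0_eq yx : d x y = 0 by have := d_ge0 x y; lra.
by subst y; have := dtri x a b; have := pa.2; have := pb.2; rewrite (dC a x); lra.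
Qed.

(** While the farther point is more than [3 * K] away from [A], a move of [2 * K] towards the other
    point shifts its projection by at most [K]; once it is within [3 * K], the triangle inequality
    costs [6 * K]. *)
Lemma proj_lipschitz p q a b : proj d A p a -> proj d A q b ->
  d a b <= d p q + 6 * K.
Proof.
have k1 := K1; have [n] : exists n : nat, d p q < n%:R * (2 * K).
  exists (Num.Def.archi_bound (d p q / (2 * K))).
  rewrite -ltr_pdivrMr; last lra.
  by apply: archi_boundP; apply: divr_ge0; [exact: d_ge0|lra].
elim: n p q a b => [|n IH] p q a b; first by have := d_ge0 p q; lra.
wlog le_ba : p q a b / d q b <= d p a.
  move=> H pq pa pb; have [h|h] := leP (d q b) (d p a); first exact: H.
  by rewrite dC (dC p); apply: H => //; [exact: ltW | rewrite dC].
move=> pq pa pb; have [pa3|pa3] := leP (d p a) (3 * K).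
  by have := dtri p a b; have := dtri q p b; rewrite (dC a p); lra.
have [pq2|pq2] := leP (d p q) (2 * K).
  have h : d p q <= d p a - K by lra.
  by have := proj_step pa pb h; have := d_ge0 p q; lra.
have [gam /(_ (2 * K))[]] := geodesic_points p q; first by apply/andP; lra.
have [c pc] := AK.1 (gam (2 * K)).
rewrite (dC q) => h1 h2 _.
have h3 : d p (gam (2 * K)) <= d p a - K by rewrite h1; lra.
have h4 : d (gam (2 * K)) q < n%:R * (2 * K).
  by rewrite h2; move: pq; rewrite -natr1; lra.
have := proj_step pa pc h3; have := IH _ _ _ _ h4 pc pb; rewrite h2.
by have := dtri c a b; lra.
Qed.

(* Far from A the projection moves slowly: either the two projections are
   close, or travelling from x to y costs a detour along A. *)
Lemma proj_detour x y a b : proj d A x a -> proj d A y b ->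
  d a b <= 4 * K \/ d x a + d a b + d b y <= d x y + 12 * K.
Proof.
have k1 := K1; move=> pa pb.
(* One may travel [tx] from [x] and [ty] from [y] without moving the projection by more than
   [2 * K]. If these stretches cover the geodesic, a common point gives [4 * K]. Otherwise [12 * K]
   is twice [2 * K], plus [6 * K] for the middle part, plus a [K] lost at each end. *)
pose tx := Num.max 0 (d x a - K); pose ty := Num.max 0 (d y b - K).
have tx0 : 0 <= tx by rewrite le_max lexx.
have ty0 : 0 <= ty by rewrite le_max lexx.
have txa : d x a - K <= tx by rewrite le_max lexx orbT.
have tyb : d y b - K <= ty by rewrite le_max lexx orbT.
have [gam gamP] := geodesic_points x y.
have [lt_l|le_l] := ltP (tx + ty) (d x y); last first.
  left; pose t := Num.min tx (d x y).
  have tx1 : t <= tx by rewrite ge_min lexx.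
  have t01 : 0 <= t <= d x y by rewrite le_min tx0 d_ge0 ge_min lexx orbT.
  have [c pc] := AK.1 (gam t); have [xt yt _] := gamP _ t01.
  have h1 := proj_retreat pa pc; rewrite xt in h1.
  have h2 := proj_retreat pb pc; rewrite yt in h2.
  have h3 : d x y - t <= ty by rewrite /t minEle; case: ifP => _; lra.
  have := h1 tx1; have := h2 h3; have := dtri c a b; rewrite (dC b c); lra.
right; have [c pc] := AK.1 (gam tx); have [e pe] := AK.1 (gam (d x y - ty)).
have [xc _ h] : [/\ d x (gam tx) = tx, d y (gam tx) = d x y - tx &
    forall s, tx <= s <= d x y -> d (gam tx) (gam s) = s - tx].
  by apply: gamP; apply/andP; split; lra.
have hce : d (gam tx) (gam (d x y - ty)) = d x y - ty - tx.
  by apply: h; apply/andP; split; lra.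
have [|_ ye _] := gamP (d x y - ty); first by apply/andP; split; lra.
have h1 := proj_retreat pa pc; rewrite xc in h1.
have h2 := proj_retreat pb pe; rewrite ye in h2.
have h3 : d x y - (d x y - ty) <= Num.max 0 (d y b - K) by rewrite -/ty; lra.
have := h1 (lexx _); have := h2 h3; have := proj_lipschitz pc pe.
rewrite hce; have := dtri c a b; have := dtri e c b; rewrite (dC b e) (dC b y); lra.
Qed.

Lemma proj_detour_in x y b : A x -> proj d A y b ->
  d x b + d b y <= d x y + 12 * K.
Proof.
have k1 := K1; move=> Ax pb; have px := proj_self_in Ax (AK.1 x).
by case: (proj_detour px pb); rewrite ?dxx; have := dtri x b y;
  rewrite (dC b x); lra.
Qed.

End Contraction.

Lemma archi_nat (R : realType) (x : R) : exists n : nat, x <= n%:R.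
Proof.
exists (Num.Def.archi_bound `|x|); apply: le_trans (ler_norm x) _.
exact/ltW/archi_boundP.
Qed.

Lemma NegzS_add1 (n : nat) : (Negz n.+1 + 1)%R = Negz n.
Proof. by lia. Qed.

(** * Projection indices along a contracting axis *)

Section Axis.
Local Open Scope group_scope.
Variables (R : realType) (X : Type) (d : X -> X -> R) (G : groupType).
Variables (act : G -> X -> X) (o : X) (a : G) (K : R).
Hypotheses (dM : is_metric d) (dG : geodesic_space d).
Hypotheses (actP : isometric_faithful_action d act).
Hypotheses (K1 : (1 <= K)%R) (aK : contracting_axisZ d K (orbit_seq act o a)).

Lemma zpowS (i : int) : zpow a (i + 1)%R = zpow a i * a.
Proof.
case: i => [n|[|n]]; first by rewrite -PoszD addn1 /= expgSr.
  by rewrite (_ : (Negz 0 + 1)%R = 0)//= expg1 mulVg.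
by rewrite NegzS_add1 /= (expgS a n.+1) invgM mulgVK.
Qed.

Lemma zpowD (i j : int) : zpow a (i + j)%R = zpow a i * zpow a j.
Proof.
elim/int_rec: j => [|n IH|n IH]; first by rewrite addr0 mulg1.
  by rewrite -addn1 PoszD addrA !zpowS IH mulgA.
have E (k : int) : zpow a (k - 1)%R = zpow a k * a^-1.
  by have := zpowS (k - 1)%R; rewrite subrK => ->; rewrite mulgK.
by rewrite -addn1 PoszD opprD addrA !E IH mulgA.
Qed.

Local Notation al := (orbit_seq act o a).
Local Notation P z i := (proj d (range al) z (al i)).

Lemma act1 x : act 1 x = x. Proof. by case: actP. Qed.
Lemma actM g h x : act (g * h) x = act g (act h x). Proof. by case: actP. Qed.
Lemma act_iso g x y : d (act g x) (act g y) = d x y. Proof. by case: actP. Qed.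
Lemma actK g : cancel (act g) (act g^-1).
Proof. by move=> x; rewrite -actM mulVg act1. Qed.
Lemma actKV g : cancel (act g^-1) (act g).
Proof. by move=> x; rewrite -actM mulgV act1. Qed.
Lemma act_isoV g x y : d (act g^-1 x) y = d x (act g y).
Proof. by rewrite -(act_iso g) actKV. Qed.

Lemma gromov_act g x y z :
  gromov d (act g x) (act g y) (act g z) = gromov d x y z.
Proof. by rewrite /gromov !act_iso. Qed.

Lemma al0 : al 0 = o. Proof. exact: act1. Qed.

Lemma alD n i : act (zpow a n) (al i) = al (n + i)%R.
Proof. by rewrite /orbit_seq zpowD actM. Qed.

Lemma ex_idx z : exists i, P z i.
Proof. by have [x px] := aK.2.1 z; have [i _ ei] := px.1; exists i; rewrite ei. Qed.

Lemma idx_shift n z i : P z i -> P (act (zpow a n) z) (n + i)%R.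
Proof.
move=> pz; have le_b b : range al b -> (d z (al i) <= d (act (zpow a n) z) b)%R.
  move=> [j _ <-]; have : range al (al (j - n)%R) by exists (j - n)%R.
  move=> /(proj_le dM pz); rewrite -(act_iso (zpow a n) z (al (j - n)%R)) alD.
  by rewrite addrC subrK.
split; first by exists (n + i)%R.
rewrite -alD act_iso; apply/eqP; rewrite eq_le; apply/andP; split.
  apply: lb_le_inf; last by move=> _ [b Ab <-]; exact: le_b.
  by exists (d (act (zpow a n) z) (al 0)), (al 0) => //; exists 0%R.
rewrite -(act_iso (zpow a n)) alD; apply: dist_set_le => //.
Qed.

Lemma idx_shiftV n z i : P (act (zpow a n) z) i -> P z (i - n)%R.
Proof.
move=> /(idx_shift (- n)%R); rewrite -actM -zpowD addNr act1.
by rewrite addrC.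
Qed.

Local Open Scope ring_scope.

(** A point may carry several indices, since projections need not be unique; the quasigeodesic bound
    makes this ambiguity bounded, so indices are compared up to a constant. *)
Lemma idx_close (B : R) :
  exists C : nat, forall i j : int, d (al i) (al j) <= B -> i <= j + C%:Z.
Proof.
have [C BC] := archi_nat (K * (B + K)); exists C => i j dB.
have /andP[+ _] := aK.1 i j; rewrite lerBlDr ler_pdivrMr; last first.
  by have := K1; lra.
move=> h; have {}h : `|(i - j)%:~R| <= C%:R :> R.
  apply: le_trans h _; apply: le_trans BC; rewrite mulrC ler_wpM2l//.
    by have := K1; lra.
  lra.
have : ((i - j)%:~R <= C%:R :> R) by exact: le_trans (ler_norm _) h.
by rewrite -[C%:R]/(C%:Z%:~R) ler_int; lia.
Qed.

Lemma pos_close (C : nat) :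
  exists B : R, forall i j : int, i <= j + C%:Z -> j <= i + C%:Z -> d (al i) (al j) <= B.
Proof.
exists (K * C%:R + K) => i j ij ji.
have /andP[_] := aK.1 i j; move/le_trans; apply.
rewrite lerD2r ler_wpM2l//; first by have := K1; lra.
by rewrite -intr_norm -[C%:R]/(C%:Z%:~R) ler_int; lia.
Qed.

Lemma idx_lipschitz (B : R) : exists C : nat, forall x y (i j : int),
  P x i -> P y j -> d x y <= B -> i <= j + C%:Z.
Proof.
have [C CP] := idx_close (B + 6 * K); exists C => x y i j xi yj xy.
by apply: CP; have := proj_lipschitz dM dG K1 aK.2 xi yj; lra.
Qed.

(** Indices at least [C] apart belong to axis points more than [4 * K] apart, which excludes the
    first alternative of [proj_detour]. *)
Lemma idx_detour : exists C : nat, forall x y (i j : int),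
  P x i -> P y j -> i + C%:Z <= j \/ j + C%:Z <= i ->
  d x (al i) + d (al i) (al j) + d (al j) y <= d x y + 12 * K.
Proof.
have [C CP] := idx_close (4 * K); exists C.+1 => x y i j xi yj ij.
case: (proj_detour dM dG K1 aK.2 xi yj) => // h.
by have := CP _ _ h; rewrite (dC dM) in h; have := CP _ _ h; lia.
Qed.

Lemma detour_in i y j : P y j ->
  d (al i) (al j) + d (al j) y <= d (al i) y + 12 * K.
Proof. by apply: (proj_detour_in dM dG K1 aK.2); exists i. Qed.

(* The indices of the projections of a geodesic from [al i] to [al k] move by
   bounded jumps, hence some point of the geodesic projects near [al j]. *)
Lemma axis_between : exists B : R, forall i j k : int, i <= j -> j <= k ->
  d (al i) (al j) + d (al j) (al k) <= d (al i) (al k) + B.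
Proof.
have [C CP] := idx_lipschitz 1.
have [B BP] := pos_close C; exists (24 * K + 2 * B) => i j k ij jk.
suff [p [m [pm dp mj jm]]] : exists p (m : int), [/\ P p m,
    d (al i) p + d p (al k) = d (al i) (al k), m <= j + C%:Z & j <= m + C%:Z].
  have := detour_in i pm; have := detour_in k pm.
  have := BP _ _ mj jm; have := dtri dM (al m) (al i) (al j).
  have := dtri dM (al m) (al j) (al k).
  have := d_ge0 dM (al m) p.
  by rewrite (dC dM (al j) (al m)) (dC dM (al k) p) (dC dM (al k) (al m)); lra.
have [gam gamP] := geodesic_points dM dG (al i) (al k).
set l := d (al i) (al k) in gamP *.
have l0 : 0 <= l by exact: d_ge0.
pose idx z := sval (cid (ex_idx z)).
have idxP z : P z (idx z) by exact: (svalP (cid (ex_idx z))).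
(* Unit steps along the geodesic, clipped at its end. The first sample whose index reaches [j]
   overshoots it by at most one jump [C]. *)
pose t (n : nat) := Num.min n%:R l.
have t01 n : 0 <= t n <= l by rewrite le_min ler0n l0 ge_min lexx orbT.
have step n : idx (gam (t n.+1)) <= idx (gam (t n)) + C%:Z.
  apply: (CP _ _ _ _ (idxP _) (idxP _)).
  have [_ _ h] := gamP _ (t01 n).
  have le_t : t n <= t n.+1.
    by rewrite le_min !ge_min lexx orbT ler_nat leqnSn.
  rewrite (dC dM) h; last by rewrite le_t; have /andP[] := t01 n.+1.
  by rewrite lerBlDr addrC ge_min -lerBlDr /t; case: (leP n%:R l) => ?;
    rewrite -natr1 ?addrK ?lexx ?orbT//; lra.
have sum n : d (al i) (gam (t n)) + d (gam (t n)) (al k) = l.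
  have [h1 h2 _] := gamP _ (t01 n); rewrite h1 (dC dM _ (al k)) h2; lra.
have [[n0 n0j]|none] := pselect (exists n, j <= idx (gam (t n))).
  have [n nj nmin] := ex_minnP (ex_intro (fun n => j <= idx (gam (t n))) n0 n0j).
  exists (gam (t n)), (idx (gam (t n))); split => //; last lia.
  case: n nj nmin => [|n] nj nmin.
    suff : idx (gam (t 0%N)) <= i + C%:Z by lia.
    apply: (CP _ (al i) _ _ (idxP _)); first exact: (proj_self_in dM _ (aK.2.1 _)).
    have [h1 _ _] := gamP _ (t01 0%N); rewrite (dC dM) h1 /t minEle.
    by rewrite l0.
  suff : idx (gam (t n)) < j by have := step n; lia.
  by rewrite ltNge; apply/negP => /nmin; rewrite ltnn.
(* If no sample reaches [j], the last one still does the job: it is [al k] itself, so its index is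
   below [j <= k] and yet at least [k - C]. *)
have [n ln] := archi_nat l; exists (gam (t n)), (idx (gam (t n))).
have lt_j : idx (gam (t n)) < j by rewrite ltNge; apply/negP => h; apply: none; exists n.
split => //; first lia.
suff : k <= idx (gam (t n)) + C%:Z by lia.
apply: (CP (al k) (gam (t n)) _ _ _ (idxP _)).
  exact: (proj_self_in dM _ (aK.2.1 _)).
have [_ h2 _] := gamP _ (t01 n); rewrite h2 /t minEle.
by case: ifP => _; lra.
Qed.

(** The way from [x] to [y] is forced along the axis from [al i] to [al j], and the origin lies
    either between these points or at bounded distance from [al i]. The gap [g] comes before [N], so
    that thresholds can be chosen in terms of it. *)
Lemma separated_gromov : exists g : nat, forall N : nat, exists D : R,
  forall x y (i j : int), P x i -> P y j -> i <= N%:Z -> N%:Z + g%:Z <= j ->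
  gromov d o x y <= D.
Proof.
have [g gP] := idx_detour; have [B BP] := axis_between.
exists g => N; have [B' BP'] := pos_close N.
exists (B + 2 * B' + 12 * K) => x y i j xi yj iN Nj.
have h1 := gP _ _ _ _ xi yj (or_introl (_ : i + g%:Z <= j)).
have {}h1 := h1 ltac:(lia).
have B'0 : 0 <= B'.
  by apply: le_trans (d_ge0 dM (al 0) (al 0)) _; apply: BP'; lia.
have B0 : 0 <= B by have := BP 0 0 0 (lexx _) (lexx _); rewrite !(dxx dM); lra.
have h2 := dtri dM (al i) o x; have h3 := dtri dM (al j) o y.
have k1 := K1.
have h4 : d o (al i) + d o (al j) - d (al i) (al j) <= B + 2 * B'.
  case: (leP i 0) => i0.
    by have := BP i 0 j i0 ltac:(lia); rewrite al0 (dC dM (al i) o); lra.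
  have : d (al 0) (al i) <= B' by apply: BP'; lia.
  by have := dtri dM (al i) o (al j); rewrite al0; lra.
rewrite /gromov; have := d_ge0 dM x y.
by move: h1 h2 h3; rewrite (dC dM x (al i)) (dC dM (al j) y); lra.
Qed.

(* Tree picture: [f o] lies far along the axis, [f^-1 o] does not lie ahead of
   the origin, so the geodesic from [o] to [f y] must pass near [f o], and
   cannot turn back along the axis before reaching it. *)
Lemma axis_link : exists g : nat, forall L : nat, exists C M0 : nat,
  forall (f : G) (y : X) (T : int), M0%:Z <= T ->
  (forall i, P (act f o) i -> T <= i) ->
  (forall i, P (act f^-1%g o) i -> i <= L%:Z) ->
  (exists i, P y i /\ L%:Z + g%:Z <= i) ->
  forall k, P (act f y) k -> T <= k + C%:Z.
Proof.
have [g gP] := separated_gromov; have [g' gP'] := idx_detour.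
have [B BP] := axis_between.
exists g => L; have [D DP] := gP L.
have [C CP] := idx_close (2 * D + 24 * K + B).
exists (C + g')%N, C.+1 => f y T M0T hT hL [i2 [yi2 Li2]] k yk.
have [i1 fi1] := ex_idx (act f^-1%g o).
have [ip fip] := ex_idx (act f o).
have := DP _ _ _ _ fi1 yi2 (hL _ fi1) Li2.
rewrite /gromov act_isoV.
rewrite (dC dM o (act f^-1%g o)) act_isoV -(act_iso f o y) => h0.
have Tip := hT _ fip.
have [|ipk] := leP ip (k + g'%:Z); first by rewrite PoszD; lia.
have h1 := gP' _ _ _ _ fip yk (or_intror (ltW ipk)).
have h2 := detour_in 0 fip; rewrite al0 in h2.
have h3 := dtri dM (al k) o (act f y).
have k1 := K1; have p1 := d_ge0 dM (act f o) (al ip).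
rewrite (dC dM (al ip) (act f o)) in h2.
have h4 : d o (al ip) + d (al ip) (al k) <= d o (al k) + 2 * D + 24 * K by lra.
have [k0|k0] := leP 0 k.
  have := BP 0 k ip k0 ltac:(lia); rewrite al0 (dC dM (al k)) => h5.
  have : d (al ip) (al k) <= 2 * D + 24 * K + B.
    by have := d_ge0 dM (al ip) (al k); lra.
  by move=> /CP; rewrite PoszD; lia.
have := BP k 0 ip (ltW k0) ltac:(lia); rewrite al0 (dC dM (al k)) => h5.
have : d (al ip) (al 0) <= 2 * D + 24 * K + B.
  by rewrite al0 (dC dM (al ip)); rewrite (dC dM (al k)) in h5; have := d_ge0 dM o (al ip); lra.
by move=> /CP; lia.
Qed.

End Axis.

(** * Words over the group and their weights *)

Section Words.
Local Open Scope group_scope.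
Variable G : groupType.

Definition gprod (s : seq G) : G := foldr (fun x y => x * y) 1 s.

Lemma gprod_cat s t : gprod (s ++ t) = gprod s * gprod t.
Proof. by elim: s => [|x s IH] /=; rewrite ?mul1g// IH mulgA. Qed.

Lemma gprod_rcons s x : gprod (rcons s x) = gprod s * x.
Proof. by rewrite -cats1 gprod_cat /= mulg1. Qed.

Definition inv_word (s : seq G) : seq G := [seq x^-1 | x <- rev s].

Lemma gprod_inv s : gprod (inv_word s) = (gprod s)^-1.
Proof.
elim: s => [|x s IH]; first by rewrite /= invg1.
by rewrite /inv_word rev_cons map_rcons gprod_rcons IH invgM.
Qed.

Lemma inv_wordK : involutive inv_word.
Proof.
by move=> s; rewrite /inv_word -map_rev revK -map_comp map_id_in// => x _ /=; rewrite invgK.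
Qed.

Lemma size_inv_word s : size (inv_word s) = size s.
Proof. by rewrite size_map size_rev. Qed.

Lemma inv_word_cat s t : inv_word (s ++ t) = inv_word t ++ inv_word s.
Proof. by rewrite /inv_word rev_cat map_cat. Qed.

Definition rep n (s : seq G) : seq G := flatten (nseq n s).

Lemma gprod_rep n s : gprod (rep n s) = gprod s ^+ n.
Proof. by elim: n => [|n IH] //; rewrite /rep /= gprod_cat IH expgS. Qed.

Lemma size_rep n s : size (rep n s) = (n * size s)%N.
Proof. by elim: n => [|n IH] //; rewrite /rep /= size_cat IH mulSn. Qed.

Variables (R : realType) (mu : G -> R).

Definition weight (s : seq G) : R := (\prod_(x <- s) mu x)%R.

Lemma weight_cat s t : weight (s ++ t) = (weight s * weight t)%R.
Proof. exact: big_cat. Qed.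

Lemma weight_rep n s : weight (rep n s) = (weight s ^+ n)%R.
Proof.
elim: n => [|n IH]; first by rewrite expr0 /weight big_nil.
by rewrite exprS -IH -weight_cat.
Qed.

Lemma semigroup_word g : semigroup_gen (support mu) g ->
  exists s, [/\ (0 < size s)%N, (0 < weight s)%R & gprod s = g].
Proof.
elim=> [h Sh|h k _ [s [s0 ws <-]] _ [t [_ wt <-]]].
  by exists [:: h]; rewrite /weight big_seq1 /= mulg1.
exists (s ++ t); rewrite size_cat weight_cat gprod_cat mulr_gt0//.
by rewrite (leq_trans s0) ?leq_addr.
Qed.

End Words.

(** * Two independent axes *)

Section Independence.
Local Open Scope ring_scope.
Variables (R : realType) (X : Type) (d : X -> X -> R) (G : groupType).
Variables (act : G -> X -> X) (o : X) (K : R).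
Hypotheses (dM : is_metric d) (dG : geodesic_space d).
Hypotheses (actP : isometric_faithful_action d act) (K1 : 1 <= K).

Local Notation al a := (orbit_seq act o a).
Local Notation P a z i := (proj d (range (al a)) z (al a i)).
Local Notation axis a := (contracting_axisZ d K (al a)).

Lemma independentC a b :
  independent_isometries d act o a b -> independent_isometries d act o b a.
Proof.
move=> ab M M0; have [N NP] := ab M M0; exists N => n m.
by rewrite (dC dM) => /NP[].
Qed.

(** Project back: if [al a i] goes to [al b j], and [al b j] to [al a m], the detour inequalities
    through [o], which lies on both axes, give [2 * d (al a m) (al b j) <= 36 * K]. So independence
    is invoked at radius [19 * K]. *)
Lemma idx_other_axis a b : axis a -> axis b ->
  independent_isometries d act o a b ->
  exists N : nat, forall i j : int, P b (al a i) j -> (`|j| <= N)%N.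
Proof.
move=> aK bK ab; have k1 := K1; have [|N NP] := ab (19 * K); first lra.
exists N => i j pj; have [m pm] := ex_idx aK (al b j).
suff : d (al a m) (al b j) < 19 * K by move=> /NP[].
have := detour_in dM dG K1 bK 0 pj; rewrite (al0 _ _ actP).
have := detour_in dM dG K1 aK 0 pm; rewrite (al0 _ _ actP).
have := detour_in dM dG K1 aK i pm; have := dtri dM (al a m) o (al a i).
by rewrite (dC dM (al a m) (al a i)) (dC dM (al b j) (al a i)); lra.
Qed.

(** If both indices were large, the way from [al a i] to [z] would pass near [al b j], and the way
    from [al b j] to [z] near [al a i]. Adding the two detours cancels the distances to [z] and
    leaves at most [24 * K] for a long piece of the axis of [b]. *)
Lemma independent_axes a b : axis a -> axis b ->
  independent_isometries d act o a b ->
  exists C : nat, forall z (i j : int), P a z i -> P b z j ->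
    (`|i| <= C)%N \/ (`|j| <= C)%N.
Proof.
move=> aK bK ab; have k1 := K1.
have [N1 N1P] := idx_other_axis aK bK ab.
have [N2 N2P] := idx_other_axis bK aK (independentC ab).
have [g1 g1P] := idx_detour dM dG K1 aK; have [g2 g2P] := idx_detour dM dG K1 bK.
have [C CP] := idx_close K1 bK (24 * K).
exists (N1 + N2 + g1 + g2 + C)%N => z i j pi pj.
have [?|ih] := leqP `|i| (N1 + N2 + g1 + g2 + C); first by left.
have [?|jh] := leqP `|j| (N1 + N2 + g1 + g2 + C); [by right | exfalso].
have [j' pj'] := ex_idx bK (al a i); have hj' := N1P _ _ pj'.
have [i' pi'] := ex_idx aK (al b j); have hi' := N2P _ _ pi'.
have h1 := g2P _ _ _ _ pj' pj ltac:(lia).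
have h2 := g1P _ _ _ _ pi' pi ltac:(lia).
have h3 : d (al b j') (al b j) <= 24 * K.
  have := d_ge0 dM (al a i) (al b j'); have := d_ge0 dM (al b j) (al a i').
  have := d_ge0 dM (al a i') (al a i); lra.
by have := CP _ _ h3; rewrite (dC dM) in h3; have := CP _ _ h3; lia.
Qed.

(* A point whose [a]-index is large in absolute value has a small [b]-index;
   a large power of [b] makes that index large, hence the [a]-index small. *)
Lemma axis_twist a b : axis a -> axis b ->
  independent_isometries d act o a b ->
  exists C : nat, forall (T : int) z i j, (C.*2 < `|T|)%N ->
    P a z i -> P a (act (zpow b T) z) j -> (C < `|i|)%N -> (`|j| <= C)%N.
Proof.
move=> aK bK ab; have [C CP] := independent_axes aK bK ab.
exists C => T z i j TC pi pj iC.
have [k pk] := ex_idx bK z; have pk' := idx_shift dM actP T pk.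
by case: (CP _ _ _ pi pk); [lia|]; case: (CP _ _ _ pj pk'); lia.
Qed.

End Independence.

(** * The Schottky alphabet *)

(** The spacing [2 * L + 1] makes the integer intervals of radius [L] around the multiples of [T]
    disjoint. *)
Lemma near_multiple_uniq (L T k k' : nat) (i : int) :
  T = L.*2.+1 -> (absz (i - (k * T)%N%:Z)%R <= L)%N ->
  (absz (i - (k' * T)%N%:Z)%R <= L)%N -> k = k'.
Proof.
move=> TE; wlog : k k' / (k <= k')%N.
  by move=> h; case/orP: (leq_total k k') => kk h1 h2; [|apply/esym]; exact: h.
move=> /subnKC <-; case: (k' - k)%N => [|e]; first by rewrite addn0.
by rewrite mulnDl mulSn TE; lia.
Qed.

Section Schottky.
Local Open Scope group_scope.
Variables (R : realType) (X : Type) (d : X -> X -> R) (G : groupType).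
Variables (act : G -> X -> X) (o : X).

(* [Up] and [V] are the strict tests for a later, resp. earlier, point of the
   path to be on the correct side of a letter whose midpoint is [o]; [U] is the
   half-space ahead of the letter. *)
Record schottky (mu : G -> R) (n m1 m2 : nat) (pw sw : 'I_n -> seq G)
    (U Up V : X -> Prop) : Prop := Schottky {
  sch_size_pw : forall k, size (pw k) = m1;
  sch_size_sw : forall k, size (sw k) = m2;
  sch_size_gt0 : (0 < m1 + m2)%N;
  sch_weight_pw : forall k k', weight mu (pw k) = weight mu (pw k');
  sch_weight_sw : forall k k', weight mu (sw k) = weight mu (sw k');
  sch_weight_pw_gt0 : forall k, (0 < weight mu (pw k))%R;
  sch_weight_sw_gt0 : forall k, (0 < weight mu (sw k))%R;
  sch_past : forall z k k', ~ V (act (gprod (pw k))^-1 z) ->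
    ~ V (act (gprod (pw k'))^-1 z) -> k = k';
  sch_future : forall z k k', ~ Up (act (gprod (sw k)) z) ->
    ~ Up (act (gprod (sw k')) z) -> k = k';
  sch_UpU : forall z, Up z -> U z;
  sch_VU : forall z, V z -> ~ U z;
  sch_Up : exists z, Up z;
  sch_V : exists z, V z;
  sch_nest : forall f, Up (act f o) -> V (act f^-1 o) ->
    forall z, U z -> U (act f z) }.

Hypotheses (dM : is_metric d) (dG : geodesic_space d).
Hypotheses (actP : isometric_faithful_action d act).

(** If undoing [pw k] leaves [z] outside [V], some index is above [L] when the block of [b] is
    applied again; the twist brings it down to at most [L] in absolute value, and the power of [a]
    in front moves it next to [k * T]. So the index of [z] reveals [k]. For suffixes it is near
    [- k * T]. *)
Lemma schottky_exists (mu : G -> R) (la lb : seq G) (K : R) (n : nat) :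
  (0 < size la)%N -> (0 < size lb)%N ->
  (0 < weight mu la)%R -> (0 < weight mu lb)%R -> (1 <= K)%R ->
  contracting_axisZ d K (orbit_seq act o (gprod la)) ->
  contracting_axisZ d K (orbit_seq act o (gprod lb)) ->
  independent_isometries d act o (gprod la) (gprod lb) ->
  exists m1 m2 (pw sw : 'I_n -> seq G) U Up V D,
    schottky mu m1 m2 pw sw U Up V /\
    forall f, Up (act f o) -> V (act f^-1 o) ->
      forall x z, ~ U x -> U z -> (gromov d o x (act f z) <= D)%R.
Proof.
set a := gprod la; set b := gprod lb => la0 lb0 wa wb K1 aK bK ab.
pose P z i := proj d (range (orbit_seq act o a)) z (orbit_seq act o a i).
have [L LP] := axis_twist dM dG actP K1 aK bK ab.
have [g1 sepP] := separated_gromov dM dG actP K1 aK.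
have [g2 /(_ L)[C [M0 linkP]]] := axis_link dM dG actP K1 aK.
(* [H] is at least [L + g2], as linking demands of the points of [U]. The linked image has index at
   least [M - L - C], which is at least [H + g1]: it is back in [U], and beyond [H] by the
   separation gap. *)
pose H := (L + g1 + g2).+1; pose M := (L + M0 + H + g1 + C)%N.
have [D DP] := sepP H.
have [T TE] : exists T, T = (L.*2).+1 by eexists.
(* In both families the sum of the exponents of [a] does not depend on [k], so length and weight do
   not either; only the place of the block of [b] does. *)
pose pw (k : 'I_n) := rep (k * T) la ++ rep T lb ++ rep ((n - k) * T) la.
pose sw (k : 'I_n) := rep M la ++ rep ((n - k) * T) la ++ rep T lb ++ rep (k * T) la.
pose U z := exists i, P z i /\ (H%:Z <= i)%R.
pose Up z := forall i, P z i -> (M%:Z - L%:Z <= i)%R.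
pose V z := forall i, P z i -> (i <= L%:Z)%R.
have nP (Q : int -> Prop) z : ~ (forall i, P z i -> Q i) -> exists i, P z i /\ ~ Q i.
  move=> h; apply: contrapT => h'; apply: h => i pi; apply: contrapT => qi.
  by apply: h'; exists i.
(* Indices of one and the same point differ by at most [C0]; this margin yields points all of whose
   indices satisfy [Up], resp. [V]. *)
have [C0 C0P] := idx_close K1 aK 0%R.
exists ((n * T) * size la + T * size lb)%N.
exists (M * size la + ((n * T) * size la + T * size lb))%N.
exists pw, sw, U, Up, V, D; split; last first.
  move=> f hf hV x z xU [j [pj Hj]].
  have [i pi] := ex_idx aK x; have [k pk] := ex_idx aK (act f z).
  apply: (DP _ _ _ _ pi pk).
    by rewrite leNgt; apply/negP => h; apply: xU; exists i; split => //; lia.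
  have := linkP f z (M%:Z - L%:Z)%R _ hf hV _ _ pk; rewrite /M /H => h.
  suff : (M%:Z - L%:Z <= k + C%:Z)%R by rewrite /M /H; lia.
  by apply: h; [lia | exists j; split => //; rewrite /H in Hj; lia].

have zposE x (m : nat) : zpow x m%:Z = x ^+ m :> G by [].
have szA (k : 'I_n) : (k * T + (n - k) * T = n * T)%N.
  by rewrite -mulnDl subnKC// ltnW.
split.
- by move=> k; rewrite !size_cat !size_rep -(szA k) mulnDl addnA addnAC.
- move=> k; rewrite !size_cat !size_rep -(szA k) mulnDl; congr addn.
  by rewrite addnCA [RHS]addnC; congr addn; rewrite addnC.
- by rewrite TE; move: lb0; case: (size lb) => // q _; lia.
- move=> k k'; rewrite !weight_cat !weight_rep mulrCA [RHS]mulrCA.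
  by rewrite -!exprD !szA.
- move=> k k'; rewrite !weight_cat !weight_rep; congr (_ * _)%R.
  by rewrite mulrCA [RHS]mulrCA -!exprD ![((n - _) * T + _)%N]addnC !szA.
- by move=> k; rewrite !weight_cat !weight_rep !mulr_gt0// exprn_gt0.
- by move=> k; rewrite !weight_cat !weight_rep !mulr_gt0// exprn_gt0.
- suff twist z k : ~ V (act (gprod (pw k))^-1 z) ->
      forall i, P z i -> (absz (i - (k * T)%N%:Z)%R <= L)%N.
    move=> z k k' /twist h1 /twist h2; have [i pi] := ex_idx aK z.
    exact/val_inj/(near_multiple_uniq TE (h1 _ pi) (h2 _ pi)).
  move=> /nP[i [pi /negP]]; rewrite -ltNge => iL j pj.
  have e : z = act (zpow a (k * T)%N) (act (zpow b T) (act (zpow a ((n - k) * T)%N)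
      (act (gprod (pw k))^-1 z))).
    rewrite -!(actM actP) !zposE ?mulgA /a /b -!gprod_rep -!gprod_cat -!catA.
    by rewrite -/(pw k) mulgV (act1 actP).
  set z' := act (gprod _)^-1 z in e pi.
  have pi' := idx_shift dM actP ((n - k) * T)%N pi.
  move: pj; rewrite e => /(idx_shiftV dM actP) pj.
  apply: (LP T%:Z _ _ _ _ pi' pj); first by rewrite absz_nat TE.
  have : (0 <= ((n - k) * T)%N%:Z :> int)%R by [].
  lia.
- suff twist z k : ~ Up (act (gprod (sw k)) z) ->
      forall i, P z i -> (absz (i + (k * T)%N%:Z)%R <= L)%N.
    move=> z k k' /twist h1 /twist h2; have [i pi] := ex_idx aK z.
    apply/val_inj/(@near_multiple_uniq L T _ _ (- i)%R TE).
      by rewrite -opprD abszN; exact: h1.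
    by rewrite -opprD abszN; exact: h2.
  move=> /nP[i [pi /negP]]; rewrite -ltNge => iL j pj.
  pose y := act (zpow b T) (act (zpow a (k * T)%N) z).
  have e : act (gprod (sw k)) z = act (zpow a (M + (n - k) * T)%N) y.
    rewrite /y -!(actM actP) !zposE expgnDr ?mulgA /a /b -!gprod_rep -!gprod_cat.
    by rewrite /sw -!catA.
  move: pi; rewrite e => /(idx_shiftV dM actP) pi.
  have ey : act (zpow a (k * T)%N) z = act (zpow b (- T%:Z)%R) y.
    by rewrite /y -(actM actP) -zpowD addNr (act1 actP).
  have pj' := idx_shift dM actP (k * T)%N pj; rewrite ey in pj'.
  have hT : (L.*2 < absz (- T%:Z)%R)%N by rewrite abszN absz_nat TE.
  have h : (0 <= ((n - k) * T)%N%:Z :> int)%R by [].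
  have hi : (L < absz (i - (M + (n - k) * T)%N%:Z)%R)%N by rewrite PoszD; lia.
  by rewrite addrC; apply: (LP _ _ _ _ hT pi pj' hi).
- move=> z hz; have [i pi] := ex_idx aK z; exists i; split => //.
  by have := hz _ pi; rewrite /M /H; lia.
- by move=> z hz [i [/hz + ]]; rewrite /H; lia.
- exists (orbit_seq act o a (M%:Z + C0%:Z)%R) => i pi.
  have : (M%:Z + C0%:Z <= i + C0%:Z)%R.
    apply: C0P; rewrite (_ : orbit_seq act o a i = orbit_seq act o a (M%:Z + C0%:Z)%R).
      by rewrite (dxx dM).
    by apply: (proj_self dM _ pi); exists (M%:Z + C0%:Z)%R.
  by lia.
- exists (orbit_seq act o a (- C0%:Z)%R) => i pi.
  have : (i <= - C0%:Z + C0%:Z)%R.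
    apply: C0P; rewrite (_ : orbit_seq act o a i = orbit_seq act o a (- C0%:Z)%R).
      by rewrite (dxx dM).
    by apply: (proj_self dM _ pi); exists (- C0%:Z)%R.
  by lia.
- move=> f hf hV z [j [pj Hj]]; have [i pi] := ex_idx aK (act f z).
  exists i; split => //.
  have := linkP f z (M%:Z - L%:Z)%R _ hf hV _ _ pi; rewrite /M /H => h.
  suff : (M%:Z - L%:Z <= i + C%:Z)%R by rewrite /M /H; lia.
  by apply: h; [lia | exists j; split => //; rewrite /H in Hj; lia].
Qed.

Lemma weight_inv_word (mu : G -> R) s :
  weight (fun g => mu g^-1) (inv_word s) = weight mu s.
Proof.
rewrite /weight big_map (perm_big s) ?perm_rev//=.
by apply: eq_bigr => x _; rewrite invgK.
Qed.

(** Inverting the words exchanges prefix with suffix and past with future, and turns the half-space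
    into its complement. Results on forward paths thereby apply to reversed ones. *)
Lemma schottky_mirror mu n m1 m2 (pw sw : 'I_n -> seq G) U Up V :
  schottky mu m1 m2 pw sw U Up V ->
  schottky (fun g => mu g^-1) m2 m1 (fun k => inv_word (sw k))
    (fun k => inv_word (pw k)) (fun z => ~ U z) V Up.
Proof.
case=> s1 s2 s0 w1 w2 w10 w20 sp sf UpU VU [zU hU] [zV hV] nest; split.
- by move=> k; rewrite size_inv_word.
- by move=> k; rewrite size_inv_word.
- by rewrite addnC.
- by move=> k k'; rewrite !weight_inv_word.
- by move=> k k'; rewrite !weight_inv_word.
- by move=> k; rewrite weight_inv_word.
- by move=> k; rewrite weight_inv_word.
- by move=> z k k'; rewrite !gprod_inv !invgK; exact: sf.
- by move=> z k k'; rewrite !gprod_inv; exact: sp.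
- by move=> z /VU.
- by move=> z /UpU Uz; apply.
- by exists zV.
- by exists zU.
- move=> f hf hf' z zU' fz; apply: zU'; rewrite -(actK actP f z).
  by apply: nest => //; rewrite invgK.
Qed.

End Schottky.

(** * The stack machine *)

Section StackMachine.
Local Open Scope nat_scope.

Definition pop (p : pred nat) (s : seq nat) : seq nat := drop (find (predC p) s) s.

(* [rb i j]: the letter [i] is not aligned with the later letter [j];
   [lb i j]: the letter [j] is not aligned with the earlier letter [i]. *)
Fixpoint stack (S : pred nat) (rb lb : nat -> nat -> bool) (t : nat) : seq nat :=
  if t is t'.+1 then
    if S t' then
      let s := pop (rb^~ t') (stack S rb lb t') in
      if s is i :: _ then if lb i t' then s else t' :: s else [:: t']
    else stack S rb lb t'
  else [::].

Lemma stack_lt S rb lb t : all (fun i => i < t) (stack S rb lb t).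
Proof.
elim: t => //= t IH.
have w s : all (fun i => i < t) s -> all (fun i => i < t.+1) s.
  by apply: sub_all => i; exact: ltnW.
case: (S t); last exact: w.
have : all (fun i => i < t) (pop (rb^~ t) (stack S rb lb t)).
  by apply/allP => i /mem_drop; exact: (allP IH).
case: (pop _ _) => [|i s] h; first by rewrite /= ltnSn.
by case: ifP => _; [exact: w|apply/andP; split; [exact: ltnSn|exact: (w (i :: s))]].
Qed.

Lemma eq_pop (p p' : pred nat) s : {in s, p =1 p'} -> pop p s = pop p' s.
Proof. by move=> pp; rewrite /pop (@eq_in_find _ _ (predC p'))// => i /pp /= ->. Qed.

Lemma eq_stack S S' rb rb' lb lb' t : (forall i, i < t -> S i = S' i) ->
  (forall i j, i < j < t -> rb i j = rb' i j) ->
  (forall i j, i < j < t -> lb i j = lb' i j) ->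
  stack S rb lb t = stack S' rb' lb' t.
Proof.
elim: t => //= t IH hS hr hl; rewrite hS//.
rewrite IH => [|i it|i j ijt|i j ijt]; [|by apply: hS; lia|by apply: hr; lia|by apply: hl; lia].
rewrite (@eq_pop _ (rb'^~ t)) => [|i /(allP (stack_lt _ _ _ _)) it]; last by apply: hr; lia.
have := allP (stack_lt S' rb' lb' t); rewrite /pop; set r := find _ _ => h.
case: ifP => // _; case E : (drop r _) => [|i s] //; rewrite hl// ltnSn andbT.
by apply/h/(@mem_drop r); rewrite E mem_head.
Qed.

(* The possible histories of the machine: the stack, the popped letters [i]
   with the time [j] of their removal, as [(i, j)], and the letters [j] that
   were not pushed with the top [i] that rejected them, as [(j, i)]. *)
Definition history := (seq nat * seq (nat * nat) * seq (nat * nat))%type.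

(** [r] letters are popped at time [t]. Rejection needs a letter left on the stack to reject, so
    each [r] has one or two outcomes. *)
Definition history_step (t : nat) (h : history) (r : nat) : seq history :=
  let s := drop r h.1.1 in
  let popped := [seq (i, t) | i <- take r h.1.1] ++ h.1.2 in
  (t :: s, popped, h.2) ::
    (if s is i :: _ then [:: (s, popped, (t, i) :: h.2)] else [::]).

Fixpoint histories (S : pred nat) (t : nat) : seq history :=
  if t is t'.+1 then
    if S t' then
      flatten [seq flatten [seq history_step t' h r | r <- iota 0 (size h.1.1).+1]
              | h <- histories S t']
    else histories S t'
  else [:: ([::], [::], [::])].

Lemma historiesS S t : histories S t.+1 =
  if S t then
    flatten [seq flatten [seq history_step t h r | r <- iota 0 (size h.1.1).+1]
            | h <- histories S t]
  else histories S t.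
Proof. by []. Qed.

Lemma all_take_find (p : pred nat) s : all p (take (find (predC p) s) s).
Proof. by elim: s => //= x s IH; case: (boolP (p x)) => //= ->. Qed.

Lemma stack_history S rb lb t : exists2 h, h \in histories S t &
  [/\ h.1.1 = stack S rb lb t, all (fun p => rb p.1 p.2) h.1.2 &
      all (fun p => lb p.2 p.1) h.2].
Proof.
elim: t => [|t [h hin [hs hr hl]]]; first by exists ([::], [::], [::]).
rewrite historiesS [stack _ _ _ t.+1]/=; case: ifP => St; last by exists h.
set r := find (predC (rb^~ t)) h.1.1.
have hr' : all (fun p => rb p.1 p.2) ([seq (i, t) | i <- take r h.1.1] ++ h.1.2).
  by rewrite all_cat hr andbT all_map; exact: (all_take_find (rb^~ t)).
have sub h' : h' \in history_step t h r ->
    h' \in flatten [seq flatten [seq history_step t h r | r <- iota 0 (size h.1.1).+1]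
              | h <- histories S t].
  move=> h'in; apply/flatten_mapP; exists h => //; apply/flatten_mapP; exists r => //.
  by rewrite mem_iota add0n ltnS /= find_size.
rewrite /pop -hs -/r.
case E : (drop r h.1.1) => [|i s].
  exists ([:: t], [seq (i, t) | i <- take r h.1.1] ++ h.1.2, h.2) => //.
  by apply: sub; rewrite /history_step E inE eqxx.
case: ifP => li.
  exists (i :: s, [seq (i, t) | i <- take r h.1.1] ++ h.1.2, (t, i) :: h.2).
    by apply: sub; rewrite /history_step E !inE eqxx orbT.
  by split=> //=; rewrite li.
exists (t :: i :: s, [seq (i, t) | i <- take r h.1.1] ++ h.1.2, h.2) => //.
by apply: sub; rewrite /history_step E inE eqxx.
Qed.

(** The blamed letters are therefore distinct, and their number is the count of letters minus the
    height of the stack; the order of the times decides which label a blame tests. *)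
Lemma histories_inv S t h : h \in histories S t ->
  [/\ perm_eq (h.1.1 ++ [seq p.1 | p <- h.1.2] ++ [seq p.1 | p <- h.2])
              [seq i <- iota 0 t | S i],
      all (fun p => p.1 < p.2 < t) h.1.2 & all (fun p => p.2 < p.1 < t) h.2].
Proof.
elim: t h => [|t IH] h; first by rewrite inE => /eqP ->.
have wR t' (s : seq (nat * nat)) : all (fun p => p.1 < p.2 < t') s -> all (fun p => p.1 < p.2 < t'.+1) s.
  by apply: sub_all => p; lia.
have wL t' (s : seq (nat * nat)) : all (fun p => p.2 < p.1 < t') s -> all (fun p => p.2 < p.1 < t'.+1) s.
  by apply: sub_all => p; lia.
rewrite historiesS -[X in iota _ X]addn1 iotaD add0n filter_cat [seq.filter S (iota t 1)]/=; case: ifP => St; last first.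
  by rewrite cats0 => /IH[pe hr hl]; split=> //; [exact: wR|exact: wL].
move=> /flatten_mapP[h0 /IH[pe hr hl] hin]; have /flatten_mapP[r _] := hin.
have lt0 : all (fun i => i < t) h0.1.1.
  apply/allP => i ih; have : i \in [seq i <- iota 0 t | S i].
    by rewrite -(perm_mem pe) mem_cat ih.
  by rewrite mem_filter mem_iota => /andP[_]; lia.
have hr' : all (fun p => p.1 < p.2 < t.+1) ([seq (i, t) | i <- take r h0.1.1] ++ h0.1.2).
  rewrite all_cat (wR _ _ hr) andbT all_map; apply/allP => i /mem_take ih /=.
  by have := allP lt0 _ ih; lia.
have pe' : perm_eq (drop r h0.1.1 ++ [seq p.1 | p <- [seq (i, t) | i <- take r h0.1.1] ++ h0.1.2]
    ++ [seq p.1 | p <- h0.2]) [seq i <- iota 0 t | S i].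
  apply: perm_trans pe; rewrite map_cat -map_comp map_id !catA perm_cat2r.
  by rewrite -catA perm_catCA catA cat_take_drop.
rewrite /history_step inE => /orP[/eqP ->|].
  split=> //=; last exact: wL.
  by apply/permP => p; move/permP/(_ p): pe'; rewrite /= !count_cat /=; lia.
move: pe'; case E : (drop r h0.1.1) => [|i s] //= pe'; rewrite inE => /eqP -> /=.
split=> //=; last first.
  rewrite wL// ltnSn !andbT; apply: (allP lt0); apply: (@mem_drop r).
  by rewrite E inE eqxx.
by apply/permP => p; move/permP/(_ p): pe'; rewrite /= !count_cat /=; lia.
Qed.

Lemma sum_pow2_drop n : \sum_(r <- iota 0 n.+1) 2 ^ (n - r).+1 <= 4 * 2 ^ n.
Proof.
suff : \sum_(r <- iota 0 n.+1) 2 ^ (n - r).+1 + 2 = 4 * 2 ^ n by lia.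
rewrite (_ : iota 0 n.+1 = index_iota 0 n.+1) ?big_mkord; last first.
  by rewrite /index_iota subn0.
rewrite (reindex_inj rev_ord_inj) /=.
under eq_bigr => i _ do rewrite subSS subKn ?leq_ord// expnS.
rewrite -big_distrr /=; have := predn_exp 2 n.+1.
rewrite /= mul1n => <-; have : 0 < 2 ^ n by rewrite expn_gt0.
by rewrite expnS; lia.
Qed.

(** The number of possible pops grows with the stack, so high stacks are charged a weight [2 ^ n].
    One letter turns this into at most [4 * 2 ^ n] by pushing and half as much by rejecting, whence
    the [6]. *)
Lemma history_weight S t :
  \sum_(h <- histories S t) 2 ^ size h.1.1 <= 6 ^ count S (iota 0 t).
Proof.
elim: t => [|t IH]; first by rewrite big_seq1.
rewrite historiesS -[X in iota _ X]addn1 iotaD add0n count_cat [count S (iota t 1)]/= addn0.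
case: (S t); last by rewrite addn0.
rewrite addn1 expnS; apply: leq_trans (leq_mul (leqnn 6) IH).
rewrite big_flatten big_map big_distrr; apply: leq_sum => h _.
rewrite big_flatten big_map.
set n := size h.1.1.
apply: (@leq_trans (\sum_(r <- iota 0 n.+1) (2 ^ (n - r).+1 + 2 ^ (n - r)))).
  rewrite big_seq [X in _ <= X]big_seq; apply: leq_sum => r _.
  rewrite /history_step big_cons /= size_drop -/n leq_add2l.
  have := size_drop r h.1.1; rewrite -/n; case: (drop r h.1.1) => [|i s] <-.
    by rewrite big_nil.
  by rewrite big_seq1.
have := sum_pow2_drop n; rewrite big_split /= => h1.
have : \sum_(r <- iota 0 n.+1) 2 ^ (n - r).+1 = 2 * \sum_(r <- iota 0 n.+1) 2 ^ (n - r).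
  by rewrite big_distrr; apply: eq_bigr => r _; rewrite expnS.
move: h1; move: (\sum_(_ <- _) _) (\sum_(_ <- _) _) (2 ^ n) => a b c; lia.
Qed.

Lemma card_union_bound (L : finType) (T : eqType) (s : seq T) (A : T -> pred L)
    (Q : pred L) :
  (forall l, Q l -> exists2 x, x \in s & A x l) -> #|Q| <= \sum_(x <- s) #|A x|.
Proof.
elim: s Q => [|x s IH] Q h.
  rewrite big_nil leqn0; apply/eqP/eq_card0 => l.
  by apply/negP => /h[].
rewrite big_cons -(cardID (A x) Q) leq_add//.
  by apply: subset_leq_card; apply/fintype.subsetP => l; rewrite inE => /andP[].
apply: IH => l; rewrite inE => /andP[nA /h[y]]; rewrite inE => /orP[/eqP ->|ys].
  by move: nA; rewrite unfold_in => /negP.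
by exists y.
Qed.

(* Union bound over the histories: a history with many removals blames many
   distinct letters, and by hypothesis blaming [n] letters costs [B ^ n]. *)
Lemma stack_union_bound (L : finType) (S : pred nat) (t : nat)
    (rb lb : L -> nat -> nat -> bool) (B : nat) (q := count S (iota 0 t)) :
  (forall n, q <= 8 * n -> 12 ^ q <= B ^ n) ->
  (forall s : seq (nat * nat), uniq [seq p.1 | p <- s] ->
     all (fun p => S p.1 && (p.1 < p.2 <= t)) s ->
     B ^ size s * #|[pred l | all (fun p => rb l p.1 p.2) s]| <= #|L|) ->
  (forall s : seq (nat * nat), uniq [seq p.1 | p <- s] ->
     all (fun p => S p.1 && (p.2 < p.1 < t)) s ->
     B ^ size s * #|[pred l | all (fun p => lb l p.2 p.1) s]| <= #|L|) ->
  2 ^ q * #|[pred l | 4 * size (pop ((rb l)^~ t) (stack S (rb l) (lb l) t)) < 3 * q]|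
    <= #|L|.
Proof.
move=> powB HR HL.
pose blame (h : history) r l :=
  all (fun p => rb l p.1 p.2) ([seq (i, t) | i <- take r h.1.1] ++ h.1.2) &&
  all (fun p => lb l p.2 p.1) h.2.
pose cond (h : history) r := 4 * (size h.1.1 - r) < 3 * q.
have cov : #|[pred l | 4 * size (pop ((rb l)^~ t) (stack S (rb l) (lb l) t)) < 3 * q]| <=
    \sum_(h <- histories S t) \sum_(r <- iota 0 (size h.1.1).+1)
      #|[pred l | cond h r && blame h r l]|.
  apply: (@leq_trans (\sum_(hr <- [seq (h, r) | h <- histories S t,
      r <- iota 0 (size h.1.1).+1]) #|[pred l | cond hr.1 hr.2 && blame hr.1 hr.2 l]|));
    last by rewrite big_allpairs_dep.
  apply: card_union_bound => l; have [h hin [hs hr hl]] := stack_history S (rb l) (lb l) t.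
  rewrite inE /pop -hs size_drop; set r := find _ _ => lt_q.
  exists (h, r).
    by apply/allpairsPdep; exists h, r; split; rewrite // mem_iota ltnS find_size.
  rewrite inE /cond lt_q /blame hl andbT all_cat hr andbT all_map.
  exact: (all_take_find ((rb l)^~ t)).
(* Fewer than [3 * q / 4] survivors leave more than [q / 4] removals, so pops or rejections alone
   make up at least [q / 8]. *)
have aux a b c n : 4 * a < 3 * n -> a + (b + c) = n -> n <= 8 * b \/ n <= 8 * c.
  by lia.
have term h r : h \in histories S t -> r <= size h.1.1 ->
    12 ^ q * #|[pred l | cond h r && blame h r l]| <= #|L|.
  move=> hin rs; case: (boolP (cond h r)) => lt_q; last by rewrite (eq_card0 (fun _ => _)) ?muln0.
  have [pe hr hl] := histories_inv hin.
  set RB := [seq (i, t) | i <- take r h.1.1] ++ h.1.2.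
  have pe' : perm_eq (drop r h.1.1 ++ [seq p.1 | p <- RB] ++ [seq p.1 | p <- h.2])
      [seq i <- iota 0 t | S i].
    apply: perm_trans pe; rewrite map_cat -map_comp map_id !catA perm_cat2r.
    by rewrite perm_cat2r perm_catC cat_take_drop.
  have un : uniq (drop r h.1.1 ++ [seq p.1 | p <- RB] ++ [seq p.1 | p <- h.2]).
    by rewrite (perm_uniq pe') filter_uniq// iota_uniq.
  have mem i : i \in drop r h.1.1 ++ [seq p.1 | p <- RB] ++ [seq p.1 | p <- h.2] -> S i && (i < t).
    by rewrite (perm_mem pe') mem_filter mem_iota.
  have sz : size h.1.1 - r + (size RB + size h.2) = q.
    have := perm_size pe'; rewrite 2!size_cat size_drop 2!(size_map fst) size_filter.
    by move=> e; rewrite /q -e.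
  move: un; rewrite !cat_uniq => /and3P[_ _ /and3P[uR _ uL]].
  have HR' : B ^ size RB * #|[pred l | all (fun p => rb l p.1 p.2) RB]| <= #|L|.
    apply: HR => //; apply/allP => p pR.
    have /andP[-> pt] : S p.1 && (p.1 < t).
      by apply: mem; rewrite !mem_cat (map_f fst pR) ?orbT.
    move: pR; rewrite mem_cat => /orP[/mapP[i _ e]|/(allP hr)]; last by lia.
    by move: pt; rewrite e /= leqnn andbT.
  have HL' : B ^ size h.2 * #|[pred l | all (fun p => lb l p.2 p.1) h.2]| <= #|L|.
    apply: HL => //; apply/allP => p pL.
    have /andP[-> pt] : S p.1 && (p.1 < t).
      by apply: mem; rewrite !mem_cat (map_f fst pL) ?orbT.
    by move/(allP hl): pL; lia.
  have [big|big] := aux _ _ _ _ lt_q sz.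
    apply: leq_trans HR'; apply: leq_mul; first exact: powB.
    by apply: subset_leq_card; apply/fintype.subsetP => l; rewrite !inE => /and3P[].
  apply: leq_trans HL'; apply: leq_mul; first exact: powB.
  by apply: subset_leq_card; apply/fintype.subsetP => l; rewrite !inE => /and3P[].
(* [12 ^ q] pays for the [6 ^ q] of the histories and leaves [2 ^ q]. The [size + 1] choices of the
   final pop are absorbed by the weight [2 ^ size] of the history. *)
rewrite -(leq_pmul2l (_ : 0 < 6 ^ q)) ?expn_gt0// mulnA -expnMn.
apply: leq_trans (leq_mul (leqnn _) cov) _; rewrite big_distrr /=.
apply: leq_trans (leq_mul (history_weight S t) (leqnn _)); rewrite big_distrl /=.
rewrite big_seq [X in _ <= X]big_seq; apply: leq_sum => h hin.
apply: (@leq_trans ((size h.1.1).+1 * #|L|)); last by rewrite leq_mul// ltn_expl.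
rewrite big_distrr; apply: (@leq_trans (\sum_(r <- iota 0 (size h.1.1).+1) #|L|));
  last by rewrite big_const_seq count_predT size_iota iter_addn_0 mulnC.
rewrite big_seq [X in _ <= X]big_seq; apply: leq_sum => r.
by rewrite -[0 :: _]/(iota 0 (size h.1.1).+1) mem_iota ltnS; exact: term.
Qed.

End StackMachine.

(** * Counting the labels that fail given tests *)

Section Fibers.
Local Open Scope nat_scope.

(** [upd] splits [L] into fibres of size [#|A|]; [Q] is constant on each, and [P] holds at most once
    there. So updating spreads the points of [P] and [Q] injectively over [Q]. *)
Lemma card_fiber (L A : finType) (upd : L -> A -> L) (get : L -> A) (P Q : pred L) :
  (forall l a, get (upd l a) = a) ->
  (forall l a b, upd (upd l a) b = upd l b) ->
  (forall l, upd l (get l) = l) ->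
  (forall l a, Q (upd l a) = Q l) ->
  (forall l a, P l -> P (upd l a) -> a = get l) ->
  #|A| * #|[pred l | P l && Q l]| <= #|[pred l | Q l]|.
Proof.
move=> gu uu ug Qu Pu; rewrite -cardX.
have inj : {in [predX A & [pred l | P l && Q l]] &, injective (fun al => upd al.2 al.1)}.
  move=> [a l] [b l']; rewrite !inE /= => /andP[Pl _] /andP[Pl' _] e.
  have ab : a = b by rewrite -(gu l a) e gu.
  subst b; have e' : l' = upd l (get l') by rewrite -(uu l a) e uu ug.
  have g' : get l' = get l by apply: Pu => //; rewrite -e'.
  by rewrite e' g' ug.
rewrite -(card_in_image inj); apply: subset_leq_card; apply/fintype.subsetP => l.
move=> /mapP[[a l']]; rewrite mem_enum !inE /= => /andP[_ h] ->; move: h.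
by rewrite Qu.
Qed.

(* Each test has its own coordinate, which the later tests of the list do not
   see, and which can make the test fail in at most one way. *)
Lemma card_tests (L A : finType) (T : eqType) (r : rel T) (s : seq T)
    (test : L -> T -> bool) (upd : T -> L -> A -> L) (get : T -> L -> A) :
  transitive r -> sorted r s ->
  (forall p l a, p \in s -> get p (upd p l a) = a) ->
  (forall p l a b, p \in s -> upd p (upd p l a) b = upd p l b) ->
  (forall p l, p \in s -> upd p l (get p l) = l) ->
  (forall p p' l a, p \in s -> p' \in s -> r p p' -> test (upd p l a) p' = test l p') ->
  (forall p l a, p \in s -> test l p -> test (upd p l a) p -> a = get p l) ->
  #|A| ^ size s * #|[pred l | all (test l) s]| <= #|L|.
Proof.
move=> rT; elim: s => [|p s IH] /=; first by move=> *; rewrite mul1n max_card.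
move=> ps gu uu ug tu tP; have ps' : all (r p) s by exact: order_path_min.
have sub p' : p' \in s -> p' \in p :: s by move=> h; rewrite inE h orbT.
rewrite expnSr -mulnA; apply: leq_trans (leq_mul (leqnn _) _) (IH _ _ _ _ _ _).
- apply: (@card_fiber _ _ (upd p) (get p)); rewrite ?mem_head//.
  + by move=> l a; apply: gu; rewrite mem_head.
  + by move=> l a b; apply: uu; rewrite mem_head.
  + by move=> l; apply: ug; rewrite mem_head.
  + move=> l a; apply: eq_in_all => p' hp'; apply: tu; rewrite ?mem_head ?sub//.
    exact: (allP ps').
  + by move=> l a; apply: tP; rewrite mem_head.
- exact: path_sorted ps.
- by move=> p' l a /sub; exact: gu.
- by move=> p' l a b /sub; exact: uu.
- by move=> p' l /sub; exact: ug.
- by move=> p' p'' l a /sub h /sub; exact: tu.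
- by move=> p' l a /sub; exact: tP.
Qed.

End Fibers.

(** * The group of labels acting on letters *)

Section Relabel.
Local Open Scope group_scope.
Variables (R : realType) (X : Type) (d : X -> X -> R) (G : groupType).
Variables (act : G -> X -> X) (o : X).
Hypotheses (actP : isometric_faithful_action d act).
Variables (mu : G -> R) (n m1 m2 : nat) (pw sw : 'I_n.+1 -> seq G).
Variables (U Up V : X -> Prop).
Hypothesis sch : schottky act o mu m1 m2 pw sw U Up V.
Local Notation lab := ('I_n.+1 * 'I_n.+1)%type.

Definition word (p : lab) : seq G := pw p.1 ++ sw p.2.

Lemma pw_inj : injective pw.
Proof.
move=> k k' e; have [z uz] := sch_Up sch.
have h : ~ V (act (gprod (pw k))^-1 (act (gprod (pw k)) z)).
  by rewrite (actK actP) => /(sch_VU sch); apply; exact: (sch_UpU sch).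
by apply: (sch_past sch h); rewrite -e.
Qed.

Lemma sw_inj : injective sw.
Proof.
move=> k k' e; have [z vz] := sch_V sch.
have h : ~ Up (act (gprod (sw k)) (act (gprod (sw k))^-1 z)).
  by rewrite (actKV actP) => /(sch_UpU sch); exact: (sch_VU sch).
by apply: (sch_future sch h); rewrite -e.
Qed.

Lemma word_inj : injective word.
Proof.
move=> [k l] [k' l'] /eqP; rewrite eqseq_cat ?(sch_size_pw sch)//=.
by move=> /andP[/eqP/pw_inj -> /eqP/sw_inj ->].
Qed.

Definition is_word (c : seq G) : bool := [exists p, c == word p].

Lemma is_wordP c : reflect (exists p, c = word p) (is_word c).
Proof. exact: exists_eqP. Qed.

(** A translation in the finite group [lab], extended by the identity to cells that are no letters;
    resampling uniformly is then averaging over a group of bijections. *)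
Definition relabel (b : lab) (c : seq G) : seq G :=
  if [pick p | c == word p] is Some p then word (p + b)%R else c.

Lemma relabel_word b p : relabel b (word p) = word (p + b)%R.
Proof.
rewrite /relabel; case: pickP => [q /eqP/word_inj -> //|/(_ p)].
by rewrite eqxx.
Qed.

Lemma relabel_nword b c : ~~ is_word c -> relabel b c = c.
Proof.
rewrite /relabel; case: pickP => // p /eqP -> /is_wordP[].
by exists p.
Qed.

Lemma is_word_relabel b c : is_word (relabel b c) = is_word c.
Proof.
case: (boolP (is_word c)) => [/is_wordP[p ->]|h]; last by rewrite relabel_nword// (negbTE h).
by rewrite relabel_word; apply/is_wordP; exists (p + b)%R.
Qed.

Lemma relabelD b b' c : relabel b (relabel b' c) = relabel (b' + b)%R c.
Proof.
case: (boolP (is_word c)) => [/is_wordP[p ->]|h]; last by rewrite !relabel_nword.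
by rewrite !relabel_word addrA.
Qed.

Lemma relabel0 c : relabel 0%R c = c.
Proof.
case: (boolP (is_word c)) => [/is_wordP[p ->]|h]; last by rewrite !relabel_nword.
by rewrite relabel_word addr0.
Qed.

Lemma relabelK b : cancel (relabel b) (relabel (- b)%R).
Proof. by move=> c; rewrite relabelD subrr relabel0. Qed.

Lemma relabel_inj b : injective (relabel b).
Proof. exact: can_inj (relabelK b). Qed.

Lemma size_relabel b c : size (relabel b c) = size c.
Proof.
case: (boolP (is_word c)) => [/is_wordP[p ->]|h]; last by rewrite !relabel_nword.
by rewrite relabel_word !size_cat !(sch_size_pw sch) !(sch_size_sw sch).
Qed.

Lemma weight_relabel b c : weight mu (relabel b c) = weight mu c.
Proof.
case: (boolP (is_word c)) => [/is_wordP[p ->]|h]; last by rewrite !relabel_nword.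
rewrite relabel_word !weight_cat.
by rewrite (sch_weight_pw sch _ p.1) (sch_weight_sw sch _ p.2).
Qed.

End Relabel.

(** * Alignment of letters along a path of cells *)

Lemma sort_fst (s : seq (nat * nat)) : uniq [seq p.1 | p <- s] ->
  exists2 s', perm_eq s s' & sorted [rel p q : nat * nat | (p.1 < q.1)%N] s'.
Proof.
pose r := [rel p q : nat * nat | (p.1 <= q.1)%N] => us.
have ps : perm_eq s (sort r s) by rewrite perm_sym perm_sort.
exists (sort r s) => //; move: us; rewrite (perm_uniq (perm_map fst ps)) => us.
have rtot : total r by move=> p q; exact: leq_total.
have := sort_sorted rtot s; move: us; elim: (sort r s) => //= p q IH.
move=> /andP[pq uq]; case: q pq uq IH => //= q q' + uq IH /andP[pq h].
rewrite inE negb_or => /andP[h1 _]; rewrite ltn_neqAle h1 pq /=.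
by apply: IH; rewrite ?uq.
Qed.

Section Path.
Local Open Scope group_scope.
Variables (R : realType) (X : Type) (d : X -> X -> R) (G : groupType).
Variables (act : G -> X -> X) (o : X).
Hypotheses (actP : isometric_faithful_action d act).
Variables (mu : G -> R) (n m1 m2 : nat) (pw sw : 'I_n.+1 -> seq G).
Variables (U Up V : X -> Prop).
Hypothesis sch : schottky act o mu m1 m2 pw sw U Up V.
Local Notation lab := ('I_n.+1 * 'I_n.+1)%type.
Local Notation word := (word pw sw).
Local Notation is_word := (is_word pw sw).

Implicit Types (x y : nat -> seq G) (z : X).

Fixpoint pos x t : G := if t is t'.+1 then pos x t' * gprod (x t') else 1.
(** The base point of letter [t]: earlier points are tested through its prefix, later ones through
    its suffix. *)
Definition mid x t : G := pos x t * gprod (take m1 (x t)).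
Definition seg x a b : G := (pos x a)^-1 * pos x b.

Lemma pos_mid x i : pos x i.+1 = mid x i * gprod (drop m1 (x i)).
Proof. by rewrite /mid -mulgA -gprod_cat cat_take_drop. Qed.

Lemma eq_seg x y a b : (a <= b)%N ->
  (forall s, (a <= s < b)%N -> x s = y s) -> seg x a b = seg y a b.
Proof.
elim: b => [|b IH] ab xy; first by move: ab; rewrite leqn0 => /eqP ->; rewrite /seg !mulVg.
move: ab; rewrite leq_eqVlt => /orP[/eqP ->|ab]; first by rewrite /seg !mulVg.
rewrite /seg /= !mulgA -!/(seg _ a b) IH// => [|s sb]; first by rewrite xy//; lia.
by apply: xy; lia.
Qed.

Definition rbad x i z : bool := `[< ~ Up (act (mid x i)^-1 z) >].
Definition lbad x j z : bool := `[< ~ V (act (mid x j)^-1 z) >].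
Definition letter (free : pred nat) x : pred nat := fun s => free s && is_word (x s).
Definition path_stack free x t : seq nat :=
  stack (letter free x) (fun i j => rbad x i (act (mid x j) o))
    (fun i j => lbad x j (act (mid x i) o)) t.
Definition final_stack free x t z : seq nat :=
  pop (fun i => rbad x i z) (path_stack free x t).

(** Time [j = t] stands for the endpoint of the path, so that testing a letter against a later
    letter and against the endpoint obey one formula. *)
Definition tail x t (zeta : X) j : X :=
  if (j < t)%N then act (gprod (take m1 (x j))) o else zeta.

(** Seen from the middle of letter [i], later points involve only the suffix of [i] and what follows
    it. Hence tests listed by increasing [i] do not see the suffixes changed by the tests before
    them. *)
Lemma rbad_rel x t zeta i j : (i < j <= t)%N ->
  act (mid x i)^-1 (if (j < t)%N then act (mid x j) o else act (pos x t) zeta) =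
  act (gprod (drop m1 (x i))) (act (seg x i.+1 j) (tail x t zeta j)).
Proof.
move=> /andP[ij jt].
have -> : (if (j < t)%N then act (mid x j) o else act (pos x t) zeta) =
    act (pos x j) (tail x t zeta j).
  rewrite /tail; case: ltnP => tj; first by rewrite /mid (actM actP).
  by rewrite (_ : t = j)//; apply/eqP; rewrite eqn_leq tj jt.
rewrite -!(actM actP); congr act; rewrite /seg pos_mid (invgM (mid x i)) !mulgA.
by rewrite mulgV mul1g.
Qed.

(** The mirror image: only the prefix of [j] and the path between the two middles enter, so these
    tests are listed by decreasing [j]. *)
Lemma lbad_rel x i j : (i < j)%N ->
  act (mid x j)^-1 (act (mid x i) o) =
  act (gprod (take m1 (x j)))^-1 (act (gprod (drop m1 (x i)) * seg x i.+1 j)^-1 o).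
Proof.
move=> ij; rewrite -!(actM actP); congr act.
have e : pos x j = mid x i * (gprod (drop m1 (x i)) * seg x i.+1 j).
  by rewrite mulgA -pos_mid /seg mulVKg.
rewrite -[mid x j]/(pos x j * _) (invgM (pos x j)) e (invgM (mid x i)).
by rewrite -!mulgA mulVg mulg1.
Qed.

Section Resample.
Variables (free : pred nat) (x0 : nat -> seq G) (t : nat) (zeta : X).
Local Notation L := {ffun 'I_t -> lab}.

(** The default [0] leaves all cells from time [t] on unchanged. *)
Definition label_at (l : L) (s : nat) : lab := if insub s is Some i then l i else 0%R.
Definition resample (l : L) : nat -> seq G := fun s =>
  if free s then relabel pw sw (label_at l s) (x0 s) else x0 s.

Lemma letter_resample l : letter free (resample l) =1 letter free x0.
Proof.
by move=> s; rewrite /letter /resample; case: (free s); rewrite //= (is_word_relabel actP sch).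
Qed.

Lemma resample_letter l s p : free s -> x0 s = word p ->
  resample l s = word (p + label_at l s)%R.
Proof. by move=> fs xs; rewrite /resample fs xs (relabel_word actP sch). Qed.

Lemma take_word p : take m1 (word p) = pw p.1.
Proof. by rewrite take_size_cat// (sch_size_pw sch). Qed.

Lemma drop_word p : drop m1 (word p) = sw p.2.
Proof. by rewrite drop_size_cat// (sch_size_pw sch). Qed.

Definition upd (g : lab -> 'I_n.+1 -> lab) (i : nat) (l : L) (a : 'I_n.+1) : L :=
  [ffun k : 'I_t => if val k == i then g (l k) a else l k].
Definition set1 (b : lab) a : lab := (a, b.2).
Definition set2 (b : lab) a : lab := (b.1, a).

Lemma label_at_upd g i l a s : (i < t)%N ->
  label_at (upd g i l a) s = if s == i then g (label_at l s) a else label_at l s.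
Proof.
move=> it; rewrite /label_at; case: insubP => [k kt ks|]; first by rewrite ffunE ks.
by rewrite -leqNgt => ts; case: eqP => // e; move: it; rewrite -e ltnNge ts.
Qed.

Lemma label_at_ord l (k : 'I_t) : label_at l k = l k.
Proof.
rewrite /label_at; case: insubP => [k' _ /val_inj -> //|].
by rewrite ltn_ord.
Qed.

Lemma resample_upd g i l a s : (i < t)%N -> s != i ->
  resample (upd g i l a) s = resample l s.
Proof. by move=> it si; rewrite /resample label_at_upd// (negbTE si). Qed.

Lemma future_tests (s : seq (nat * nat)) : uniq [seq p.1 | p <- s] ->
  all (fun p => letter free x0 p.1 && (p.1 < p.2 <= t)%N) s ->
  (n.+1 ^ size s * #|[pred l : L | all (fun p => rbad (resample l) p.1
     (if (p.2 < t)%N then act (mid (resample l) p.2) o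
      else act (pos (resample l) t) zeta)) s]| <= #|L|)%N.
Proof.
pose tst (l : L) (p : nat * nat) := rbad (resample l) p.1
  (if (p.2 < t)%N then act (mid (resample l) p.2) o else act (pos (resample l) t) zeta).
move=> /sort_fst[s' ps rs]; rewrite (perm_size ps) (perm_all _ ps) => ss.
rewrite (eq_card (B := [pred l : L | all (tst l) s'])); last first.
  by move=> l; rewrite !inE (perm_all _ ps).
have lt_t p : p \in s' -> (p.1 < t)%N.
  by move=> /(allP ss) /andP[_ /andP[h1 h2]]; exact: leq_trans h1 h2.
rewrite -{1}(card_ord n.+1).
apply: (@card_tests _ _ _ [rel p q : nat * nat | (p.1 < q.1)%N] s' tst
  (fun p => upd set2 p.1) (fun p l => (label_at l p.1).2)) => //.
- by move=> q p w; exact: ltn_trans.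
- by move=> p l a ps'; rewrite label_at_upd ?lt_t// eqxx.
- by move=> p l a b ps'; apply/ffunP => k; rewrite !ffunE; case: eqP.
- move=> p l ps'; apply/ffunP => k; rewrite !ffunE; case: eqP => // <-.
  by rewrite label_at_ord /set2; case: (l k).
- move=> p p' l a ps' ps'' /= pp'; rewrite /tst.
  have /andP[_ hp] := allP ss _ ps''.
  rewrite /rbad !rbad_rel//; have pt := lt_t _ ps'.
  have e k : (p'.1 <= k)%N -> resample (upd set2 p.1 l a) k = resample l k.
    by move=> pk; apply: resample_upd => //; rewrite neq_ltn (leq_trans pp' pk) orbT.
  have /andP[h1 _] := hp; rewrite e// (@eq_seg _ (resample l))//.
    by rewrite /tail e// ltnW.
  by move=> k /andP[hk _]; apply: e; exact: ltnW.
- move=> p l a ps'; rewrite /tst; have /andP[/andP[fp /(is_wordP)[b xb]] hp] := allP ss _ ps'.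
  have pt := lt_t _ ps'.
  have /andP[h1 _] := hp; rewrite /rbad !rbad_rel// (@eq_seg _ (resample l))//; last first.
    by move=> k /andP[hk _]; apply: resample_upd => //; rewrite gtn_eqF.
  have -> : tail (resample (upd set2 p.1 l a)) t zeta p.2 = tail (resample l) t zeta p.2.
    by rewrite /tail resample_upd// gtn_eqF.
  rewrite !(resample_letter _ fp xb) !drop_word label_at_upd// eqxx.
  by move=> /asboolP h /asboolP/(sch_future sch h)/addrI.
Qed.

Lemma past_tests (s : seq (nat * nat)) : uniq [seq p.1 | p <- s] ->
  all (fun p => letter free x0 p.1 && (p.2 < p.1 < t)%N) s ->
  (n.+1 ^ size s * #|[pred l : L | all (fun p => lbad (resample l) p.1
     (act (mid (resample l) p.2) o)) s]| <= #|L|)%N.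
Proof.
pose tst (l : L) (p : nat * nat) :=
  lbad (resample l) p.1 (act (mid (resample l) p.2) o).
move=> /sort_fst[s0 ps0]; rewrite -rev_sorted => rs.
have ps : perm_eq s (rev s0) by rewrite perm_sym perm_rev perm_sym.
move: rs ps; move: (rev s0) => s' rs ps {s0 ps0}.
rewrite (perm_size ps) (perm_all _ ps) => ss.
rewrite (eq_card (B := [pred l : L | all (tst l) s'])); last first.
  by move=> l; rewrite !inE (perm_all _ ps).
have lt_t p : p \in s' -> (p.1 < t)%N by move=> /(allP ss) /andP[_ /andP[_]].
rewrite -{1}(card_ord n.+1).
apply: (@card_tests _ _ _ [rel p q : nat * nat | (q.1 < p.1)%N] s' tst
  (fun p => upd set1 p.1) (fun p l => (label_at l p.1).1)) => //.
- by move=> q p w /= h1 h2; exact: ltn_trans h2 h1.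
- by move=> p l a ps'; rewrite label_at_upd ?lt_t// eqxx.
- by move=> p l a b ps'; apply/ffunP => k; rewrite !ffunE; case: eqP.
- move=> p l ps'; apply/ffunP => k; rewrite !ffunE; case: eqP => // <-.
  by rewrite label_at_ord /set1; case: (l k).
- move=> p p' l a ps' ps'' /= pp'; rewrite /tst.
  have /andP[_ /andP[h1 _]] := allP ss _ ps''.
  rewrite /lbad !lbad_rel//; have pt := lt_t _ ps'.
  have e k : (k <= p'.1)%N -> resample (upd set1 p.1 l a) k = resample l k.
    by move=> kp; apply: resample_upd => //; rewrite neq_ltn (leq_ltn_trans kp pp').
  rewrite e// (@eq_seg _ (resample l))// => [|k /andP[_ hk]]; first by rewrite e// ltnW.
  by apply: e; exact: ltnW.
- move=> p l a ps'; rewrite /tst.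
  have /andP[/andP[fp /(is_wordP)[b xb]] /andP[h1 _]] := allP ss _ ps'.
  have pt := lt_t _ ps'.
  rewrite /lbad !lbad_rel// (@eq_seg _ (resample l))//; last first.
    by move=> k /andP[_ hk]; apply: resample_upd => //; rewrite ltn_eqF.
  rewrite (@resample_upd set1 p.1 l a p.2)// ?ltn_eqF//.
  rewrite !(resample_letter _ fp xb) !take_word label_at_upd// eqxx.
  by move=> /asboolP h /asboolP/(sch_past sch h)/addrI.
Qed.

(* Two subsets of at least [3 q / 4] among [q >= 4] letters share two of them. *)
Definition few_letters x : bool :=
  let q := count (letter free x) (iota 0 t) in
  (4 * size (final_stack free x t (act (pos x t) zeta)) < 3 * q)%N || (q < 4)%N.

Lemma few_letters_bound (q := count (letter free x0) (iota 0 t)) :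
  (forall k, q <= 8 * k -> 12 ^ q <= n.+1 ^ k)%N ->
  (2 ^ q * #|[pred l : L | few_letters (resample l)]| <= 16 * #|L|)%N.
Proof.
move=> nB.
have qE l : count (letter free (resample l)) (iota 0 t) = q.
  by apply: eq_count; exact: letter_resample.
(* With fewer than four letters every label counts as bad; the factor [16 = 2 ^ 4] makes the bound
   trivial there. *)
have [q4|q4] := ltnP q 4.
  apply: leq_mul; last exact: max_card.
  by rewrite -[16%N]/(2 ^ 4)%N leq_exp2l// ltnW.
apply: (@leq_trans (1 * #|L|)); last by rewrite leq_mul2r orbT.
rewrite mul1n.
pose rb l i j := rbad (resample l) i
  (if (j < t)%N then act (mid (resample l) j) o else act (pos (resample l) t) zeta).
pose lb l i j := lbad (resample l) j (act (mid (resample l) i) o).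
have stk l : path_stack free (resample l) t = stack (letter free x0) (rb l) (lb l) t.
  rewrite /path_stack.
  apply: eq_stack => [i _|i j /andP[_ jt]|//]; first exact: letter_resample.
  by rewrite /rb jt.
rewrite (eq_card (B := [pred l : L | 4 * size (pop ((rb l)^~ t)
    (stack (letter free x0) (rb l) (lb l) t)) < 3 * q]%N)); last first.
  move=> l; rewrite !inE /few_letters qE (leq_gtF q4) orbF /final_stack stk.
  by rewrite /rb /= ltnn.
by apply: (@stack_union_bound _ _ _ _ _ n.+1) => //; [exact: future_tests|exact: past_tests].
Qed.

End Resample.

Lemma eq_few_letters free t zeta x y : (forall i, (i < t)%N -> x i = y i) ->
  few_letters free t zeta x = few_letters free t zeta y.
Proof.
move=> xy; have ep i : (i <= t)%N -> pos x i = pos y i.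
  by elim: i => //= i IH it; rewrite IH ?xy// ltnW.
have em i : (i < t)%N -> mid x i = mid y i by move=> it; rewrite /mid ep ?xy// ltnW.
have el i : (i < t)%N -> letter free x i = letter free y i by move=> it; rewrite /letter xy.
have es : path_stack free x t = path_stack free y t.
  by apply: eq_stack => // i j /andP[ij jt]; rewrite ?/rbad ?/lbad !em// (ltn_trans ij).
rewrite /few_letters (@eq_in_count _ (letter free x) (letter free y)); last first.
  by move=> i; rewrite mem_iota => it; exact: el.
rewrite /final_stack es (@eq_pop _ (fun i => rbad y i (act (pos y t) zeta)))// => i.
move=> /(allP (stack_lt _ _ _ _)) it; by rewrite /rbad em// ep.
Qed.
End Path.

(** * Letters that survive forever *)

Section Persistence.
Local Open Scope group_scope.
Variables (R : realType) (X : Type) (d : X -> X -> R) (G : groupType).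
Variables (act : G -> X -> X) (o : X).
Hypotheses (actP : isometric_faithful_action d act).
Variables (mu : G -> R) (n m1 m2 : nat) (pw sw : 'I_n.+1 -> seq G).
Variables (U Up V : X -> Prop).
Hypothesis sch : schottky act o mu m1 m2 pw sw U Up V.
Variables (free : pred nat) (x : nat -> seq G).
Local Notation mid := (mid m1 x).
Local Notation pos := (pos x).
Local Notation letter := (letter pw sw free x).
Local Notation rbad := (rbad act m1 Up x).
Local Notation lbad := (lbad act m1 V x).
Local Notation path_stack := (path_stack act o m1 pw sw Up V free x).
Local Notation final_stack := (final_stack act o m1 pw sw Up V free x).
Local Notation few_letters := (few_letters act o m1 pw sw Up V free).

Definition ahead i z : Prop := U (act (mid i)^-1 z).

Definition linked j i : bool :=
  [&& (i < j)%N, ~~ rbad i (act (mid j) o) & ~~ lbad j (act (mid i) o)].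

Lemma linked_up j i : linked j i -> Up (act ((mid i)^-1 * mid j) o).
Proof. by move=> /and3P[_ /asboolPn/contrapT h _]; rewrite (actM actP). Qed.

Lemma linked_down j i : linked j i -> V (act ((mid i)^-1 * mid j)^-1 o).
Proof.
by move=> /and3P[_ _ /asboolPn/contrapT h]; rewrite invgM invgK (actM actP).
Qed.

Lemma ahead_linked j i z : linked j i -> ahead j z -> ahead i z.
Proof.
move=> ji hz; rewrite /ahead.
have -> : act (mid i)^-1 z = act ((mid i)^-1 * mid j) (act (mid j)^-1 z).
  by rewrite -(actM actP) mulgK.
by apply: (sch_nest sch) hz; [exact: linked_up|exact: linked_down].
Qed.

Lemma ahead_chain j s z : path linked j s -> ahead j z ->
  forall i, i \in s -> ahead i z.
Proof.
elim: s j => //= i' s IH j /andP[ji ps] hz i; rewrite inE.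
have hz' := ahead_linked ji hz.
by move=> /orP[/eqP ->//|]; exact: IH hz' _.
Qed.

Lemma chain_below j s i : path linked j s -> i \in s ->
  exists2 k, linked k i & forall z, ahead j z -> ahead k z.
Proof.
elim: s j => //= i' s IH j /andP[ji ps]; rewrite inE => /orP[/eqP ->|his].
  by exists j.
have [k ki h] := IH _ ps his; exists k => // z hz; apply: h.
exact: ahead_linked ji hz.
Qed.

Lemma sorted_linked_gt j s : path linked j s -> all (fun i => (i < j)%N) s.
Proof.
move=> ps; have : path (fun a b => (b < a)%N) j s.
  by apply: sub_path ps => a b /and3P[].
by apply: order_path_min => a b c /= h1 h2; exact: ltn_trans h2 h1.
Qed.

Lemma chain_between s i j : sorted linked s -> i \in s -> j \in s -> (i < j)%N ->
  exists2 k, linked k i & forall z, ahead j z -> ahead k z.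
Proof.
elim: s => //= a s IH ps; rewrite !inE => /orP[/eqP ->|hi] /orP[/eqP ->|hj] ij.
- by rewrite ltnn in ij.
- by have := allP (sorted_linked_gt ps) _ hj; rewrite ltnNge ltnW.
- exact: chain_below hi.
- by apply: IH => //; exact: path_sorted ps.
Qed.

Lemma sorted_drop_linked r s : sorted linked s -> sorted linked (drop r s).
Proof.
elim: r s => [|r IH] [|a s] //= ps; apply: IH; exact: path_sorted ps.
Qed.

Lemma pop_head (p : pred nat) s i s' : pop p s = i :: s' -> ~~ p i.
Proof.
rewrite /pop; elim: s => //= a s IH; case: (boolP (p a)) => //= pa.
by move=> [<- _].
Qed.

Lemma path_stackS t : path_stack t.+1 =
  if letter t then
    let s := pop (fun i => rbad i (act (mid t) o)) (path_stack t) in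
    if s is i :: _ then if lbad t (act (mid i) o) then s else t :: s else [:: t]
  else path_stack t.
Proof. by []. Qed.

Lemma path_stack_inv t :
  sorted linked (path_stack t) /\
  all (fun i => (i < t)%N && letter i) (path_stack t).
Proof.
elim: t => // t [IHs IHa]; rewrite path_stackS; case: ifP => lt; last first.
  by split => //; apply: sub_all IHa => i /andP[it ->]; rewrite andbT ltnW.
set p := fun i => _.
have dr : sorted linked (pop p (path_stack t)) by exact: sorted_drop_linked.
have da : all (fun i => (i < t)%N && letter i) (pop p (path_stack t)).
  by apply/allP => i /mem_drop; exact: (allP IHa).
have da' : all (fun i => (i < t.+1)%N && letter i) (pop p (path_stack t)).
  by apply: sub_all da => i /andP[it ->]; rewrite andbT ltnW.
move: dr da da' (@pop_head p (path_stack t)).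
case: (pop p (path_stack t)) => [|i s] dr da da' hd /=; first by rewrite lt ltnSn.
case: ifP => lb; first by split.
split => /=; last by move: da' => /= ->; rewrite lt ltnSn.
move: da dr => /= /andP[/andP[it _] _] ->.
by rewrite /linked it lb (hd _ _ erefl).
Qed.

Lemma final_stack_ahead t z i : i \in final_stack t z -> ahead i z.
Proof.
have [ss _] := path_stack_inv t.
have := sorted_drop_linked (find (predC (fun i => rbad i z)) (path_stack t)) ss.
have := @pop_head (fun i => rbad i z) (path_stack t).
rewrite /final_stack /pop; case: (drop _ _) => // j s /(_ _ _ erefl).
move=> /asboolPn/contrapT/(sch_UpU sch) hj ps; rewrite inE => /orP[/eqP ->//|].
exact: ahead_chain ps hj i.
Qed.

Lemma final_stack_uniq t z : uniq (final_stack t z).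
Proof.
have [ss _] := path_stack_inv t.
apply/drop_uniq/(@sorted_uniq _ (fun a b => (b < a)%N)) => [a b c /= h1 h2||].
- exact: ltn_trans h2 h1.
- by move=> a; rewrite ltnn.
- by apply: sub_sorted ss => a b /and3P[].
Qed.

Lemma final_stack_sub t z i : i \in final_stack t z -> (i < t)%N && letter i.
Proof. by move=> /mem_drop; have [_ /allP] := path_stack_inv t; apply. Qed.

(** The oldest [s] letters, as the head of the list is the top of the stack. *)
Definition bottom s (S : seq nat) := drop (size S - s) S.

Lemma bottom_drop s r S : (s <= size (drop r S))%N -> bottom s (drop r S) = bottom s S.
Proof.
rewrite size_drop => h; have [rS|rS] := leqP r (size S).
  by rewrite /bottom drop_drop size_drop; congr drop; lia.
by rewrite /bottom !drop_oversize// ?size_drop; lia.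
Qed.

Lemma bottom_cons s a S : (s <= size S)%N -> bottom s (a :: S) = bottom s S.
Proof. by move=> h; rewrite /bottom /= subSn. Qed.

Variable k : nat.
Local Notation count_letters t := (count letter (iota 0 t)).
Hypothesis many : forall t r, (k <= t)%N -> (r <= m1 + m2)%N ->
  ~~ few_letters t (act (gprod (take r (x t))) o) x.

Let s0 := ((3 * count_letters k + 3) %/ 4)%N.

Lemma count_letters_le t : (k <= t)%N -> (count_letters k <= count_letters t)%N.
Proof. by move=> /subnKC <-; rewrite iotaD count_cat leq_addr. Qed.

Lemma final_stack_large t r : (k <= t)%N -> (r <= m1 + m2)%N ->
  (s0 <= size (final_stack t (act (pos t * gprod (take r (x t))) o)))%N.
Proof.
move=> kt rm; have := many kt rm; rewrite /few_letters negb_or -leqNgt => /andP[h _].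
by have := count_letters_le kt; move: h; rewrite (actM actP) /s0; lia.
Qed.

(** When a letter is read at time [t], the stack is popped against the middle of cell [t], which is
    the case [r = m1] of [many]. At least [s0] letters remain each time, so the lowest [s0] are
    never touched. *)
Lemma path_stack_bottom t : (k <= t)%N ->
  bottom s0 (path_stack t) = bottom s0 (path_stack k).
Proof.
move=> /subnKC <-; elim: (t - k)%N => [|e IH]; first by rewrite addn0.
have := @final_stack_large (k + e) m1 (leq_addr _ _) (leq_addr _ _).
rewrite addnS path_stackS -/(mid _) /final_stack; case: ifP => // _ /=.
have := @bottom_drop s0 (find (predC (fun i => rbad i (act (mid (k + e)) o)))
  (path_stack (k + e))) (path_stack (k + e)).
rewrite /pop; case: (drop _ _) => [|i s] h sz; rewrite IH in h.
  by rewrite -(h sz) bottom_cons.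
by case: ifP => _; [rewrite (h sz)|rewrite bottom_cons// (h sz)].
Qed.

Lemma persistent_letters : exists I : seq nat,
  [/\ uniq I, (3 * count_letters k <= 4 * size I)%N /\ (4 <= count_letters k)%N,
      forall i, i \in I -> (i < k)%N && letter i,
      forall i j, i \in I -> j \in I -> (i < j)%N ->
        exists2 l, linked l i & forall z, ahead j z -> ahead l z &
      forall i t r, i \in I -> (k <= t)%N -> (r <= m1 + m2)%N ->
        ahead i (act (pos t * gprod (take r (x t))) o)].
Proof.
have [ss sa] := path_stack_inv k.
have sz : (s0 <= size (path_stack k))%N.
  have := @final_stack_large k 0 (leqnn _) isT; rewrite /final_stack /pop size_drop.
  lia.
exists (bottom s0 (path_stack k)); split.
- apply/drop_uniq/(@sorted_uniq _ (fun a b => (b < a)%N)) => [a b c /= h1 h2||].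
  + exact: ltn_trans h2 h1.
  + by move=> a; rewrite ltnn.
  + by apply: sub_sorted ss => a b /and3P[].
- have := many (leqnn k) (leq0n _); rewrite /few_letters negb_or -!leqNgt => /andP[_ ->].
  by split => //; rewrite /bottom size_drop (subKn sz) /s0; lia.
- by move=> i /mem_drop; exact: (allP sa).
- by move=> i j /mem_drop hi /mem_drop hj; exact: (chain_between ss hi hj).
- move=> i t r iI kt rm; apply: (@final_stack_ahead t).
  have h := final_stack_large kt rm.
  by move: iI; rewrite -(path_stack_bottom kt) -(bottom_drop h) => /mem_drop.
Qed.

End Persistence.

(** * Random walk steps and cells *)

Section Esum.
Local Open Scope ereal_scope.
Variable R : realType.

Lemma esumZl (T : choiceType) (S : set T) (k : R) (a : T -> \bar R) :
  (0 <= k)%R -> (forall i, 0 <= a i) ->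
  \esum_(i in S) (k%:E * a i) = k%:E * \esum_(i in S) a i.
Proof.
have le_esumZ (k' : R) (b : T -> \bar R) : (0 <= k')%R -> (forall i, 0 <= b i) ->
    \esum_(i in S) (k'%:E * b i) <= k'%:E * \esum_(i in S) b i.
  move=> k0 b0; apply: ge_ereal_sup => _ [A [finA AS] <-].
  rewrite -ge0_mule_fsumr// lee_wpmul2l ?lee_fin//.
  by apply: esum_ge; exists A.
move=> k0 a0; apply/eqP; rewrite eq_le le_esumZ//=.
have [->|kn0] := eqVneq k 0%R.
  by rewrite mul0e; apply: esum_ge0 => i Si; rewrite mul0e.
have kp : (0 < k)%R by rewrite lt_def kn0 k0.
rewrite -lee_pdivlMl//.
have h : \esum_(i in S) (k^-1%:E * (k%:E * a i)) <= k^-1%:E * \esum_(i in S) (k%:E * a i).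
  by apply: le_esumZ => [|i]; rewrite ?invr_ge0// mule_ge0 ?lee_fin.
apply: le_trans h; apply: le_esum => i Si.
by rewrite muleA -EFinM mulVf ?mul1e.
Qed.

Lemma esum_prod_le (T1 T2 : choiceType) (A : set T1) (B : set T2)
    (a : T1 -> R) (b : T2 -> R) (M M' : R) :
  (forall i, (0 <= a i)%R) -> (forall j, (0 <= b j)%R) -> (0 <= M)%R -> (0 <= M')%R ->
  \esum_(i in A) (a i)%:E <= M%:E -> \esum_(j in B) (b j)%:E <= M'%:E ->
  \esum_(p in A `*` B) (a p.1 * b p.2)%:E <= (M * M')%:E.
Proof.
move=> a0 b0 M0 M'0 aM bM.
have -> : A `*` B = A `*`` (fun=> B) by apply/seteqP; split.
rewrite -(esum_esum (a := fun i j => (a i * b j)%:E)); last first.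
  by move=> *; rewrite lee_fin mulr_ge0.
apply: (@le_trans _ _ (\esum_(i in A) (M'%:E * (a i)%:E))).
  apply: le_esum => i _; under eq_esum do rewrite EFinM.
  by rewrite esumZl// muleC lee_wpmul2r// lee_fin.
by rewrite esumZl// [(M * M')%R]mulrC EFinM lee_wpmul2l// lee_fin.
Qed.

Lemma esum_seqS (T : choiceType) (F : seq T -> \bar R) n :
  \esum_(s in [set s | size s = n.+1]) F s =
  \esum_(p in [set: T] `*` [set s : seq T | size s = n]) F (p.1 :: p.2).
Proof.
apply: (reindex_esum _ _ (fun p : T * seq T => p.1 :: p.2)).
split => [[a s] [_ /= ->]//|[a s] [b s'] _ _ /= [-> ->]//|[|a s]//= [sn]].
by exists (a, s).
Qed.

Lemma esum_cat (T : choiceType) (F : seq T -> \bar R) m n :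
  \esum_(s in [set s | size s = (m + n)%N]) F s =
  \esum_(p in [set s : seq T | size s = m] `*` [set s : seq T | size s = n]) F (p.1 ++ p.2).
Proof.
apply: (reindex_esum _ _ (fun p : seq T * seq T => p.1 ++ p.2)).
split => [[a s] [/= <- <-]|[a s] [b s']|s /= sn]; first by rewrite /= size_cat.
  rewrite !inE /= => -[am sn] [bm s'n] /eqP.
  by rewrite eqseq_cat ?am ?bm// => /andP[/eqP -> /eqP ->].
exists (take m s, drop m s); rewrite /= ?cat_take_drop// size_takel ?size_drop.
  by rewrite sn addKn.
by rewrite sn leq_addr.
Qed.

Lemma esum_seq_prod (T : choiceType) (phi : T -> R) (M : R) n :
  (forall a, (0 <= phi a)%R) -> \esum_(a in [set: T]) (phi a)%:E <= M%:E ->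
  \esum_(s in [set s | size s = n]) (\prod_(a <- s) phi a)%:E <= (M ^+ n)%:E.
Proof.
move=> phi0 phiM.
have M0 : (0 <= M)%R.
  by rewrite -lee_fin; apply: le_trans phiM; apply: esum_ge0 => *; rewrite lee_fin.
elim: n => [|n IH].
  have -> : [set s : seq T | size s = 0%N] = [set [::]].
    by apply/seteqP; split => [[]|s ->].
  by rewrite esum_set1 ?lee_fin ?big_nil.
rewrite esum_seqS exprS; under eq_esum do rewrite big_cons.
apply: (esum_prod_le (a := phi) (b := fun s => (\prod_(b <- s) phi b)%R)) => //.
  by move=> s; rewrite prodr_ge0.
by rewrite exprn_ge0.
Qed.

End Esum.

(** * Countably valued random variables *)

Section Discrete.
Local Open Scope ereal_scope.
Context d (Omega : measurableType d) (R : realType) (P : probability Omega R).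

(** The integral of a nonnegative function is a supremum over simple functions below it, so
    monotonicity holds without measurability; the supremum over the walk is bounded in this way. *)
Lemma le_integral_nneg (f g : Omega -> \bar R) : (forall w, 0 <= f w) ->
  (forall w, f w <= g w) -> \int[P]_w f w <= \int[P]_w g w.
Proof.
move=> f0 fg; have g0 w : 0 <= g w by exact: le_trans (fg w).
rewrite !ge0_integralTE//; apply: le_ereal_sup => _ [h hf <-].
by exists h => // w; apply: le_trans (fg w).
Qed.

Variables (T : choiceType) (Y : Omega -> T).
Hypotheses (cT : countable [set: T]) (mY : forall a, measurable [set w | Y w = a]).

Lemma measurable_discrete (E : set T) : measurable [set w | E (Y w)].
Proof.
have [f fI] := countable_injP _ cT.
have -> : [set w | E (Y w)] = \bigcup_n [set w | f (Y w) = n /\ E (Y w)].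
  by apply/seteqP; split => [w Ew|w [n _ []]//]; exists (f (Y w)).
apply: bigcupT_measurable => n.
have [[a [fa Ea]]|none] := pselect (exists a, f a = n /\ E a).
  suff -> : [set w | f (Y w) = n /\ E (Y w)] = [set w | Y w = a] by exact: mY.
  apply/seteqP; split => [w [/= fY _]|w /= ->//].
  by apply: fI; rewrite ?in_setT// fY.
suff -> : [set w | f (Y w) = n /\ E (Y w)] = set0 by exact: measurable0.
by apply/seteqP; split => // w [fY EY]; apply: none; exists (Y w).
Qed.

Lemma measurable_fun_discrete d' (S : measurableType d') (Psi : T -> S) :
  measurable_fun [set: Omega] (Psi \o Y).
Proof.
move=> _ B mB; rewrite setTI.
exact: (measurable_discrete [set a | B (Psi a)]).
Qed.

Lemma integral_discrete (Psi : T -> \bar R) (B : set Omega) :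
  (forall a, 0 <= Psi a) -> measurable B ->
  \int[P]_w (Psi (Y w) * (\1_B w)%:E) =
  \esum_(a in [set: T]) (Psi a * P (B `&` [set w | Y w = a])).
Proof.
move=> P0 mB; have [f fI] := countable_injP _ cT.
pose F n := [set w | f (Y w) = n].
have mF n : measurable (F n) by exact: (measurable_discrete [set a | f a = n]).
have FT : \bigcup_n F n = setT by apply/seteqP; split => // w _; exists (f (Y w)).
have mfun : measurable_fun [set: Omega] ((fun w => (Psi \o Y) w * (\1_B w)%:E) : _ -> \bar R).
  apply: emeasurable_funM; first exact: measurable_fun_discrete.
  by apply/measurable_EFinP; exact: measurable_indic.
have f0 w : 0 <= Psi (Y w) * (\1_B w)%:E by rewrite mule_ge0// lee_fin.
rewrite -FT ge0_integral_bigcup//; last 2 first.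
- by rewrite FT.
- apply/trivIsetP => i j _ _ ij; rewrite -subset0 => w [/= fi fj].
  by move: ij; rewrite -fi -fj eqxx.
rewrite nneseries_esumT => [|n]; last by apply: integral_ge0 => w _.
pose g n := \int[P]_(w in F n) (Psi (Y w) * (\1_B w)%:E).
have gE a : g (f a) = Psi a * P (B `&` [set w | Y w = a]).
  have Fa : F (f a) = [set w | Y w = a].
    apply/seteqP; split => [w h|w /= e]; last by rewrite /F /= e.
    by apply: fI; rewrite ?in_setT.
  rewrite /g (eq_integral (fun w => Psi a * (\1_B w)%:E)); last first.
    by move=> w; rewrite Fa inE => /= ->.
  rewrite ge0_integralZl//; last first.
    by apply: measurable_funTS; apply/measurable_EFinP; exact: measurable_indic.
  by rewrite integral_indic// Fa.
under [RHS]eq_esum do rewrite -gE.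
rewrite -(esum_image _ f g); last by move=> a b _ _; apply: fI; rewrite in_setT.
rewrite esum_mkcond [RHS]esum_mkcond; apply: eq_esum => n _.
rewrite in_setT; case: ifPn => //; rewrite notin_setE => h.
rewrite -/(g n) /g (_ : F n = set0) ?integral_set0//.
by apply/seteqP; split => // w fY; apply: h; exists (Y w).
Qed.

Lemma prob_discrete (E : set T) :
  P [set w | E (Y w)] = \esum_(a in E) P [set w | Y w = a].
Proof.
have mE := measurable_discrete E.
have := @integral_discrete (fun a => (\1_E a)%:E) setT _ measurableT.
under eq_integral do rewrite indicT mule1.
rewrite (_ : (fun w => _) = (fun w => (\1_[set w | E (Y w)] w)%:E)).
  rewrite integral_indic// setIT => -> => [|a]; last by rewrite lee_fin.
  rewrite [RHS]esum_mkcond; apply: eq_esum => a _.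
  by rewrite setTI indicE; case: (a \in E); rewrite ?mul1e ?mul0e.
by apply/funext => w; rewrite !indicE; congr (_%:R%:E).
Qed.

End Discrete.

Section Window.
Local Open Scope ereal_scope.
Context d (Omega : measurableType d) (R : realType) (P : probability Omega R).
Variables (I : eqType) (C : choiceType) (c : I -> Omega -> C) (mass : C -> R).
Hypotheses (cC : countable [set: C]) (mc : forall i a, measurable [set w | c i w = a]).
Hypothesis mass0 : forall a, (0 <= mass a)%R.

Definition vals (s : seq I) (w : Omega) : seq C := [seq c i w | i <- s].

Lemma countable_seq : countable [set: seq C].
Proof.
have [f fI] := countable_injP _ cC; apply/countable_injP.
exists (fun s => pickle (map f s)) => s t _ _ /(pcan_inj pickleK).
by apply: inj_map => a b; apply: fI; rewrite in_setT.
Qed.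

Lemma measurable_vals s cs : measurable [set w | vals s w = cs].
Proof.
elim: s cs => [|i s IH] [|a cs].
- by rewrite (_ : [set w | _] = setT)//; apply/seteqP; split.
- by rewrite (_ : [set w | _] = set0)//; apply/seteqP; split.
- by rewrite (_ : [set w | _] = set0)//; apply/seteqP; split.
rewrite (_ : [set w | _] = [set w | c i w = a] `&` [set w | vals s w = cs]).
  exact: measurableI.
by apply/seteqP; split => w /= => [[-> ->]|[-> <-]].
Qed.

Lemma measurable_window s (E : set (seq C)) : measurable [set w | E (vals s w)].
Proof. exact: (measurable_discrete countable_seq (measurable_vals s) E). Qed.

Hypothesis law : forall (s : seq I) (a : I -> C), uniq s ->
  P [set w | forall i, i \in s -> c i w = a i] = (\prod_(i <- s) mass (a i))%:E.

Lemma prob_vals s cs : uniq s ->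
  P [set w | vals s w = cs] =
  if size cs == size s then (\prod_(a <- cs) mass a)%:E else 0.
Proof.
move=> us; case: eqP => sz; last first.
  rewrite (_ : [set w | _] = set0) ?measure0//.
  by apply/seteqP; split => // w /= e; apply: sz; rewrite -e size_map.
case: s us sz => [|i0 s] us sz.
  rewrite (size0nil sz) big_nil (_ : [set w | _] = setT) ?probability_setT//.
  by apply/seteqP; split.
case: cs sz => [//|a0 cs] sz.
pose a i := nth a0 (a0 :: cs) (index i (i0 :: s)).
have e : a0 :: cs = [seq a i | i <- i0 :: s].
  apply: (@eq_from_nth _ a0); rewrite ?size_map// => j jsz.
  by rewrite (nth_map i0) -?sz// /a index_uniq// -sz.
rewrite [in RHS]e big_map -law//; congr (P _); apply/seteqP; split => w h.
  have /eq_in_map h' : [seq c i w | i <- i0 :: s] = [seq a i | i <- i0 :: s] by rewrite -e.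
  exact: h'.
change ([seq c i w | i <- i0 :: s] = a0 :: cs).
by rewrite e; apply/eq_in_map.
Qed.

Lemma prob_window s (E : set (seq C)) : uniq s ->
  P [set w | E (vals s w)] =
  \esum_(cs in [set cs | size cs = size s /\ E cs]) (\prod_(a <- cs) mass a)%:E.
Proof.
move=> us; rewrite (prob_discrete P countable_seq (measurable_vals s)).
rewrite esum_mkcond [RHS]esum_mkcond; apply: eq_esum => cs _.
rewrite prob_vals//; case: (boolP (cs \in E)) => hE; last first.
  case: ifPn => //; rewrite inE => -[_ /mem_set h].
  by rewrite h in hE.
case: eqP => sz.
  by rewrite ifT// inE; split => //; exact: set_mem.
by rewrite ifF//; apply/negbTE; rewrite notin_setE => -[].
Qed.

Lemma integral_window s (F : seq C -> \bar R) : uniq s -> (forall cs, 0 <= F cs) ->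
  \int[P]_w F (vals s w) =
  \esum_(cs in [set cs | size cs = size s]) (F cs * (\prod_(a <- cs) mass a)%:E).
Proof.
move=> us F0.
have := integral_discrete P countable_seq (measurable_vals s) F0 measurableT.
under eq_integral do rewrite indicT mule1.
move=> ->; rewrite [RHS]esum_mkcond; apply: eq_esum => cs _.
rewrite setTI prob_vals//; case: eqP => sz; first by rewrite ifT// inE.
by rewrite mule0 ifF//; apply/negbTE; rewrite notin_setE.
Qed.

Lemma mass_total (i : I) : \esum_(a in [set: C]) (mass a)%:E = 1.
Proof.
have := prob_window (s := [:: i]) setT isT.
rewrite (_ : [set w | _] = setT) ?probability_setT => [->|]; last by apply/seteqP; split.
rewrite (reindex_esum [set: C] _ (fun a => [:: a])).
  by apply: eq_esum => a _; rewrite big_seq1.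
split => [a _ //|a b _ _ [//]|[|a [|b s]] //= [//]].
by move=> _ _; exists a.
Qed.

End Window.

Section CellIndex.
Local Open Scope ring_scope.
Variable m : nat.
Hypothesis m_gt0 : (0 < m)%N.

(** The walk starts with step [1]: cell [0] holds the steps [1] to [m], and the cells of negative
    index hold those of the backward walk. *)
Definition step_of (t : int) (r : nat) : int := t * m%:Z + r.+1%:Z.
Definition cell_of (e : int) : int := ((e - 1) %/ m%:Z)%Z.
Definition pos_in_cell (e : int) : nat := absz ((e - 1) %% m%:Z)%Z.

Lemma pos_in_cell_lt e : (pos_in_cell e < m)%N.
Proof.
rewrite /pos_in_cell; have m0 : m%:Z != 0 by rewrite eqz_nat -lt0n.
by have := modz_ge0 (e - 1) m0; have := ltz_mod (e - 1) m0; lia.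
Qed.

Lemma step_of_cell e : step_of (cell_of e) (pos_in_cell e) = e.
Proof.
have m0 : m%:Z != 0 by rewrite eqz_nat -lt0n.
rewrite /step_of /cell_of /pos_in_cell; have := modz_ge0 (e - 1) m0.
by have := divz_eq (e - 1) m%:Z; lia.
Qed.

Lemma cell_of_step t r : (r < m)%N -> cell_of (step_of t r) = t.
Proof.
move=> rm; rewrite /cell_of /step_of.
have -> : t * m%:Z + r.+1%:Z - 1 = t * m%:Z + r%:Z by lia.
rewrite divzMDl ?eqz_nat -?lt0n// divz_small ?addr0//.
Qed.

Lemma pos_of_step t r : (r < m)%N -> pos_in_cell (step_of t r) = r.
Proof.
move=> rm; rewrite /pos_in_cell /step_of.
have -> : t * m%:Z + r.+1%:Z - 1 = t * m%:Z + r%:Z by lia.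
by rewrite modzMDl modz_small.
Qed.

End CellIndex.

Section Cells.
Local Open Scope ring_scope.
Context dd (Omega : measurableType dd) (R : realType) (P : probability Omega R).
Variables (G : groupType) (mu : G -> R) (g : int -> Omega -> G).
Hypotheses (cG : countable [set: G]) (mu0 : forall x, 0 <= mu x).
Hypothesis iid : iid_steps P mu g.
Variable m : nat.
Hypothesis m_gt0 : (0 < m)%N.
Local Notation step_of := (step_of m).
Local Notation cell_of := (cell_of m).
Local Notation pos_in_cell := (pos_in_cell m).

Definition cell (t : int) (w : Omega) : seq G := [seq g (step_of t r) w | r <- iota 0 m].
(** Zero off the words of length [m], so that cells are i.i.d. with values in the single type
    [seq G]. *)
Definition cell_mass (c : seq G) : R := if size c == m then weight mu c else 0.

Lemma size_cell t w : size (cell t w) = m.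
Proof. by rewrite size_map size_iota. Qed.

Lemma nth_cell t w r : (r < m)%N -> nth 1%g (cell t w) r = g (step_of t r) w.
Proof. by move=> rm; rewrite (nth_map 0%N) ?size_iota// nth_iota. Qed.

Lemma nth_cell_of e w : nth 1%g (cell (cell_of e) w) (pos_in_cell e) = g e w.
Proof. by rewrite nth_cell ?pos_in_cell_lt// step_of_cell. Qed.

Lemma measurable_cell t a : measurable [set w | cell t w = a].
Proof.
have := measurable_vals iid.1 [seq step_of t r | r <- iota 0 m] a.
by rewrite /vals; under [X in measurable X -> _]eq_set do rewrite -map_comp.
Qed.

Lemma cell_mass_ge0 c : 0 <= cell_mass c.
Proof. by rewrite /cell_mass; case: ifP => // _; exact: prodr_ge0. Qed.

Lemma cell_law (s : seq int) (a : int -> seq G) : uniq s ->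
  P [set w | forall t, t \in s -> cell t w = a t] =
  (\prod_(t <- s) cell_mass (a t))%:E.
Proof.
move=> us; have [/allP sz|] := boolP (all (fun t => size (a t) == m) s); last first.
  move=> /allPn[t ts szt]; rewrite (big_rem t)//= {1}/cell_mass (negbTE szt) mul0r.
  rewrite (_ : [set w | _] = set0) ?measure0//; apply/seteqP; split => // w /= /(_ t ts) e.
  by move: szt; rewrite -e size_cell eqxx.
pose S := [seq step_of t r | t <- s, r <- iota 0 m].
pose b i := nth 1%g (a (cell_of i)) (pos_in_cell i).
have uS : uniq S.
  apply: allpairs_uniq; rewrite ?iota_uniq// => -[t r] [t' r'].
  move=> /allpairsP[[t1 r1] [_ + [-> ->]]] /allpairsP[[t2 r2] [_ + [-> ->]]] /=.
  rewrite !mem_iota !add0n => /andP[_ rm] /andP[_ rm'] e; rewrite /= in rm rm' e.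
  have et : t1 = t2 by rewrite -(cell_of_step m_gt0 t1 rm) e cell_of_step.
  by rewrite et -(pos_of_step m_gt0 t1 rm) e pos_of_step.
have -> : [set w | forall t, t \in s -> cell t w = a t] =
    [set w | forall i, i \in S -> g i w = b i].
  apply/seteqP; split => w /= h.
    move=> i /allpairsP[[t r] [/= ts]]; rewrite mem_iota add0n => /andP[_ rm] ->.
    by rewrite /b cell_of_step// pos_of_step// -h// nth_cell.
  move=> t ts; apply: (@eq_from_nth _ 1%g); first by rewrite size_cell (eqP (sz _ ts)).
  rewrite size_cell => r rm; rewrite nth_cell// h.
    by rewrite /b cell_of_step// pos_of_step.
  by apply/allpairsP; exists (t, r); rewrite mem_iota.
rewrite iid.2// big_allpairs_dep; congr (_%:E); apply: eq_big_seq => t ts.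
rewrite /cell_mass sz// /weight (big_nth 1%g) (eqP (sz _ ts)).
rewrite /index_iota subn0; apply: eq_big_seq => r; rewrite mem_iota => /andP[_ rm].
by rewrite /b cell_of_step// pos_of_step.
Qed.

End Cells.

(** * The probability of having few aligned letters *)

Section FewLetters.
Local Open Scope ring_scope.
Context dd (Omega : measurableType dd) (R : realType) (P : probability Omega R).
Variables (X : Type) (d : X -> X -> R) (G : groupType).
Variables (act : G -> X -> X) (o : X).
Hypotheses (actP : isometric_faithful_action d act).
Variables (mu : G -> R) (n m1 m2 : nat) (pw sw : 'I_n.+1 -> seq G).
Variables (U Up V : X -> Prop).
Hypothesis sch : schottky act o mu m1 m2 pw sw U Up V.
Hypothesis nB : forall q k, (q <= 8 * k -> 12 ^ q <= n.+1 ^ k)%N.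
Variable g : int -> Omega -> G.
Hypotheses (cG : countable [set: G]) (mu0 : forall x, 0 <= mu x).
Hypothesis iid : iid_steps P mu g.
Variables (es : seq int) (gam : int -> G).
Local Notation m := (m1 + m2)%N.
Local Notation cell := (cell g m).
Local Notation cell_mass := (cell_mass mu m).
Local Notation cell_of := (cell_of m).
Local Notation pos_in_cell := (pos_in_cell m).
Local Notation is_word := (is_word pw sw).
Local Notation lab := ('I_n.+1 * 'I_n.+1)%type.

Definition frozen_cells : seq int := undup [seq cell_of e | e <- es].
(* The cells of the prescribed steps are not used as letters, so that
   relabelling leaves these steps unchanged. *)
Definition free_cell : pred nat := fun i => Posz i \notin frozen_cells.
Definition prescribed (w : Omega) : Prop := forall e, e \in es -> g e w = gam e.

Definition word_mass : R := weight mu (pw ord0) * weight mu (sw ord0).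
(** Halving the mass of all letters lowers the total mass from [1] to at most this number; the mass
    of just one word is taken into account. *)
Definition decay : R := 1 - word_mass / 2.

Lemma word_mass_gt0 : 0 < word_mass.
Proof. by rewrite mulr_gt0// ?(sch_weight_pw_gt0 sch) ?(sch_weight_sw_gt0 sch). Qed.

Lemma cell_mass_word p : cell_mass (word pw sw p) = word_mass.
Proof.
rewrite /cell_mass size_cat (sch_size_pw sch) (sch_size_sw sch) eqxx weight_cat.
by rewrite (sch_weight_pw sch _ ord0) (sch_weight_sw sch _ ord0).
Qed.

Let m_gt0 : (0 < m)%N := sch_size_gt0 sch.
Let cell_countable : countable [set: seq G] := countable_seq cG.
Let mcell : forall t a, measurable [set w | cell t w = a] := measurable_cell iid m.
Let lawc : forall s a, uniq s -> P [set w | forall t, t \in s -> cell t w = a t] =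
    (\prod_(t <- s) cell_mass (a t))%:E := fun s a us => cell_law iid m_gt0 a us.
Let cm0 : forall c, 0 <= cell_mass c := cell_mass_ge0 mu0 m.

Lemma cell_mass_total : (\esum_(c in [set: seq G]) (cell_mass c)%:E = 1)%E.
Proof. exact: (mass_total cell_countable mcell lawc 0). Qed.

(* Averaging over the labels, a path with [q] letters is bad with weight
   [16 / 2 ^ q]; this weight is distributed over the cells. *)
Definition half_mass (c : seq G) : R := cell_mass c * (if is_word c then 2^-1 else 1).

Lemma half_mass_ge0 c : 0 <= half_mass c.
Proof. by rewrite mulr_ge0//; case: ifP => _; rewrite ?invr_ge0. Qed.

Lemma half_mass_total : (\esum_(c in [set: seq G]) (half_mass c)%:E <= decay%:E)%E.
Proof.
pose w0 := word pw sw (ord0, ord0).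
have w0w : is_word w0 by apply/is_wordP; exists (ord0, ord0).
have hw : 0 <= word_mass / 2 by rewrite divr_ge0// ltW// word_mass_gt0.
have e1 : (\esum_(c in [set: seq G]) (word_mass / 2 * (c == w0)%:R)%:E = (word_mass / 2)%:E)%E.
  transitivity (\esum_(c in [set w0]) (word_mass / 2)%:E)%E; last by rewrite esum_set1 ?lee_fin.
  rewrite [RHS]esum_mkcond; apply: eq_esum => c _.
  case: (eqVneq c w0) => [->|h]; first by rewrite mem_set// mulr1.
  by rewrite mulr0 ifF//; apply/negbTE; rewrite notin_setE; exact/eqP.
have le1 : (\esum_(c in [set: seq G]) (half_mass c)%:E + (word_mass / 2)%:E <= 1)%E.
  rewrite -cell_mass_total -e1 -esumD => [|c _|c _]; last 2 first.
  - by rewrite lee_fin half_mass_ge0.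
  - by rewrite lee_fin mulr_ge0.
  apply: le_esum => c _; rewrite -EFinD lee_fin /half_mass.
  case: (eqVneq c w0) => [->|h].
    by rewrite w0w cell_mass_word mulr1; lra.
  by rewrite mulr0 addr0; case: ifP => _; have := cm0 c; lra.
have fin : (\esum_(c in [set: seq G]) (half_mass c)%:E \is a fin_num)%E.
  rewrite ge0_fin_numE; last by apply: esum_ge0 => c _; rewrite lee_fin half_mass_ge0.
  rewrite (le_lt_trans _ (ltry 1))//; apply: le_trans le1.
  by rewrite leeDl// lee_fin.
by rewrite -(fineK fin) -EFinD !lee_fin in le1 *; rewrite /decay; lra.
Qed.

Section Bound.
Variables (t : nat) (zeta : seq G -> X).
Local Notation L := {ffun 'I_t -> lab}.

Definition free_before : seq int := [seq Posz i | i <- iota 0 t & free_cell i].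
(** Cell [t] belongs to the window because the endpoint [zeta] may depend on it; it is never
    relabelled. *)
Definition fixed_cells : seq int := undup (Posz t :: frozen_cells).
Local Notation s1 := [seq i <- fixed_cells | i \notin free_before].
Local Notation s2 := free_before.

Lemma mem_free_before i : (Posz i \in s2) = (i < t)%N && free_cell i.
Proof.
rewrite mem_map; last by move=> a b [].
by rewrite mem_filter mem_iota andbC.
Qed.

Lemma window_uniq : uniq (s1 ++ s2).
Proof.
rewrite cat_uniq filter_uniq ?undup_uniq//= map_inj_uniq ?filter_uniq ?iota_uniq//; last first.
  by move=> a b [].
by rewrite andbT; apply/hasPn => i /= h; rewrite mem_filter h.
Qed.

Lemma window_mem (i : nat) : (i <= t)%N -> Posz i \in s1 ++ s2.
Proof.
rewrite leq_eqVlt mem_cat mem_filter mem_undup inE mem_free_before.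
move=> /orP[/eqP ->|it]; first by rewrite eqxx ltnn.
by rewrite it /= /free_cell; case: (_ \in frozen_cells); rewrite ?orbT.
Qed.

Lemma frozen_mem e : e \in es -> cell_of e \in s1.
Proof.
move=> ee; have h : cell_of e \in frozen_cells by rewrite mem_undup map_f.
rewrite mem_filter mem_undup inE h orbT andbT; apply/negP => /mapP[i].
by rewrite mem_filter => /andP[+ _] e'; rewrite /free_cell -e' h.
Qed.

Lemma size_free_before : (t - size es <= size s2)%N.
Proof.
rewrite size_map size_filter leq_subLR.
rewrite -[X in (X <= _)%N](size_iota 0) -(count_predC free_cell) addnC leq_add2r.
rewrite -size_filter -(size_map Posz) -(size_map cell_of es).
apply: leq_trans (size_undup _); apply: uniq_leq_size.
  by rewrite map_inj_uniq ?filter_uniq ?iota_uniq// => a b [].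
by move=> _ /mapP[i + ->]; rewrite mem_filter /= negbK => /andP[].
Qed.

Definition extend (s : seq int) (cs : seq (seq G)) (i : int) : seq G :=
  nth [::] cs (index i s).

Lemma extend_vals s i w : i \in s -> extend s (vals cell s w) i = cell i w.
Proof. by move=> si; rewrite /extend (nth_map 0) ?index_mem// nth_index. Qed.

Definition shift_label (l : L) (i : int) : lab :=
  if i is Posz j then if free_cell j then label_at l j else 0 else 0.

Definition shift (l : L) (cs : seq (seq G)) : seq (seq G) :=
  [seq relabel pw sw (shift_label l p.1) p.2 | p <- zip (s1 ++ s2) cs].

Lemma size_shift l cs : size cs = size (s1 ++ s2) -> size (shift l cs) = size cs.
Proof. by move=> h; rewrite size_map size_zip h minnn. Qed.

Lemma extend_shift l cs i : size cs = size (s1 ++ s2) ->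
  extend (s1 ++ s2) (shift l cs) i =
  if i \in s1 ++ s2 then relabel pw sw (shift_label l i) (extend (s1 ++ s2) cs i) else [::].
Proof.
move=> sz; rewrite /extend; case: ifPn => is_; last first.
  by rewrite nth_default// size_shift// sz leqNgt index_mem.
rewrite (nth_map (0, [::])) ?size_zip ?sz ?minnn ?index_mem//.
by rewrite nth_zip//= nth_index.
Qed.

Lemma extend_shift_resample l cs : size cs = size (s1 ++ s2) ->
  (fun i => extend (s1 ++ s2) (shift l cs) (Posz i)) =
  resample pw sw free_cell (fun i => extend (s1 ++ s2) cs (Posz i)) l.
Proof.
move=> sz; apply/funext => i; rewrite extend_shift// /resample /shift_label.
case: ifPn => is_; first by case: ifP => // _; rewrite (relabel0 actP sch).
have -> : extend (s1 ++ s2) cs i = [::].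
  by rewrite /extend nth_default// sz leqNgt index_mem.
case: ifPn => // fi; rewrite (_ : label_at l i = 0) ?(relabel0 actP sch)//.
rewrite /label_at; case: insubP => // k kt _.
by move: is_; rewrite mem_cat mem_free_before kt fi orbT.
Qed.

Lemma weight_shift l cs : size cs = size (s1 ++ s2) ->
  \prod_(c <- shift l cs) cell_mass c = \prod_(c <- cs) cell_mass c.
Proof.
move=> sz; rewrite big_map -[in RHS](@unzip2_zip _ _ (s1 ++ s2) cs) ?sz// big_map.
apply: eq_bigr => p _; rewrite /cell_mass (size_relabel actP sch).
by rewrite (weight_relabel actP sch).
Qed.

Lemma shift_bij l : set_bij [set cs | size cs = size (s1 ++ s2)]
  [set cs | size cs = size (s1 ++ s2)] (shift l).
Proof.
have inj cs cs' : size cs = size (s1 ++ s2) -> size cs' = size (s1 ++ s2) ->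
    (forall i, i \in s1 ++ s2 -> extend (s1 ++ s2) cs i = extend (s1 ++ s2) cs' i) -> cs = cs'.
  move=> sz sz' h; apply: (@eq_from_nth _ [::]); rewrite ?sz ?sz'// => j jsz.
  have := h (nth 0 (s1 ++ s2) j) (mem_nth _ jsz).
  by rewrite /extend index_uniq// window_uniq.
split.
- by move=> cs /= sz; rewrite size_shift.
- move=> cs cs'; rewrite !inE /= => sz sz' e; apply: inj => // i hi.
  have : extend (s1 ++ s2) (shift l cs) i = extend (s1 ++ s2) (shift l cs') i by rewrite e.
  by rewrite !extend_shift// hi => /(relabel_inj actP sch).
- move=> cs /= sz; pose l' : L := [ffun k => - l k].
  exists (shift l' cs); first by rewrite /= size_shift.
  apply: inj => [|//|i hi]; first by rewrite !size_shift.
  rewrite !extend_shift ?size_shift// hi (relabelD actP sch).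
  rewrite (_ : _ + _ = 0) ?(relabel0 actP sch)//.
  rewrite /shift_label; case: i hi => j _; rewrite ?addr0//.
  case: ifP => _; rewrite ?addr0//.
  rewrite /label_at; case: (insub j : option 'I_t) => [k|]; rewrite ?addr0//.
  by rewrite ffunE addNr.
Qed.

Definition bad_cells (y : int -> seq G) : bool :=
  few_letters act o m1 pw sw Up V free_cell t (zeta (y t)) (fun i => y (Posz i)).

Definition prescribed_cells (y : int -> seq G) : bool :=
  all (fun e => nth 1%g (y (cell_of e)) (pos_in_cell e) == gam e) es.

Lemma eq_prescribed_cells y y' : (forall e, e \in es -> y (cell_of e) = y' (cell_of e)) ->
  prescribed_cells y = prescribed_cells y'.
Proof. by move=> h; apply: eq_in_all => e /h ->. Qed.

Lemma prescribed_cell w : reflect (prescribed w) (prescribed_cells (cell^~ w)).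
Proof.
apply: (iffP allP) => h e ee; have := h e ee; rewrite (nth_cell_of g m_gt0).
  by move/eqP.
by move=> ->.
Qed.

Lemma frozen_window e : e \in es -> cell_of e \in s1 ++ s2.
Proof. by move=> /frozen_mem; rewrite mem_cat => ->. Qed.

Lemma prescribed_window w :
  prescribed_cells (extend (s1 ++ s2) (vals cell (s1 ++ s2) w)) = prescribed_cells (cell^~ w).
Proof. by apply: eq_prescribed_cells => e /frozen_window; exact: extend_vals. Qed.

Lemma bad_window w :
  bad_cells (extend (s1 ++ s2) (vals cell (s1 ++ s2) w)) = bad_cells (cell^~ w).
Proof.
rewrite /bad_cells extend_vals ?window_mem//; apply: eq_few_letters => i it.
by rewrite extend_vals// window_mem// ltnW.
Qed.

Lemma prescribed_shift l cs : size cs = size (s1 ++ s2) ->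
  prescribed_cells (extend (s1 ++ s2) (shift l cs)) =
  prescribed_cells (extend (s1 ++ s2) cs).
Proof.
move=> sz; apply: eq_prescribed_cells => e ee.
rewrite extend_shift// frozen_window// (_ : shift_label l _ = 0) ?(relabel0 actP sch)//.
have : cell_of e \in frozen_cells by rewrite mem_undup map_f.
by rewrite /shift_label; case: (cell_of e) => // j h; rewrite /free_cell h.
Qed.

Lemma bad_shift l cs : size cs = size (s1 ++ s2) ->
  bad_cells (extend (s1 ++ s2) (shift l cs)) =
  few_letters act o m1 pw sw Up V free_cell t (zeta (extend (s1 ++ s2) cs t))
    (resample pw sw free_cell (fun i => extend (s1 ++ s2) cs (Posz i)) l).
Proof.
move=> sz; rewrite /bad_cells extend_shift_resample//; congr (few_letters _ _ _ _ _ _ _ _ _ (zeta _) _).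
rewrite extend_shift// window_mem// (_ : shift_label l _ = 0) ?(relabel0 actP sch)//.
rewrite /shift_label; case: ifP => // _; rewrite /label_at; case: insubP => // k.
by rewrite ltnn.
Qed.

Lemma half_mass_window cs1 cs2 : size cs1 = size s1 -> size cs2 = size s2 ->
  (\prod_(c <- cs2) cell_mass c) / 2 ^+ count
    (letter pw sw free_cell (fun i => extend (s1 ++ s2) (cs1 ++ cs2) (Posz i))) (iota 0 t) =
  \prod_(c <- cs2) half_mass c.
Proof.
move=> sz1 sz2; rewrite big_split /=; congr (_ * _).
pose y (i : nat) := extend (s1 ++ s2) (cs1 ++ cs2) i.
have e : cs2 = [seq y i | i <- iota 0 t & free_cell i].
  apply: (@eq_from_nth _ [::]) => [|j]; first by rewrite sz2 !size_map.
  rewrite sz2 => jsz; have jsz' : (j < size [seq i <- iota 0 t | free_cell i])%N.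
    by move: jsz; rewrite size_map.
  rewrite (nth_map 0%N)// /y /extend; have us := window_uniq.
  have -> : Posz (nth 0%N [seq i <- iota 0 t | free_cell i] j) = nth 0 (s1 ++ s2) (size s1 + j).
    by rewrite nth_cat ltnNge leq_addr /= addKn (nth_map 0%N).
  by rewrite index_uniq// ?size_cat ?ltn_add2l// nth_cat sz1 ltnNge leq_addr /= addKn.
rewrite -/y [in RHS]e big_map big_filter; move: y {e} => y.
elim: (iota 0 t) => [|i l IH]; first by rewrite big_nil expr0 invr1.
rewrite big_cons -IH [count _ (_ :: _)]/= {1}/letter; case: (free_cell i) => //=.
by case: (is_word _); rewrite /= ?mul1r// exprS invfM.
Qed.

Lemma decay_ge0 : 0 <= decay.
Proof.
rewrite -lee_fin; apply: le_trans half_mass_total.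
by apply: esum_ge0 => c _; rewrite lee_fin half_mass_ge0.
Qed.

Lemma decay_lt1 : decay < 1.
Proof. by rewrite /decay; have := word_mass_gt0; lra. Qed.

Lemma measurable_prescribed : measurable [set w | prescribed w].
Proof.
have := measurable_window cell_countable mcell s1 [set cs | prescribed_cells (extend s1 cs)].
congr measurable; apply/seteqP; split => w /=.
  by rewrite (@eq_prescribed_cells _ (cell^~ w)) => [/prescribed_cell|e /frozen_mem] //; exact: extend_vals.
move=> /prescribed_cell; rewrite (@eq_prescribed_cells _ (extend s1 (vals cell s1 w)))//.
by move=> e /frozen_mem h; rewrite extend_vals.
Qed.

Lemma measurable_bad : measurable [set w | bad_cells (cell^~ w)].
Proof.
have := measurable_window cell_countable mcell (s1 ++ s2)
  [set cs | bad_cells (extend (s1 ++ s2) cs)].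
by congr measurable; apply/seteqP; split => w /=; rewrite bad_window.
Qed.

(** Each [shift l] permutes the windows and keeps mass and prescription, so the probability equals
    its mean over [l]. Exchanging the sums leaves for each window the proportion of bad labels, at
    most [16 / 2 ^ q]. *)
Lemma bad_cells_average :
  (P ([set w | bad_cells (cell^~ w)] `&` [set w | prescribed w]) <=
   \esum_(cs in [set cs | size cs = size (s1 ++ s2)])
     (16 * (\prod_(c <- cs) cell_mass c) * (prescribed_cells (extend (s1 ++ s2) cs))%:R /
     2 ^+ count (letter pw sw free_cell (fun i => extend (s1 ++ s2) cs (Posz i))) (iota 0 t))%:E)%E.
Proof.
set W := [set cs | size cs = _].
pose w (cs : seq (seq G)) : R := \prod_(c <- cs) cell_mass c.
pose chi (cs : seq (seq G)) : R := (bad_cells (extend (s1 ++ s2) cs) &&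
  prescribed_cells (extend (s1 ++ s2) cs))%:R.
have w0 cs : 0 <= w cs by rewrite prodr_ge0.
have chi0 cs : 0 <= chi cs by [].
have eP : P ([set w | bad_cells (cell^~ w)] `&` [set w | prescribed w]) =
    (\esum_(cs in W) (w cs * chi cs)%:E)%E.
  have -> : [set w | bad_cells (cell^~ w)] `&` [set w | prescribed w] =
      [set w | [set cs | bad_cells (extend (s1 ++ s2) cs) &&
         prescribed_cells (extend (s1 ++ s2) cs)] (vals cell (s1 ++ s2) w)].
    apply/seteqP; split => v /=; rewrite bad_window prescribed_window.
      by move=> [-> /prescribed_cell].
    by move=> /andP[-> /prescribed_cell].
  rewrite (prob_window cell_countable mcell lawc)// ?window_uniq//.
  rewrite esum_mkcond [RHS]esum_mkcond; apply: eq_esum => cs _.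
  rewrite /W /chi; case: (boolP (cs \in [set cs | size cs = size (s1 ++ s2)])) => hW; last first.
    rewrite ifF//; apply/negbTE; rewrite notin_setE => -[h _].
    by move: hW; rewrite notin_setE; apply.
  rewrite inE in hW; case: (boolP (_ && _)) => hE.
    by rewrite ifT ?mulr1// inE; split.
  rewrite mulr0 ifF//; apply/negbTE; rewrite notin_setE => -[_ h].
  by rewrite h in hE.
have finP : (\esum_(cs in W) (w cs * chi cs)%:E \is a fin_num)%E.
  by rewrite -eP fin_num_measure//; apply: measurableI;
    [exact: measurable_bad|exact: measurable_prescribed].
rewrite eP; have K0 : (0 < #|L|)%N by apply/card_gt0P; exists [ffun=> 0].
rewrite -(@lee_pmul2l _ (#|L|%:R)%:E) ?lte_fin ?ltr0n//.
have avg : ((#|L|%:R)%:E * (\esum_(cs in W) (w cs * chi cs)%:E) =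
    \esum_(cs in W) (w cs * (prescribed_cells (extend (s1 ++ s2) cs))%:R *
      #|[pred l : L | bad_cells (extend (s1 ++ s2) (shift l cs))]|%:R)%:E)%E.
  transitivity (\sum_(l : L) \esum_(cs in W) (w (shift l cs) * chi (shift l cs))%:E)%E.
    rewrite (eq_bigr (fun=> \esum_(cs in W) (w cs * chi cs)%:E)%E); last first.
      by move=> l _; rewrite [RHS](reindex_esum _ _ _ _ (shift_bij l)).
    by rewrite -(fineK finP) sumEFin sumr_const -EFinM mulr_natl.
  rewrite -esum_sum => [|cs l _ _]; last by rewrite lee_fin mulr_ge0.
  apply: eq_esum => cs; rewrite /W /= => sz.
  rewrite sumEFin; congr (_%:E).
  under eq_bigr => l _ do rewrite /w weight_shift// -/(w cs) /chi prescribed_shift//.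
  rewrite -big_distrr /= -mulrA; congr (_ * _).
  case: (prescribed_cells _); last by rewrite mul0r big1// => l _; rewrite andbF.
  under eq_bigr => l _ do rewrite andbT.
  by rewrite mul1r -sum1_card natr_sum [RHS]big_mkcond /=; apply: eq_bigr => l _; rewrite inE; case: (bad_cells _).
rewrite avg -esumZl => [||cs]; last 2 first.
- by rewrite ler0n.
- by rewrite lee_fin !mulr_ge0// ?invr_ge0 ?exprn_ge0// w0.
apply: le_esum => cs; rewrite /W /= => sz; rewrite -EFinM lee_fin.
rewrite [X in _ <= X](_ : _ = w cs * (prescribed_cells (extend (s1 ++ s2) cs))%:R *
  (16 * #|L|%:R / 2 ^+ count (letter pw sw free_cell
     (fun i => extend (s1 ++ s2) cs (Posz i))) (iota 0 t))); last first.
  by rewrite /w; ring.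
rewrite ler_wpM2l ?mulr_ge0// ler_pdivlMr ?exprn_gt0//.
rewrite (eq_card (B := [pred l : L | few_letters act o m1 pw sw Up V free_cell t
  (zeta (extend (s1 ++ s2) cs t))
  (resample pw sw free_cell (fun i => extend (s1 ++ s2) cs (Posz i)) l)])); last first.
  by move=> l; rewrite !inE bad_shift.
rewrite mulrC -natrX -!natrM ler_nat.
by apply: (few_letters_bound actP sch); exact: nB.
Qed.

(** The prescription lives on [s1] and the factors one half on [s2], so the sum factorizes: [s1]
    gives the probability of the prescription, each cell of [s2] a factor [decay]. A prescribed step
    costs at most one cell. *)
Lemma bad_cells_tail :
  (P ([set w | bad_cells (cell^~ w)] `&` [set w | prescribed w]) <=
   (16 * decay ^+ (t - size es))%:E * P [set w | prescribed w])%E.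
Proof.
have finH : P [set w | prescribed w] \is a fin_num.
  by rewrite fin_num_measure//; exact: measurable_prescribed.
pose a cs1 : R := 16 * ((\prod_(c <- cs1) cell_mass c) * (prescribed_cells (extend s1 cs1))%:R).
pose b cs2 : R := \prod_(c <- cs2) half_mass c.
have p0 (cs : seq (seq G)) : 0 <= \prod_(c <- cs) cell_mass c by rewrite prodr_ge0.
have aP : (\esum_(cs in [set cs | size cs = size s1]) (a cs)%:E =
    16%:E * P [set w | prescribed w])%E.
  rewrite /a; under eq_esum do rewrite EFinM.
  rewrite esumZl//; last by move=> cs; rewrite lee_fin mulr_ge0.
  congr (_ * _)%E.
  have -> : [set w | prescribed w] =
      [set w | [set cs | prescribed_cells (extend s1 cs)] (vals cell s1 w)].
    apply/seteqP; split => v /=; rewrite (@eq_prescribed_cells (extend _ _) (cell^~ v));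
      try by move=> e /frozen_mem h; rewrite extend_vals.
      by move/prescribed_cell.
    by move/prescribed_cell.
  rewrite (prob_window cell_countable mcell lawc)//; last by rewrite filter_uniq ?undup_uniq.
  rewrite esum_mkcond [RHS]esum_mkcond; apply: eq_esum => cs _.
  case: (boolP (cs \in [set cs | size cs = size s1])) => hW; last first.
    rewrite ifF//; apply/negbTE; rewrite notin_setE => -[h _].
    by move: hW; rewrite notin_setE; apply.
  rewrite inE in hW; case: (boolP (prescribed_cells _)) => hE.
    by rewrite ifT ?mulr1// inE; split.
  rewrite mulr0 ifF//; apply/negbTE; rewrite notin_setE => -[_ h].
  by rewrite h in hE.
have bP : (\esum_(cs in [set cs | size cs = size s2]) (b cs)%:E <= (decay ^+ size s2)%:E)%E.
  by apply: esum_seq_prod; [exact: half_mass_ge0|exact: half_mass_total].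
apply: le_trans bad_cells_average _.
rewrite size_cat esum_cat.
apply: (@le_trans _ _ (\esum_(p in [set cs | size cs = size s1] `*` [set cs | size cs = size s2])
    (a p.1 * b p.2)%:E)%E).
  apply: le_esum => -[cs1 cs2] [/= sz1 sz2]; rewrite lee_fin.
  rewrite /b -(half_mass_window sz1 sz2) /a big_cat /=.
  rewrite (@eq_prescribed_cells _ (extend s1 cs1)).
    by rewrite le_eqVlt; apply/orP; left; apply/eqP; ring.
  move=> e /frozen_mem h; rewrite /extend index_cat h nth_cat sz1.
  by rewrite index_mem h.
have d0 := decay_ge0; have d1 := decay_lt1.
apply: le_trans (esum_prod_le _ _ _ _ (M := fine (16%:E * P [set w | prescribed w])%E) _ bP) _.
- by move=> cs; rewrite /a !mulr_ge0.
- by move=> cs; rewrite /b prodr_ge0// => c _; exact: half_mass_ge0.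
- by rewrite fine_ge0// mule_ge0// ?lee_fin.
- by rewrite exprn_ge0.
- by rewrite aP fineK// fin_numM.
- rewrite EFinM fineK ?fin_numM// EFinM -muleA [X in (_ <= X)%E]muleAC -muleA.
  rewrite muleA [X in (_ <= X)%E]muleA lee_wpmul2l ?mule_ge0 ?lee_fin//.
  by rewrite ler_wiXn2l// ?ltW// size_free_before.
Qed.

End Bound.
End FewLetters.

Lemma series_geometric_le (R : realType) (a r : R) : 0 <= a -> 0 <= r -> r < 1 ->
  (\sum_(0 <= j <oo) (a * r ^+ j)%:E <= (a / (1 - r))%:E)%E.
Proof.
move=> a0 r0 r1; have r1' : 0 < 1 - r by lra.
apply: lime_le; first by apply: is_cvg_nneseries => j _ _; rewrite lee_fin mulr_ge0 ?exprn_ge0.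
apply: nearW => k; rewrite sumEFin lee_fin -big_distrr /= ler_wpM2l//.
rewrite -[X in _ <= X]mul1r ler_pdivlMr// mulrC big_mkord.
have := subrX1 r k; move: (\sum_(i < k) _) => s e.
have : 0 <= r ^+ k by rewrite exprn_ge0.
have -> : (1 - r) * s = - ((r - 1) * s) by ring.
by rewrite -e; lra.
Qed.

(** * The walk read in cells, and its time reversal *)

Section Walk.
Local Open Scope group_scope.
Variables (R : realType) (X : Type) (d : X -> X -> R) (G : groupType).
Variables (act : G -> X -> X) (o : X).
Hypotheses (dM : is_metric d) (actP : isometric_faithful_action d act).
Context dd (T : measurableType dd).
Variable g : int -> T -> G.

Lemma fwd_walkD n r w :
  fwd_walk g (n + r) w = fwd_walk g n w * gprod [seq g (Posz (n + j.+1)) w | j <- iota 0 r].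
Proof.
elim: r => [|r IH]; first by rewrite addn0 mulg1.
have -> : iota 0 r.+1 = iota 0 r ++ [:: r] by rewrite -addn1 iotaD.
by rewrite map_cat gprod_cat mulgA -IH /= mulg1 addnS.
Qed.

Lemma take_cell m (t : nat) r w : (r <= m)%N ->
  take r (cell g m t w) = [seq g (Posz (t * m + j.+1)) w | j <- iota 0 r].
Proof.
by move=> rm; rewrite /cell -map_take take_iota (minn_idPl rm).
Qed.

Lemma pos_cells m t w : pos (fun i => cell g m (Posz i) w) t = fwd_walk g (t * m) w.
Proof.
by elim: t => //= t ->; rewrite mulSn addnC fwd_walkD.
Qed.

Lemma fwd_walk_cells m t r w : (r <= m)%N ->
  fwd_walk g (t * m + r) w =
  pos (fun i => cell g m (Posz i) w) t * gprod (take r (cell g m (Posz t) w)).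
Proof. by move=> rm; rewrite fwd_walkD pos_cells take_cell. Qed.

Definition path_length n w : R := (\sum_(i < n) d o (act (g (Posz i.+1) w) o))%R.

Lemma path_length_ge0 n w : (0 <= path_length n w)%R.
Proof. by rewrite sumr_ge0// => i _; exact: d_ge0. Qed.

Lemma le_path_length n k w : (n <= k)%N -> (path_length n w <= path_length k w)%R.
Proof.
move=> /subnKC <-; rewrite /path_length big_split_ord /= lerDl sumr_ge0// => i _.
exact: d_ge0.
Qed.

Lemma fwd_walk_length n w : (d o (act (fwd_walk g n w) o) <= path_length n w)%R.
Proof.
elim: n => [|n IH]; first by rewrite /= (act1 actP) (dxx dM) /path_length big_ord0.
rewrite /path_length big_ord_recr /= (actM actP).
have := dtri dM (act (fwd_walk g n w) o) o (act (fwd_walk g n w) (act (g (Posz n.+1) w) o)).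
by rewrite (act_iso actP); move: IH; rewrite /path_length; lra.
Qed.

(* The walk of [reversed g K] goes from the position at time [K] back to the
   origin and continues as the backward walk; for [K = 0] it exchanges the
   forward and the backward walk. *)
Definition reversed (K : nat) : int -> T -> G := fun i w => (g (Posz K + 1 - i)%R w)^-1.

Lemma reversed_walk_before K j w : (j <= K)%N ->
  fwd_walk (reversed K) j w = (fwd_walk g K w)^-1 * fwd_walk g (K - j) w.
Proof.
elim: j => [|j IH] jK; first by rewrite subn0 mulVg.
rewrite [LHS]/= IH ?(ltnW jK)// /reversed.
have -> : (Posz K + 1 - Posz j.+1)%R = Posz (K - j) by lia.
by rewrite -[(K - j)%N]prednK ?subn_gt0// -subnS /= -mulgA mulgK.
Qed.

Lemma reversed_walk_after K j w :
  fwd_walk (reversed K) (K + j) w = (fwd_walk g K w)^-1 * bwd_walk g j w.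
Proof.
elim: j => [|j IH]; first by rewrite addn0 reversed_walk_before// subnn.
rewrite addnS [LHS]/= IH /= -mulgA /reversed.
by have -> : (Posz K + 1 - Posz (K + j).+1)%R = (- Posz j)%R by lia.
Qed.

Lemma cell_reversed m (k t : nat) w : (t < k)%N ->
  cell (reversed (k * m)) m (Posz t) w = inv_word (cell g m (Posz (k - t.+1)) w).
Proof.
move=> tk; apply: (@eq_from_nth _ 1); rewrite ?size_inv_word !size_cell// => j jm.
rewrite nth_cell// /inv_word (nth_map 1) ?size_rev ?size_cell// nth_rev ?size_cell//.
rewrite nth_cell; last by lia.
rewrite /reversed /step_of; congr (g _ _)^-1.
have -> : k = (k - t.+1 + t.+1)%N by lia.
rewrite addnK; move: (k - t.+1)%N => e; rewrite mulnDl mulSn.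
by lia.
Qed.

End Walk.

(** * Exponential tails *)

Section Rare.
Local Open Scope ring_scope.
Context dd (Omega : measurableType dd) (R : realType) (P : probability Omega R).
Variables (X : Type) (d : X -> X -> R) (G : groupType).
Variables (act : G -> X -> X) (o : X).
Hypotheses (actP : isometric_faithful_action d act).
Variables (mu : G -> R) (n m1 m2 : nat) (pw sw : 'I_n.+1 -> seq G).
Variables (U Up V : X -> Prop).
Hypothesis sch : schottky act o mu m1 m2 pw sw U Up V.
Hypothesis nB : forall q k, (q <= 8 * k -> 12 ^ q <= n.+1 ^ k)%N.
Variable g : int -> Omega -> G.
Hypotheses (cG : countable [set: G]) (mu0 : forall x, 0 <= mu x).
Hypothesis iid : iid_steps P mu g.
Local Notation m := (m1 + m2)%N.
Local Notation rho := (decay mu pw sw).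
Local Notation cellg := (cell g m).
Local Notation badc := (bad_cells act o m1 m2 pw sw Up V).
Local Notation letterg es w := (letter pw sw (free_cell m1 m2 es) (fun i => cellg (Posz i) w)).
Local Notation aheadg w := (ahead act m1 U (fun i => cellg (Posz i) w)).
Local Notation linkedg w := (linked act o m1 Up V (fun i => cellg (Posz i) w)).

(** [16 / rho ^+ 2] bounds one time, the square paying for at most two frozen cells; [m.+1] counts
    the positions within a cell, and [1 - rho] sums over the times from [k] on. *)
Definition rare_const : R := m.+1%:R * (16 / rho ^+ 2) / (1 - rho).

Definition rare es gam k (B : set Omega) : Prop :=
  measurable B /\ (P (B `&` [set w | prescribed g es gam w]) <=
    (rare_const * rho ^+ k)%:E * P [set w | prescribed g es gam w])%E.

Lemma decay_gt0 : 0 < rho.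
Proof.
have := cell_law iid (sch_size_gt0 sch) (fun=> word pw sw (ord0, ord0)) (s := [:: 0]) isT.
rewrite big_seq1 (cell_mass_word sch) => e; rewrite /decay.
suff : word_mass mu pw sw <= 1 by lra.
rewrite -lee_fin -e; apply: probability_le1.
rewrite [X in measurable X](_ : _ = [set w | cellg 0 w = word pw sw (ord0, ord0)]).
  exact: (measurable_cell iid).
apply/seteqP; split => w /= h; first by apply: h; rewrite inE.
by move=> t; rewrite inE => /eqP ->.
Qed.

Lemma rare_const_ge0 : 0 <= rare_const.
Proof.
have := decay_gt0; have := decay_lt1 sch => h1 h0.
by rewrite /rare_const !mulr_ge0// invr_ge0 ?exprn_ge0; lra.
Qed.

Lemma bad_cells_rare es gam t zeta : (size es <= 2)%N ->
  (P ([set w | badc es t zeta (cellg^~ w)] `&` [set w | prescribed g es gam w]) <=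
    (16 / rho ^+ 2 * rho ^+ t)%:E * P [set w | prescribed g es gam w])%E.
Proof.
move=> es2; have h0 := decay_gt0; have h1 := decay_lt1 sch.
apply: le_trans (bad_cells_tail actP sch nB cG mu0 iid es gam t zeta) _.
rewrite lee_wpmul2r// lee_fin -mulrA ler_wpM2l// [leRHS]mulrC ler_pdivlMr ?exprn_gt0//.
by rewrite -exprD ler_wiXn2l// ?ltW//; lia.
Qed.

Definition bad_at es t r : set Omega :=
  [set w | badc es t (fun c => act (gprod (take r c)) o) (cellg^~ w)].

Definition bad_after es k : set Omega :=
  \bigcup_j \big[setU/set0]_(r < m.+1) bad_at es (k + j) r.

Lemma bad_after_rare es gam k : (size es <= 2)%N -> rare es gam k (bad_after es k).
Proof.
move=> es2; have h0 := decay_gt0; have h1 := decay_lt1 sch.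
pose E j r := bad_at es (k + j) r.
have mE j r : measurable (E j r) by exact: (measurable_bad act o m1 m2 pw sw Up V cG iid).
have mU j : measurable (\big[setU/set0]_(r < m.+1) E j r) by exact: bigsetU_measurable.
have mB : measurable (bad_after es k) by exact: bigcupT_measurable.
have mH := measurable_prescribed sch cG iid es gam 0.
split => //.
have finH : P [set w | prescribed g es gam w] \is a fin_num by rewrite fin_num_measure.
have step j : (P (\big[setU/set0]_(r < m.+1) E j r `&` [set w | prescribed g es gam w]) <=
    ((m.+1%:R * (16 / rho ^+ 2 * rho ^+ k)) *
       fine (P [set w | prescribed g es gam w]) * rho ^+ j)%:E)%E.
  rewrite -bigcup_mkord setI_bigcupl bigcup_mkord.
  apply: (@le_trans _ _ (\sum_(r < m.+1) P (E j r `&` [set w | prescribed g es gam w]))%E).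
    apply: (Boole_inequality P (A := fun r => E j r `&` [set w | prescribed g es gam w])).
    by move=> r _; exact: measurableI.
  apply: (@le_trans _ _ (\sum_(r < m.+1) (16 / rho ^+ 2 * rho ^+ (k + j) *
       fine (P [set w | prescribed g es gam w]))%:E)%E).
    apply: lee_sum => r _; rewrite EFinM fineK//; exact: bad_cells_rare.
  rewrite sumEFin sumr_const card_ord lee_fin exprD -mulr_natl.
  by rewrite le_eqVlt; apply/orP; left; apply/eqP; ring.
rewrite -[P [set w | prescribed g es gam w] in leRHS]fineK// -EFinM.
apply: (@le_trans _ _ (\sum_(0 <= j <oo) P (\big[setU/set0]_(r < m.+1) E j r `&`
    [set w | prescribed g es gam w]))%E).
  apply: measure_sigma_subadditive => [j||].
  - exact: measurableI.
  - exact: measurableI.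
  - by rewrite setI_bigcupl.
apply: (@le_trans _ _ (\sum_(0 <= j <oo) ((m.+1%:R * (16 / rho ^+ 2 * rho ^+ k)) *
    fine (P [set w | prescribed g es gam w]) * rho ^+ j)%:E)%E).
  by apply: lee_nneseries => // j _; exact: step.
have p0 : 0 <= fine (P [set w | prescribed g es gam w]) by rewrite fine_ge0.
apply: le_trans (series_geometric_le _ (ltW h0) h1) _.
  by rewrite !mulr_ge0// ?invr_ge0 ?exprn_ge0// ltW.
rewrite lee_fin /rare_const le_eqVlt; apply/orP; left; apply/eqP.
by ring.
Qed.

Lemma forward_tail es gam k : (size es <= 2)%N -> exists B, rare es gam k B /\
  forall w, ~ B w -> exists I : seq nat,
  [/\ uniq I, (3 * count (letterg es w) (iota 0 k) <= 4 * size I)%N /\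
        (4 <= count (letterg es w) (iota 0 k))%N,
      forall i, i \in I -> (i < k)%N && letterg es w i,
      forall i j, i \in I -> j \in I -> (i < j)%N ->
        exists2 l, linkedg w l i & forall z, aheadg w j z -> aheadg w l z &
      forall i t, i \in I -> (k * m <= t)%N -> aheadg w i (act (fwd_walk g t w) o)].
Proof.
move=> es2; exists (bad_after es k); split; first exact: bad_after_rare.
move=> w nb.
have many t r : (k <= t)%N -> (r <= m)%N ->
    ~~ few_letters act o m1 pw sw Up V (free_cell m1 m2 es) t
      (act (gprod (take r (cellg (Posz t) w))) o) (fun i => cellg (Posz i) w).
  move=> kt rm; apply/negP => h; apply: nb; exists (t - k)%N => //.
  rewrite -bigcup_mkord; exists r => //.
  by rewrite /bad_at /= /bad_cells subnKC.
have [I [uI cI lI chI aI]] := persistent_letters actP sch many.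
exists I; split => // i t iI kt.
have m0 := sch_size_gt0 sch.
rewrite (divn_eq t m) (fwd_walk_cells g (t %/ m)); last by rewrite ltnW// ltn_mod.
apply: aI => //; first by rewrite leq_divRL.
by rewrite ltnW// ltn_mod.
Qed.

(** Meant for the reversed walk, which is back at the origin at time [k * m]: there [z] becomes the
    fixed point [x]. As [x] does not move, a single time is considered. *)
Lemma forward_point_tail es gam k z : (size es <= 2)%N -> exists B, rare es gam k B /\
  forall w, ~ B w -> exists I : seq nat,
  [/\ uniq I, (3 * count (letterg es w) (iota 0 k) <= 4 * size I)%N /\
        (4 <= count (letterg es w) (iota 0 k))%N,
      forall i, i \in I -> (i < k)%N && letterg es w i &
      forall i, i \in I -> aheadg w i (act (fwd_walk g (k * m) w) z)].
Proof.
move=> es2; exists [set w | badc es k (fun=> z) (cellg^~ w)]; split.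
  split; first exact: (measurable_bad act o m1 m2 pw sw Up V cG iid).
  apply: le_trans (bad_cells_rare gam k (fun=> z) es2) _.
  have h0 := decay_gt0; have h1 := decay_lt1 sch.
  rewrite lee_wpmul2r// lee_fin ler_wpM2r ?exprn_ge0// ?(ltW h0)//.
  rewrite /rare_const; set a := 16 / _.
  rewrite (_ : _ * a / _ = a * (m.+1%:R / (1 - rho))); last by ring.
  rewrite ler_peMr//.
    by rewrite divr_ge0// exprn_ge0// ltW.
  rewrite ler_pdivlMr ?mul1r; last by lra.
  have : 1 <= m.+1%:R :> R by rewrite ler1n.
  by lra.
move=> w /negP; rewrite /bad_cells /few_letters negb_or -!leqNgt => /andP[h1 h2].
exists (final_stack act o m1 pw sw Up V (free_cell m1 m2 es) (fun i => cellg (Posz i) w) k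
  (act (pos (fun i => cellg (Posz i) w) k) z)); split => //.
- exact: final_stack_uniq.
- by move=> i; exact: final_stack_sub.
- by move=> i iI; rewrite -pos_cells; apply: (final_stack_ahead actP sch) iI.
Qed.

End Rare.

(** * Letters seen from the reversed walk *)

Lemma count_iota_rev (p q : pred nat) k : (forall i, (i < k)%N -> p i = q (k - i.+1)%N) ->
  count p (iota 0 k) = count q (iota 0 k).
Proof.
move=> pq; rewrite (@eq_in_count _ p (preim (fun i => k - i.+1)%N q)); last first.
  by move=> i; rewrite mem_iota => /pq.
rewrite -count_map; apply/permP/uniq_perm; rewrite ?iota_uniq//.
  by rewrite map_inj_in_uniq ?iota_uniq// => i j; rewrite !mem_iota; lia.
move=> j; rewrite mem_iota add0n; apply/mapP/idP => [[i]|jk].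
  by rewrite mem_iota add0n => /= ik ->; lia.
by exists (k - j.+1)%N; rewrite ?mem_iota; lia.
Qed.

Section Reversal.
Local Open Scope ring_scope.
Context dd (Omega : measurableType dd) (R : realType) (P : probability Omega R).
Variables (X : Type) (d : X -> X -> R) (G : groupType).
Variables (act : G -> X -> X) (o : X).
Hypotheses (dM : is_metric d) (actP : isometric_faithful_action d act).
Variables (mu : G -> R) (n m1 m2 : nat) (pw sw : 'I_n.+1 -> seq G).
Variables (U Up V : X -> Prop).
Hypothesis sch : schottky act o mu m1 m2 pw sw U Up V.
Hypothesis nB : forall q k, (q <= 8 * k -> 12 ^ q <= n.+1 ^ k)%N.
Variable g : int -> Omega -> G.
Hypotheses (cG : countable [set: G]) (mu0 : forall x, 0 <= mu x).
Hypothesis iid : iid_steps P mu g.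
Local Notation m := (m1 + m2)%N.
Local Notation rho := (decay mu pw sw).
Local Notation cellg := (cell g m).
Local Notation letterg es w := (letter pw sw (free_cell m1 m2 es) (fun i => cellg (Posz i) w)).
Local Notation aheadg w := (ahead act m1 U (fun i => cellg (Posz i) w)).
Local Notation linkedg w := (linked act o m1 Up V (fun i => cellg (Posz i) w)).
Local Notation rareg := (rare P mu m1 m2 pw sw g).
Local Notation mu' := (fun x : G => mu (x^-1)%g).

Lemma iid_reversed K : iid_steps P mu' (reversed g K).
Proof.
split=> [i a|s a us].
  rewrite [X in measurable X](_ : _ = [set w | g (Posz K + 1 - i) w = (a^-1)%g]).
    exact: iid.1.
  by apply/seteqP; split => w /=; rewrite /reversed; [move=> <-|move=> ->]; rewrite invgK.
pose f (i : int) := Posz K + 1 - i.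
have ff i : f (f i) = i by exact: subKr.
have := iid.2 [seq f i | i <- s] (fun j => ((a (f j))^-1)%g).
rewrite big_map (map_inj_uniq (can_inj ff)) => /(_ us).
under eq_bigr => i _ do rewrite ff.
move=> <-; congr (P _); apply/seteqP; split => w /= h.
  by move=> _ /mapP[i si ->]; rewrite ff -h// /reversed invgK.
by move=> i si; rewrite /reversed (h (f i)) ?map_f// ff invgK.
Qed.

Let es' K (es : seq int) : seq int := [seq Posz K + 1 - e | e <- es].
Let gam' K (gam : int -> G) (e : int) : G := ((gam (Posz K + 1 - e))^-1)%g.

Lemma prescribed_reversed K es gam :
  [set w | prescribed (reversed g K) (es' K es) (gam' K gam) w] =
  [set w | prescribed g es gam w].
Proof.
have ff (e : int) : Posz K + 1 - (Posz K + 1 - e) = e by exact: subKr.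
apply/seteqP; split => w /= h e.
  move=> ees; have := h _ (map_f (fun e => Posz K + 1 - e) ees).
  by rewrite /reversed /gam' ff => /invg_inj.
by move=> /mapP[e0 ees ->]; rewrite /reversed /gam' ff h.
Qed.

(** Reversing at a multiple of [m] maps cells onto cells; hence the reversal time [k * m]. *)
Lemma cell_of_reversed (k : nat) e :
  cell_of m (Posz (k * m) + 1 - e) = Posz k - 1 - cell_of m e.
Proof.
have m0 := sch_size_gt0 sch.
have e1 := step_of_cell m0 e; have r1 := pos_in_cell_lt m0 e.
have rm : (m - (pos_in_cell m e).+1 < m)%N by lia.
rewrite -[RHS](cell_of_step m0 _ rm).
congr cell_of; rewrite -{1}e1 /step_of.
have -> : Posz (m - (pos_in_cell m e).+1).+1 = Posz m - Posz (pos_in_cell m e) by lia.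
by rewrite PoszM; ring.
Qed.

Lemma free_cell_reversed (k i : nat) es : (i < k)%N ->
  free_cell m1 m2 (es' (k * m) es) i = free_cell m1 m2 es (k - i.+1)%N.
Proof.
move=> ik; rewrite /free_cell !mem_undup; congr (~~ _).
have -> : Posz (k - i.+1) = Posz k - 1 - Posz i by lia.
apply/mapP/mapP => [[_ /mapP[e ees ->] h]|[e ees h]].
- by exists e => //; move: h; rewrite cell_of_reversed; lia.
- exists (Posz (k * m) + 1 - e); first exact: map_f.
  by rewrite cell_of_reversed -h; lia.
Qed.

Lemma is_word_mirror c :
  is_word (fun k => inv_word (sw k)) (fun k => inv_word (pw k)) (inv_word c) = is_word pw sw c.
Proof.
apply/is_wordP/is_wordP => -[[k l] e]; exists (l, k).
  by apply: (inv_inj (@inv_wordK G)); rewrite e /word inv_word_cat.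
by rewrite e /word inv_word_cat.
Qed.

Local Notation letter' k es w := (letter (fun k => inv_word (sw k)) (fun k => inv_word (pw k))
  (free_cell m2 m1 (es' (k * m) es)) (fun i => cell (reversed g (k * m)) (m2 + m1) (Posz i) w)).

Lemma letter_reversed k i es w : (i < k)%N -> letter' k es w i = letterg es w (k - i.+1)%N.
Proof.
move=> ik; rewrite /letter (addnC m2) cell_reversed// is_word_mirror.
have -> : free_cell m2 m1 (es' (k * m) es) = free_cell m1 m2 (es' (k * m) es).
  by rewrite /free_cell /frozen_cells (addnC m2).
by rewrite free_cell_reversed.
Qed.

(** Exchanging [m1] and [m2] preserves the middles: [k * m - (i * m + m2)] equals
    [(k - i.+1) * m + m1]. *)
Lemma mid_reversed k i w : (i < k)%N ->
  mid m2 (fun i => cell (reversed g (k * m)) (m2 + m1) (Posz i) w) i =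
  ((fwd_walk g (k * m) w)^-1 * mid m1 (fun i => cellg (Posz i) w) (k - i.+1))%g.
Proof.
move=> ik; rewrite /mid -!fwd_walk_cells ?leq_addr ?leq_addl// reversed_walk_before.
  congr (_ * fwd_walk _ _ _)%g.
  have -> : k = (k - i.+1 + i.+1)%N by lia.
  by rewrite addnK; nia.
by nia.
Qed.

Lemma ahead_reversed k i w y : (i < k)%N ->
  ahead act m2 (fun z => ~ U z)
    (fun i => cell (reversed g (k * m)) (m2 + m1) (Posz i) w) i
    (act (fwd_walk g (k * m) w)^-1%g y) = ~ aheadg w (k - i.+1)%N y.
Proof.
move=> ik; rewrite /ahead mid_reversed// -(actM actP) invgM invgK -mulgA mulgV mulg1.
by [].
Qed.

Lemma rare_reversed K es gam k B :
  rare P mu' m2 m1 (fun k => inv_word (sw k)) (fun k => inv_word (pw k))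
    (reversed g K) (es' K es) (gam' K gam) k B -> rareg es gam k B.
Proof.
rewrite /rare prescribed_reversed /rare_const (addnC m2).
rewrite (_ : decay _ _ _ = rho)//.
by rewrite /decay /word_mass !weight_inv_word (mulrC (weight _ (sw _))).
Qed.

Definition behind es gam k (Y : Omega -> set X) : Prop := exists B, rareg es gam k B /\
  forall w, ~ B w -> exists I : seq nat,
  [/\ uniq I, (3 * count (letterg es w) (iota 0 k) <= 4 * size I)%N /\
        (4 <= count (letterg es w) (iota 0 k))%N,
      forall i, i \in I -> (i < k)%N && letterg es w i &
      forall i y, i \in I -> Y w y -> ~ aheadg w i y].

Lemma behind_reversed es gam k Y : (exists B,
  rare P mu' m2 m1 (fun k => inv_word (sw k)) (fun k => inv_word (pw k))
    (reversed g (k * m)) (es' (k * m) es) (gam' (k * m) gam) k B /\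
  forall w, ~ B w -> exists I : seq nat,
  [/\ uniq I, (3 * count (letter' k es w) (iota 0 k) <= 4 * size I)%N /\
        (4 <= count (letter' k es w) (iota 0 k))%N,
      forall i, i \in I -> (i < k)%N && letter' k es w i &
      forall i y, i \in I -> Y w y ->
        ahead act m2 (fun z => ~ U z)
          (fun i => cell (reversed g (k * m)) (m2 + m1) (Posz i) w) i
          (act (fwd_walk g (k * m) w)^-1%g y)]) ->
  behind es gam k Y.
Proof.
move=> [B [rB hB]]; exists B; split; first exact: rare_reversed rB.
move=> w /hB[I [uI [c3 c4] lI aI]]; exists [seq (k - i.+1)%N | i <- I].
have ce : count (letter' k es w) (iota 0 k) = count (letterg es w) (iota 0 k).
  by apply: count_iota_rev => i ik; exact: letter_reversed.
rewrite ce in c3 c4.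
have ltk i : i \in I -> (i < k)%N by move=> /lI /andP[].
split.
- by rewrite map_inj_in_uniq// => i j /ltk ik /ltk jk; lia.
- by rewrite size_map.
- move=> _ /mapP[i iI ->]; have ik := ltk _ iI.
  by have /andP[_] := lI _ iI; rewrite letter_reversed// => ->; lia.
- move=> _ y /mapP[i iI ->] hy; rewrite -ahead_reversed ?ltk//.
  exact: aI.
Qed.

Let sch' := schottky_mirror actP sch.
Let mu'0 : forall x, 0 <= mu' x. Proof. by move=> x; exact: mu0. Qed.

Lemma behind_point es gam k x : (size es <= 2)%N -> behind es gam k (fun=> [set x]).
Proof.
move=> es2; apply: behind_reversed.
have es2' : (size (es' (k * m) es) <= 2)%N by rewrite size_map.
have [B [rB hB]] := forward_point_tail actP sch' nB cG mu'0 (iid_reversed (k * m))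
  (gam' (k * m) gam) k x es2'.
exists B; split => // w /hB[I [uI cI lI aI]]; exists I; split => // i y iI ->.
have := aI _ iI; rewrite (addnC m2) reversed_walk_before// subnn mulg1.
by rewrite (addnC m1).
Qed.

(** After time [k * m] the reversed walk is the backward walk seen from the position at time
    [k * m], and persistent letters serve all its times simultaneously. *)
Lemma behind_bwd es gam k : (size es <= 2)%N ->
  behind es gam k (fun w => [set act (bwd_walk g j w) o | j in [set: nat]]).
Proof.
move=> es2; apply: behind_reversed.
have es2' : (size (es' (k * m) es) <= 2)%N by rewrite size_map.
have [B [rB hB]] := forward_tail actP sch' nB cG mu'0 (iid_reversed (k * m))
  (gam' (k * m) gam) k es2'.
exists B; split => // w /hB[I [uI cI lI _ aI]]; exists I; split => // i y iI [j _ <-].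
rewrite -(actM actP) -reversed_walk_after; apply: aI => //.
by rewrite (addnC m2) leq_addr.
Qed.

Variable D : R.
Hypothesis sepD : forall f, Up (act f o) -> V (act (f^-1)%g o) ->
  forall x z, ~ U x -> U z -> gromov d o x (act f z) <= D.

(** Two sets of at least [3 * q / 4] among [q >= 4] letters share some [i < i']. The points of [Y w]
    are not ahead of [i]; the walk is ahead of [i'], hence of the stack neighbour of [i]. So the
    separation bound holds at the middle of [i], and moving the base point to [o] costs at most the
    path length. *)
Lemma gromov_tail es gam k Y : (size es <= 2)%N -> behind es gam k Y ->
  exists B, [/\ measurable B,
    (P (B `&` [set w | prescribed g es gam w]) <=
      (2 * rare_const mu m1 m2 pw sw * rho ^+ k)%:E * P [set w | prescribed g es gam w])%E &
    forall w, ~ B w -> forall y j, Y w y ->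
      gromov d o y (act (fwd_walk g j w) o) <= `|D| + path_length d act o g (k * m) w].
Proof.
move=> es2 [B1 [[mB1 rB1] hB1]].
have [B2 [[mB2 rB2] hB2]] := forward_tail actP sch nB cG mu0 iid gam k es2.
have mH := measurable_prescribed sch cG iid es gam 0.
exists (B1 `|` B2); split; first exact: measurableU.
  rewrite setIUl; apply: le_trans (measureU2 _ _ _) _; try exact: measurableI.
  rewrite (_ : 2 * _ * _ = rare_const mu m1 m2 pw sw * rho ^+ k +
     rare_const mu m1 m2 pw sw * rho ^+ k); last by ring.
  have c0 : (0 <= (rare_const mu m1 m2 pw sw * rho ^+ k)%:E)%E.
    by rewrite lee_fin mulr_ge0 ?(rare_const_ge0 sch iid)// exprn_ge0// ltW// (decay_gt0 sch iid).
  by rewrite EFinD ge0_muleDl// leeD.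
move=> w /not_orP[/hB1 [I1 [u1 [c1 c4] l1 a1]] /hB2 [I2 [u2 [c2 _] l2 ch a2]]] y j hy.
have [jk|kj] := ltnP j (k * m).
  apply: le_trans (gromov_le_dr dM _ _ _) _.
  apply: le_trans (fwd_walk_length o dM actP g j w) _.
  have := le_path_length act o dM g w (ltnW jk); have := normr_ge0 D; lra.
have [i [i' [i1 i2 i'2 ii']]] : exists i i', [/\ i \in I1, i \in I2, i' \in I2 & (i < i')%N].
  have fl I : uniq I -> (forall i, i \in I -> (i < k)%N && letterg es w i) ->
      {subset I <= [seq i <- iota 0 k | letterg es w i]}.
    by move=> _ lI i /lI /andP[ik li]; rewrite mem_filter li mem_iota.
  have sz : (2 <= size [seq i <- I1 | i \in I2])%N.
    have e : (size [seq i <- I1 | i \in I2] + size [seq i <- I1 | i \notin I2])%N = size I1.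
      by rewrite !size_filter -(count_predC (mem I2) I1).
    have : (size ([seq i <- I1 | i \notin I2] ++ I2) <= count (letterg es w) (iota 0 k))%N.
      rewrite -size_filter; apply: uniq_leq_size.
        rewrite cat_uniq filter_uniq// u2 andbT; apply/hasPn => i h.
        by rewrite mem_filter h.
      move=> i; rewrite mem_cat mem_filter => /orP[/andP[_]|].
        exact: fl u1 l1 i.
      exact: fl u2 l2 i.
    rewrite size_cat; move: e c1 c2 c4; clear.
    by move: (count _ _) (size _) (size _) (size _) (size _) => q a b c1 c2; lia.
  have uf : uniq [seq i <- I1 | i \in I2] by rewrite filter_uniq.
  have : {subset [seq i <- I1 | i \in I2] <= predI (mem I1) (mem I2)}.
    by move=> i; rewrite mem_filter inE andbC.
  case: [seq i <- I1 | i \in I2] sz uf => [//|a [//|b s]] _ /= /andP[+ _] sub.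
  have /andP[a1' a2'] := sub a (mem_head _ _).
  have /andP[b1' b2'] : b \in predI (mem I1) (mem I2) by apply: sub; rewrite !inE eqxx orbT.
  rewrite inE negb_or neq_ltn => /andP[/orP[ab|ba] _]; first by exists a, b.
  by exists b, a.
have [l li al] := ch _ _ i2 i'2 ii'.
have nU := a1 _ _ i1 hy; have hU := al _ (a2 _ _ i'2 kj).
have := sepD (linked_up actP li) (linked_down actP li) nU hU.
set x := fun i => cellg (Posz i) w; rewrite -(actM actP) mulgK => le1.
have le2 : gromov d (act (mid m1 x i) o) y (act (fwd_walk g j w) o) <= D.
  by rewrite -(gromov_act actP (mid m1 x i)^-1%g) (actK actP).
apply: le_trans (gromov_le_base dM (act (mid m1 x i) o) _ _ _) _.
have -> : mid m1 x i = fwd_walk g (i * m + m1) w by rewrite fwd_walk_cells// leq_addr.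
rewrite /mid -fwd_walk_cells ?leq_addr// in le2.
have := fwd_walk_length o dM actP g (i * m + m1) w.
have ik : (i * m + m1 <= k * m)%N.
  have /andP[ik _] := l1 _ i1; apply: leq_trans (leq_mul ik (leqnn m)).
  by rewrite mulSn [leqLHS]addnC leq_add2r leq_addr.
have := le_path_length act o dM g w ik; have := ler_norm D; lra.
Qed.

End Reversal.

Section Walks.
Local Open Scope ring_scope.
Context dd (Omega : measurableType dd) (R : realType) (P : probability Omega R).
Variables (X : Type) (d : X -> X -> R) (G : groupType).
Variables (act : G -> X -> X) (o : X) (mu : G -> R) (g : int -> Omega -> G).
Hypotheses (cG : countable [set: G]) (iid : iid_steps P mu g).

Lemma bwd_reversed n w : bwd_walk g n w = fwd_walk (reversed g 0) n w.
Proof. by rewrite (reversed_walk_after g 0) /= invg1 mul1g. Qed.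

Lemma fwd_reversed n w : bwd_walk (reversed g 0) n w = fwd_walk g n w.
Proof.
elim: n => //= n ->; rewrite /reversed invgK; congr (_ * g _ w)%g.
by clear; lia.
Qed.

Lemma measurable_fwd_walk n a : measurable [set w | fwd_walk g n w = a].
Proof.
have := measurable_window cG iid.1 [seq Posz (0 + j.+1) | j <- iota 0 n]
  [set cs | gprod cs = a].
congr measurable; apply/seteqP; split => w /=.
  by rewrite /vals -map_comp -[n in fwd_walk g n]add0n fwd_walkD mul1g.
by rewrite /vals -map_comp -[n in fwd_walk g n]add0n fwd_walkD mul1g.
Qed.

Lemma measurable_path_length n : measurable_fun setT (path_length d act o g n).
Proof.
apply: measurable_sum => i.
exact: (measurable_fun_discrete cG (iid.1 (Posz i.+1)) (fun a => d o (act a o))).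
Qed.

End Walks.

Section Controlled.
Local Open Scope ring_scope.
Context dd (Omega : measurableType dd) (R : realType) (P : probability Omega R).
Variables (G : groupType) (g : int -> Omega -> G).

(** One event for all prescriptions of at most two steps: it is almost independent of any two steps,
    which is what moments of products over two steps require. *)
Definition controlled (B : nat -> set Omega) (C rho : R) : Prop := forall k,
  measurable (B k) /\ forall es gam, (size es <= 2)%N ->
    (P (B k `&` [set w | prescribed g es gam w]) <=
      (C * rho ^+ k)%:E * P [set w | prescribed g es gam w])%E.

End Controlled.

Section Exceed.
Local Open Scope ring_scope.
Context dd (Omega : measurableType dd) (R : realType) (P : probability Omega R).
Variables (X : Type) (d : X -> X -> R) (G : groupType).
Variables (act : G -> X -> X) (o : X).
Hypotheses (dM : is_metric d) (actP : isometric_faithful_action d act).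
Variables (mu : G -> R) (n m1 m2 : nat) (pw sw : 'I_n.+1 -> seq G).
Variables (U Up V : X -> Prop).
Hypothesis sch : schottky act o mu m1 m2 pw sw U Up V.
Hypothesis nB : forall q k, (q <= 8 * k -> 12 ^ q <= n.+1 ^ k)%N.
Variable g : int -> Omega -> G.
Hypotheses (cG : countable [set: G]) (mu0 : forall x, 0 <= mu x).
Hypothesis iid : iid_steps P mu g.
Variable D : R.
Hypothesis sepD : forall f, Up (act f o) -> V (act (f^-1)%g o) ->
  forall x z, ~ U x -> U z -> gromov d o x (act f z) <= D.
Local Notation m := (m1 + m2)%N.
Local Notation C := (2 * rare_const mu m1 m2 pw sw).
Local Notation rho := (decay mu pw sw).

(** The rare sets found so far depend on the prescription. The event that the bound itself fails
    does not; it is a countable union of measurable sets and lies in each of them. *)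
Lemma controlled_exceed (y : nat -> Omega -> X) :
  (forall j t, measurable_fun setT (fun w => gromov d o (y j w) (act (fwd_walk g t w) o))) ->
  (forall es gam k, (size es <= 2)%N ->
    behind P act mu m1 m2 pw sw U g es gam k (fun w => [set y j w | j in setT])) ->
  exists B, controlled P g B C rho /\ forall k w, ~ B k w ->
    forall j t, gromov d o (y j w) (act (fwd_walk g t w) o) <=
      `|D| + path_length d act o g (k * m) w.
Proof.
move=> my hy.
pose bd k w : R := `|D| + path_length d act o g (k * m) w.
pose E k j t := [set w | bd k w < gromov d o (y j w) (act (fwd_walk g t w) o)].
have mE k j t : measurable (E k j t).
  have mf : measurable_fun setT (bd k) by apply: measurable_funD => //; exact: (measurable_path_length d act o cG iid).
  have m1' : measurable [set true] by [].
  by have := measurable_fun_ltr mf (my j t) measurableT m1'; rewrite setTI.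
exists (fun k => \bigcup_j \bigcup_t E k j t); split => [k|k w nB' j t]; last first.
  by rewrite leNgt; apply/negP => h; apply: nB'; exists j => //; exists t.
have mB : measurable (\bigcup_j \bigcup_t E k j t).
  by apply: bigcupT_measurable => j; exact: bigcupT_measurable.
split => // es gam es2.
have [B [mB' rB hB]] := gromov_tail dM actP sch nB cG mu0 iid sepD es2 (hy es gam k es2).
have mH := measurable_prescribed sch cG iid es gam 0.
apply: le_trans rB; apply: le_measure; rewrite ?inE; try exact: measurableI.
apply: setSI => w [j _ [t _]]; rewrite /E /= => lt; apply: contrapT => nb.
have := hB w nb (y j w) t; rewrite leNgt lt => /(_ (ex_intro2 _ _ j I erefl)).
by [].
Qed.

Lemma controlled_point x : exists B, controlled P g B C rho /\ forall k w, ~ B k w ->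
  forall t, gromov d o (act (fwd_walk g t w) o) x <= `|D| + path_length d act o g (k * m) w.
Proof.
have [||B [cB hB]] := @controlled_exceed (fun _ _ => x).
- move=> j t; apply: (measurable_fun_discrete cG (measurable_fwd_walk cG iid t)
    (fun a => gromov d o x (act a o))).
- move=> es gam k es2.
  have -> : (fun w : Omega => [set x | j in [set: nat]]) = (fun=> [set x]).
    by apply/funext => w; apply/seteqP; split => [_ [_ _ <-]//|_ ->]; exists 0%N.
  exact: (behind_point actP sch nB cG mu0 iid).
- exists B; split => // k w /hB h t; rewrite (gromovC dM).
  exact: h 0%N t.
Qed.

Lemma controlled_two_sided : exists B, controlled P g B C rho /\ forall k w, ~ B k w ->
  forall j t, gromov d o (act (bwd_walk g j w) o) (act (fwd_walk g t w) o) <=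
    `|D| + path_length d act o g (k * m) w.
Proof.
apply: controlled_exceed => [j t|es gam k es2]; last exact: (behind_bwd actP sch nB cG mu0 iid).
have cGG : countable [set: G * G] by rewrite -setXTT; exact: countableX.
have mY (a : G * G) : measurable [set w | (bwd_walk g j w, fwd_walk g t w) = a].
  rewrite [X in measurable X](_ : _ = [set w | fwd_walk (reversed g 0) j w = a.1] `&`
      [set w | fwd_walk g t w = a.2]).
    apply: measurableI; last exact: (measurable_fwd_walk cG iid).
    exact: (measurable_fwd_walk cG (iid_reversed iid 0)).
  case: a => a b; apply/seteqP; split => w /=; rewrite -bwd_reversed => -[-> ->] //.
exact: (measurable_fun_discrete cGG mY (fun a => gromov d o (act a.1 o) (act a.2 o))).
Qed.

End Exceed.

(** * Moments *)

Section Expectation.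
Local Open Scope ring_scope.
Context dd (Omega : measurableType dd) (R : realType) (P : probability Omega R).
Variables (G : groupType) (mu : G -> R) (g : int -> Omega -> G).
Hypotheses (cG : countable [set: G]) (mu0 : forall x, 0 <= mu x).
Hypothesis iid : iid_steps P mu g.

Lemma vals_prescribed es cs : uniq es -> size cs = size es ->
  [set w | vals g es w = cs] =
  [set w | prescribed g es (fun e => nth 1%g cs (index e es)) w].
Proof.
move=> us sz; have e : cs = [seq nth 1%g cs (index e es) | e <- es].
  apply: (@eq_from_nth _ 1%g); rewrite ?size_map// => j jsz.
  by rewrite (nth_map 0) -?sz// index_uniq// -sz.
apply/seteqP; split => w /=.
  move=> h e' ee'; have : [seq g e w | e <- es] = [seq nth 1%g cs (index e es) | e <- es].
    by rewrite -e.
  by move=> /eq_in_map/(_ e' ee').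
by move=> h; rewrite [RHS]e; apply/eq_in_map => e' /h.
Qed.

(** Each value of the steps in [es] is a prescription, for which the rare event contributes a factor
    [C * rho ^+ k]; what remains is a product of single-step sums. *)
Lemma expectation_controlled B C rho (phi : G -> R) (M : R) es k :
  controlled P g B C rho -> 0 <= C * rho ^+ k -> (forall a, 0 <= phi a) ->
  (\esum_(a in [set: G]) (phi a * mu a)%:E <= M%:E)%E ->
  uniq es -> (size es <= 2)%N ->
  (\int[P]_w ((\prod_(a <- vals g es w) phi a)%:E * (\1_(B k) w)%:E) <=
   (C * rho ^+ k * M ^+ size es)%:E)%E.
Proof.
move=> cB c0 phi0 phiM us es2.
rewrite (integral_discrete P (countable_seq cG) (measurable_vals iid.1 es)
  (Psi := fun cs => (\prod_(a <- cs) phi a)%:E)) => [|cs|]; last 2 first.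
- by rewrite lee_fin prodr_ge0.
- by have [] := cB k.
apply: (@le_trans _ _ (\esum_(cs in [set cs | size cs = size es])
   ((C * rho ^+ k)%:E * (\prod_(a <- cs) (phi a * mu a))%:E))%E).
  rewrite [leRHS]esum_mkcond; apply: le_esum => cs _.
  have [sz|sz] := eqVneq (size cs) (size es).
    rewrite ifT ?inE// vals_prescribed//.
    have [_ /(_ es (fun e => nth 1%g cs (index e es)) es2)] := cB k.
    rewrite -vals_prescribed// (prob_vals iid.2)// sz eqxx -EFinM => le.
    apply: (@le_trans _ _ ((\prod_(a <- cs) phi a)%:E *
        (C * rho ^+ k * \prod_(a <- cs) mu a)%:E)%E).
      by rewrite lee_pmul// lee_fin prodr_ge0.
    by rewrite -!EFinM big_split /= mulrCA.
  rewrite ifF; last by apply/negbTE; rewrite notin_setE; exact/eqP.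
  rewrite (_ : B k `&` _ = set0) ?measure0 ?mule0//.
  by apply/seteqP; split => // w [_ /= e]; move: sz; rewrite -e size_map eqxx.
rewrite esumZl// => [|cs]; last by rewrite lee_fin prodr_ge0// => a _; rewrite mulr_ge0.
rewrite [leRHS]EFinM lee_wpmul2l ?lee_fin//.
by apply: esum_seq_prod => // a; rewrite mulr_ge0.
Qed.

Lemma expectation_window (phi : G -> R) (M : R) es : (forall a, 0 <= phi a) ->
  (\esum_(a in [set: G]) (phi a * mu a)%:E <= M%:E)%E -> uniq es ->
  (\int[P]_w (\prod_(a <- vals g es w) phi a)%:E <= (M ^+ size es)%:E)%E.
Proof.
move=> phi0 phiM us.
rewrite (integral_window cG iid.1 iid.2 (F := fun cs => (\prod_(a <- cs) phi a)%:E))//.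
  under eq_esum do rewrite -EFinM -big_split /=.
  by apply: esum_seq_prod => // a; rewrite mulr_ge0.
by move=> cs; rewrite lee_fin prodr_ge0.
Qed.

Lemma measurable_prod_vals (phi : G -> R) es :
  measurable_fun setT (fun w => \prod_(a <- vals g es w) phi a).
Proof.
exact: (measurable_fun_discrete (countable_seq cG) (measurable_vals iid.1 es)
  (fun cs => \prod_(a <- cs) phi a)).
Qed.

End Expectation.

Section FirstExit.
Local Open Scope ring_scope.
Context dd (Omega : measurableType dd) (R : realType) (P : probability Omega R).

(** Contains the event that [k] is the first index with [w] outside [B k]; for [k = 0] nothing
    precedes, hence [setT]. *)
Definition before (B : nat -> set Omega) (k : nat) : set Omega :=
  if k is k'.+1 then B k' else setT.

(** Shifting the index costs [1 / rho]; the summand [1] serves [k = 0]. *)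
Lemma controlled_before (G : groupType) (g : int -> Omega -> G) B C rho :
  0 <= C -> 0 < rho -> controlled P g B C rho ->
  controlled P g (before B) (1 + C / rho) rho.
Proof.
move=> C0 r0 cB [|k] /=.
  split => // es gam _; rewrite setTI expr0 mulr1 -{1}[P _]mul1e lee_wpmul2r// lee_fin.
  by rewrite lerDl divr_ge0// ltW.
have [mB hB] := cB k; split => // es gam /hB h; apply: le_trans (h gam) _.
rewrite lee_wpmul2r// lee_fin exprS mulrA mulrDl -mulrA mulVf ?gt_eqF// mulr1.
have r0' := ltW r0; by rewrite ler_wpM2r ?exprn_ge0// mul1r lerDr.
Qed.

(* If [w] is in all the [B k], the series diverges. *)
Lemma first_exit (B : nat -> set Omega) (a : nat -> R) w (x c : R) : 0 < c ->
  (forall k, c <= a k) -> (forall k, ~ B k w -> x <= a k) ->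
  (x%:E <= \sum_(0 <= k <oo) (a k * \1_(before B k) w)%:E)%E.
Proof.
move=> c0 ca xa.
have a0 k : 0 <= a k by apply: le_trans (ca k); exact: ltW.
have t0 k : (0 <= (a k * \1_(before B k) w)%:E)%E by rewrite lee_fin mulr_ge0.
have part N : (\sum_(0 <= k < N) (a k * \1_(before B k) w)%:E <=
    \sum_(0 <= k <oo) (a k * \1_(before B k) w)%:E)%E.
  by apply: nneseries_lim_ge.
have [[k0 nk0]|all_in] := pselect (exists k, ~ B k w).
  have ex : exists k, `[< ~ B k w >] by exists k0; exact/asboolP.
  case: (ex_minnP ex) => k /asboolP nk mink.
  apply: le_trans (part k.+1); rewrite big_nat_recr//= -[leLHS]add0e leeD//.
    by rewrite sume_ge0.
  have -> : \1_(before B k) w = 1 :> R.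
    rewrite indicE mem_set//; case: k nk mink => //= k _ mink.
    apply: contrapT => nb; have := mink k; rewrite ltnn => h.
    by have := h (asboolT nb).
  by rewrite mulr1 lee_fin xa.
have in_before k : before B k w.
  by case: k => //= k; apply: contrapT => nb; apply: all_in; exists k.
have [N xN] := archi_nat (x / c).
apply: le_trans (part N); rewrite sumEFin lee_fin.
apply: (@le_trans _ _ (\sum_(0 <= k < N) c)).
  by rewrite sumr_const_nat subn0 -mulr_natl -ler_pdivrMr.
by apply: ler_sum => k _; rewrite indicE mem_set// mulr1.
Qed.

Lemma integral_sup_le (J : Type) (j0 : J) (f : J -> Omega -> R) (B : nat -> set Omega)
  (a : nat -> Omega -> R) (c C r : R) :
  (forall j w, 0 <= f j w) -> (forall k, measurable (B k)) ->
  (forall k, measurable_fun setT (a k)) ->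
  0 < c -> (forall k w, c <= a k w) -> (forall k w, ~ B k w -> forall j, f j w <= a k w) ->
  0 <= C -> 0 <= r -> r < 1 ->
  (forall k, (\int[P]_w (a k w * \1_(before B k) w)%:E <= (C * r ^+ k)%:E)%E) ->
  (\int[P]_w ereal_sup [set (f j w)%:E | j in [set: J]] <= (C / (1 - r))%:E)%E.
Proof.
move=> f0 mB ma c0 ca fa C0 r0 r1 h.
have mbB k : measurable (before B k) by case: k => [|k]; [exact: measurableT|exact: mB].
have a0 k w : 0 <= a k w by apply: le_trans (ca k w); exact: ltW.
apply: (@le_trans _ _ (\int[P]_w \sum_(0 <= k <oo) (a k w * \1_(before B k) w)%:E)%E).
  apply: le_integral_nneg => w.
    apply: le_trans (ereal_sup_ubound _); last by exists j0.
    by rewrite lee_fin.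
  apply: ge_ereal_sup => _ [j _ <-].
  by apply: (first_exit c0) => // k nb; exact: fa.
rewrite integral_nneseries//; last 2 first.
- move=> k; apply/measurable_EFinP/measurable_funM => //; exact: measurable_indic.
- by move=> k w _; rewrite lee_fin mulr_ge0.
apply: le_trans (series_geometric_le C0 r0 r1).
apply: lee_nneseries => // k _ *; apply: integral_ge0 => w _.
by rewrite lee_fin mulr_ge0.
Qed.

End FirstExit.

(** * Elementary inequalities *)

Section Real.
Local Open Scope ring_scope.
Variable R : realType.

(** Half of the decay is spent on the power: for [rho = expR (- (2 * eps))], the inequality
    [1 + y <= expR y] at [y = eps * k.+1 / s] bounds the power by a constant times
    [expR (eps * k.+1)]. *)
Lemma poly_geometric (s rho : R) m : 0 < s -> 0 < rho -> rho < 1 -> (0 < m)%N ->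
  exists C r : R, [/\ 0 <= C, 0 <= r, r < 1 &
    forall k, (k.+1 * m)%:R `^ s * rho ^+ k <= C * r ^+ k].
Proof.
move=> s0 r0 r1 m0; have m0' : 0 < m%:R :> R by rewrite ltr0n.
pose eps := - ln rho / 2; have e0 : 0 < eps by rewrite divr_gt0// oppr_gt0 ln_lt0// r0.
have rhoE : rho = expR (- (2 * eps)).
  by rewrite -[LHS]lnK ?posrE//; congr expR; rewrite /eps; lra.
exists ((s * m%:R / eps) `^ s * expR eps), (expR (- eps)); split.
- by rewrite mulr_ge0 ?powR_ge0 ?expR_ge0.
- exact: expR_ge0.
- by rewrite expR_lt1 oppr_lt0.
move=> k; set N : R := (k.+1 * m)%:R.
have NE : N = k.+1%:R * m%:R by rewrite /N natrM.
pose y := eps * k.+1%:R / s.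
have a0 : 0 <= s * m%:R / eps by rewrite divr_ge0// ltW// mulr_gt0.
have le1 : N <= s * m%:R / eps * expR y.
  have -> : N = s * m%:R / eps * y by rewrite NE /y; field; rewrite !gt_eqF.
  by rewrite ler_wpM2l//; have := expR_ge1Dx y; lra.
have -> : (s * m%:R / eps) `^ s * expR eps * expR (- eps) ^+ k =
    (s * m%:R / eps * expR y) `^ s * rho ^+ k.
  rewrite (powRM _ a0 (expR_ge0 _)) -!mulrA; congr (_ * _).
  rewrite rhoE -!expRM_natl /powR gt_eqF ?expR_gt0// expRK -!expRD; congr expR.
  by rewrite /y -natr1; field; rewrite gt_eqF.
rewrite ler_wpM2r ?exprn_ge0 ?(ltW r0)// ge0_ler_powR ?(ltW s0)// nnegrE//.
by rewrite mulr_ge0 ?expR_ge0.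
Qed.

(** Compare with the largest term; this covers [p < 1] and [p >= 1] alike. *)
Lemma powR_sum_le (p : R) (I : eqType) (s : seq I) (x : I -> R) : 0 < p ->
  (forall i, 0 <= x i) ->
  (\sum_(i <- s) x i) `^ p <= (size s)%:R `^ p * \sum_(i <- s) x i `^ p.
Proof.
move=> p0 x0; case: s => [|i0 s0]; first by rewrite !big_nil powR0 ?gt_eqF// mulr0.
have [i is_ imax] : exists2 i, i \in i0 :: s0 & forall j, j \in i0 :: s0 -> x j <= x i.
  elim: s0 i0 => [|b s IH] a; first by exists a => [|j]; rewrite inE// => /eqP ->.
  have [i iS imax] := IH b; have [le|lt] := lerP (x a) (x i).
    exists i => [|j]; rewrite inE ?iS ?orbT// => /orP[/eqP ->//|]; exact: imax.
  exists a => [|j]; rewrite inE ?eqxx// => /orP[/eqP ->//|/imax h].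
  exact: le_trans h (ltW lt).
move: (i0 :: s0) is_ imax => s is_ imax.
apply: (@le_trans _ _ (((size s)%:R * x i) `^ p)).
  apply: ge0_ler_powR; rewrite ?(ltW p0)// ?nnegrE ?mulr_ge0 ?sumr_ge0//.
  apply: (@le_trans _ _ (\sum_(j <- s) x i)).
    by rewrite big_seq [leRHS]big_seq; apply: ler_sum => j /imax.
  by rewrite big_const_seq count_predT iter_addr_0 mulr_natl.
rewrite powRM // ler_wpM2l ?powR_ge0// (big_rem i)//= lerDl sumr_ge0// => j _.
exact: powR_ge0.
Qed.

Lemma powR_add_le (p a b : R) : 0 < p -> 0 <= a -> 0 <= b ->
  (a + b) `^ p <= 2 `^ p * (a `^ p + b `^ p).
Proof.
move=> p0 a0 b0; have := @powR_sum_le p _ [:: true; false] (fun c => if c then a else b) p0.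
by rewrite !big_cons !big_nil !addr0; apply=> -[].
Qed.

(** The tangent line of [expR] at [theta * y] bounds [expR y] and [expR 0 = 1] from below; the
    weights [theta] and [1 - theta] cancel the terms in [y]. *)
Lemma expR_convex (theta y : R) : 0 <= theta -> theta <= 1 ->
  expR (theta * y) <= 1 - theta + theta * expR y.
Proof.
move=> t0 t1; set u := expR (theta * y); have u0 : 0 < u by exact: expR_gt0.
have h1 : u * (1 + (1 - theta) * y) <= expR y.
  have -> : expR y = u * expR ((1 - theta) * y) by rewrite -expRD; congr expR; ring.
  by rewrite ler_wpM2l ?(ltW u0)// expR_ge1Dx.
have h2 : u * (1 - theta * y) <= 1.
  apply: (@le_trans _ _ (u * expR (- (theta * y)))); last by rewrite expRxMexpNx_1.
  by rewrite ler_wpM2l ?(ltW u0)// expR_ge1Dx.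
have h3 := ler_wpM2l t0 h1.
have t1' : 0 <= 1 - theta by lra.
have h4 := ler_wpM2l t1' h2.
have : theta * (u * (1 + (1 - theta) * y)) + (1 - theta) * (u * (1 - theta * y)) = u by ring.
by lra.
Qed.

End Real.

Section Moments.
Local Open Scope ring_scope.
Context dd (Omega : measurableType dd) (R : realType) (P : probability Omega R).
Variables (G : groupType) (mu : G -> R) (g : int -> Omega -> G).
Hypotheses (cG : countable [set: G]) (mu0 : forall x, 0 <= mu x).
Hypothesis iid : iid_steps P mu g.
Variables (C rho : R) (m : nat).
Hypotheses (C0 : 0 <= C) (rho0 : 0 < rho) (rho1 : rho < 1) (m0 : (0 < m)%N).

Let C' := 1 + C / rho.
Let C'0 : 0 <= C'. Proof. by rewrite addr_ge0// divr_ge0// ltW. Qed.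

(** [K] is chosen before the events and functions, whence uniformity in [x]. The power [(p + 1) * q]
    of the length collects [p] for each factor and the number of summands in [L k]; the lower bound
    [b] makes the series diverge where no exit occurs. *)
Lemma moment_series (p : R) (phi : G -> R) (b M : R) (q : nat) :
  0 < p -> 0 < b -> (forall a, b <= phi a) -> (0 < q <= 2)%N ->
  (\esum_(a in [set: G]) (phi a * mu a)%:E <= M%:E)%E ->
  exists2 K : R, 0 < K & forall (B : nat -> set Omega) (J : Type) (f : J -> Omega -> R)
    (L : nat -> seq (seq int)), J -> controlled P g B C rho ->
    (forall k s, s \in L k -> uniq s /\ size s = q) ->
    (forall k, size (L k) = ((k.+1 * m) ^ q)%N) ->
    (forall j w, 0 <= f j w) ->
    (forall k w, ~ B k w -> forall j, f j w <= ((k.+1 * m)%:R `^ p) ^+ q *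
       \sum_(s <- L k) \prod_(a <- vals g s w) phi a) ->
    (\int[P]_w ereal_sup [set (f j w)%:E | j in [set: J]] < K%:E)%E.
Proof.
move=> p0 b0 phib /andP[q0 q2] phiM.
have phi0 a : 0 <= phi a by apply: le_trans (phib a); exact: ltW.
have M0 : 0 <= M.
  rewrite -lee_fin; apply: le_trans phiM; apply: esum_ge0 => a _.
  by rewrite lee_fin mulr_ge0.
have s0 : 0 < (p + 1) * q%:R by rewrite mulr_gt0 ?ltr0n// addr_gt0.
have [E [r [E0 r0 r1 Er]]] := poly_geometric s0 rho0 rho1 m0.
exists (E * C' * M ^+ q / (1 - r) + 1).
  have : 0 <= E * C' * M ^+ q / (1 - r) by rewrite !mulr_ge0 ?exprn_ge0 ?invr_ge0//; lra.
  by lra.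
move=> B J f L j0 cB Lu Ls f0 fB.
have N1 k : 1 <= (k.+1 * m)%:R `^ p :> R.
  have : 1 `^ p <= (k.+1 * m)%:R `^ p :> R.
    by rewrite (ge0_ler_powR (ltW p0)) ?nnegrE ?ler1n// muln_gt0.
  by rewrite powR1.
pose a k w : R := ((k.+1 * m)%:R `^ p) ^+ q * \sum_(s <- L k) \prod_(a <- vals g s w) phi a.
have prod_ge (s : seq int) w : b ^+ size s <= \prod_(a <- vals g s w) phi a.
  elim: s => [|e s IH]; first by rewrite expr0 big_nil.
  by rewrite exprS /= big_cons ler_pM// ?exprn_ge0// ltW.
have prod0 (s : seq int) w : 0 <= \prod_(a <- vals g s w) phi a by rewrite prodr_ge0.
apply: (@le_lt_trans _ _ (E * C' * M ^+ q / (1 - r))%:E); last by rewrite lte_fin ltrDl.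
apply: (@integral_sup_le _ _ _ _ _ j0 f B a (b ^+ q)) => //.
- by move=> k; have [] := cB k.
- move=> k; apply: measurable_funM => //; apply: measurable_sum => s.
  exact: (measurable_prod_vals cG iid).
- by rewrite exprn_gt0.
- move=> k w; rewrite /a -[leLHS]mul1r ler_pM ?exprn_ge0 ?(ltW b0) ?exprn_ege1//.
  have := Lu k; have := Ls k; case: (L k) => [|s l] szl Lk.
    by move: szl => /= /esym/eqP; rewrite expn_eq0 muln_eq0 /= (gtn_eqF m0).
  rewrite big_cons; have [_ <-] := Lk s (mem_head _ _).
  by rewrite (le_trans (prod_ge s w))// lerDl sumr_ge0.
- by rewrite !mulr_ge0 ?exprn_ge0.
move=> k.
pose F w := (\sum_(s <- L k) ((\prod_(a <- vals g s w) phi a)%:E *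
  (\1_(before B k) w)%:E))%E.
have mbB : measurable (before B k).
  by case: k {F} => [|k]; [exact: measurableT|have [] := cB k].
have F0 w : (0 <= F w)%E by apply: sume_ge0 => s _; rewrite mule_ge0 ?lee_fin.
have mF (s : seq int) : measurable_fun setT
    (fun w => (\prod_(a <- vals g s w) phi a)%:E * (\1_(before B k) w)%:E)%E.
  apply: emeasurable_funM; apply/measurable_EFinP.
    exact: (measurable_prod_vals cG iid).
  exact: measurable_indic.
rewrite (eq_integral (fun w => ((((k.+1 * m)%:R `^ p) ^+ q)%:E * F w)%E)); last first.
  move=> w _; rewrite /F; under eq_bigr do rewrite -EFinM.
  by rewrite sumEFin -EFinM -big_distrl /= mulrA.
rewrite ge0_integralZl//; last exact: (emeasurable_sum (L k) mF).
rewrite /F ge0_integral_sum//; last by move=> s w _; rewrite mule_ge0 ?lee_fin.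
apply: (@le_trans _ _ ((((k.+1 * m)%:R `^ p) ^+ q)%:E *
    (\sum_(s <- L k) (C' * rho ^+ k * M ^+ q)%:E))%E).
  rewrite lee_wpmul2l ?lee_fin ?exprn_ge0 ?powR_ge0// big_seq [leRHS]big_seq.
  apply: lee_sum => s /(Lu k)[us sz]; rewrite -[in leRHS]sz.
  apply: (expectation_controlled cG mu0 iid (controlled_before C0 rho0 cB)) => //.
    by rewrite mulr_ge0 ?exprn_ge0 ?(ltW rho0).
  by rewrite sz.
rewrite sumEFin -EFinM lee_fin big_const_seq count_predT iter_addr_0 Ls.
have := Er k; set N : R := (k.+1 * m)%:R => ErN.
have N0 : 0 <= N by [].
have NE : N `^ ((p + 1) * q%:R) = (N `^ p) ^+ q * ((k.+1 * m) ^ q)%:R.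
  rewrite natrX -exprMn powRrM powR_mulrn ?powR_ge0//; congr (_ ^+ _).
  rewrite powRD; first by rewrite powRr1.
  by apply/implyP => _; rewrite pnatr_eq0 muln_eq0 /= -lt0n.
rewrite -mulr_natl [leLHS](_ : _ = N `^ ((p + 1) * q%:R) * rho ^+ k * (C' * M ^+ q)); last first.
  by rewrite NE; ring.
rewrite (_ : E * C' * M ^+ q * r ^+ k = E * r ^+ k * (C' * M ^+ q)); last by ring.
by rewrite ler_wpM2r// mulr_ge0 ?exprn_ge0.
Qed.

(** With [r] the square root of [rho], AM-GM bounds the integrand by the indicator of the rare event
    over [r ^+ k] plus [r ^+ k] times the square of the weight. A small [kappa] keeps the growth of
    the second moment below this decay. *)
Lemma exp_moment_series (phi : G -> R) (D c : R) : 0 < D -> 0 < c ->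
  (forall a, 0 <= phi a) -> (\esum_(a in [set: G]) (mu a)%:E = 1)%E ->
  (\esum_(a in [set: G]) (mu a * expR (c * phi a))%:E < +oo)%E ->
  exists kappa K : R, [/\ 0 < kappa, 0 < K &
  forall (B : nat -> set Omega) (J : Type) (v : J -> Omega -> R), J ->
    controlled P g B C rho ->
    (forall k w, ~ B k w -> forall j, v j w <= D + \sum_(i < k * m) phi (g (Posz i.+1) w)) ->
    (\int[P]_w ereal_sup [set (expR (kappa * v j w))%:E | j in [set: J]] < K%:E)%E].
Proof.
move=> D0 c0 phi0 mass1 fin.
have Mpos : (0 <= \esum_(a in [set: G]) (mu a * expR (c * phi a))%:E)%E.
  by apply: esum_ge0 => a _; rewrite lee_fin mulr_ge0 ?expR_ge0.
pose Mc : R := fine (\esum_(a in [set: G]) (mu a * expR (c * phi a))%:E)%E.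
have McE : (\esum_(a in [set: G]) (mu a * expR (c * phi a))%:E = Mc%:E)%E.
  by rewrite fineK// ge0_fin_numE.
have Mc1 : 1 <= Mc.
  rewrite -lee_fin -McE -mass1; apply: le_esum => a _; rewrite lee_fin ler_peMr//.
  by rewrite -expR0 ler_expR mulr_ge0// ltW.
pose eps := - ln rho / 2; have e0 : 0 < eps by rewrite divr_gt0// oppr_gt0 ln_lt0// rho0.
have rhoE : rho = expR (- eps) * expR (- eps).
  by rewrite -expRD -[LHS]lnK ?posrE//; congr expR; rewrite /eps; lra.
(* The mean of [expR (2 * kappa * phi a)] will be at most [expR (theta * (Mc - 1))]; its [m]-th
   power must not exceed [expR (eps / 2)]. The added [1] keeps the denominator positive when
   [Mc = 1]. *)
pose theta := Num.min 1 (eps / (2 * ((Mc - 1) * m%:R + 1))).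
have den0 : 0 < (Mc - 1) * m%:R + 1 by rewrite ltr_wpDl// mulr_ge0// subr_ge0.
have t0 : 0 < theta by rewrite lt_min ltr01 divr_gt0// mulr_gt0.
have t1 : theta <= 1 by rewrite ge_min lexx.
have te : theta * (Mc - 1) * m%:R <= eps / 2.
  have : theta <= eps / (2 * ((Mc - 1) * m%:R + 1)) by rewrite ge_min lexx orbT.
  rewrite ler_pdivlMr ?mulr_gt0// => h.
  by move: h; have := t0; lra.
pose kappa := theta * c / 2; have k0 : 0 < kappa by rewrite divr_gt0// mulr_gt0.
pose r := expR (- eps); pose r2 := expR (- eps / 2).
have r20 : 0 <= r2 by exact: expR_ge0.
have r21 : r2 < 1 by rewrite expR_lt1; lra.
have rr2 : r <= r2 by rewrite ler_expR; lra.
have r0 : 0 < r by exact: expR_gt0.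
pose M := expR (theta * (Mc - 1)).
have psiM : (\esum_(a in [set: G]) (expR (2 * kappa * phi a) * mu a)%:E <= M%:E)%E.
  apply: (@le_trans _ _ (\esum_(a in [set: G])
      ((1 - theta)%:E * (mu a)%:E + theta%:E * (mu a * expR (c * phi a))%:E))%E).
    apply: le_esum => a _; rewrite -!EFinM -EFinD lee_fin.
    have -> : 2 * kappa * phi a = theta * (c * phi a) by rewrite /kappa; field.
    have := ler_wpM2l (mu0 a) (expR_convex (c * phi a) (ltW t0) t1).
    by lra.
  have t1' : 0 <= 1 - theta by rewrite subr_ge0.
  rewrite esumD; last 2 first.
  - by move=> a _; rewrite mule_ge0 ?lee_fin.
  - by move=> a _; rewrite mule_ge0 ?lee_fin ?mulr_ge0 ?expR_ge0// ltW.
  rewrite !esumZl ?(ltW t0)//; last by move=> a; rewrite lee_fin mulr_ge0 ?expR_ge0.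
  rewrite mass1 McE -!EFinM -EFinD lee_fin.
  by have := expR_ge1Dx (theta * (Mc - 1)); rewrite -/M; lra.
have Mr k : r ^+ k * M ^+ (k * m) <= r2 ^+ k.
  rewrite mulnC exprM -exprMn; apply: lerXn2r; rewrite ?nnegrE ?mulr_ge0 ?exprn_ge0 ?expR_ge0//.
  by rewrite /M /r /r2 -expRM_natl -expRD ler_expR; lra.
exists kappa, ((C' + expR (2 * kappa * D)) / (1 - r2) + 1).
have E0 : 0 <= C' + expR (2 * kappa * D) by rewrite addr_ge0// expR_ge0.
have K0 : 0 <= (C' + expR (2 * kappa * D)) / (1 - r2) by rewrite divr_ge0//; lra.
split => //; first by lra.
move=> B J v j0 cB vB.
pose a k w := expR (kappa * (D + \sum_(i < k * m) phi (g (Posz i.+1) w))).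
apply: (le_lt_trans _ (_ : ((C' + expR (2 * kappa * D)) / (1 - r2))%:E < _)%E); last first.
  by rewrite lte_fin ltrDl.
apply: (@integral_sup_le _ _ _ _ _ j0 _ B a 1) => //.
- by move=> k; have [] := cB k.
- move=> k; apply: measurableT_comp => //; apply: measurable_funM => //.
  apply: measurable_funD => //; apply: measurable_sum => i.
  exact: (measurable_fun_discrete cG (iid.1 (Posz i.+1))).
- move=> k w; rewrite -expR0 ler_expR mulr_ge0 ?(ltW k0)// addr_ge0 ?(ltW D0)//.
  by rewrite sumr_ge0.
- by move=> k w nb j; rewrite ler_expR ler_wpM2l ?(ltW k0)// vB.
move=> k.
pose es := [seq Posz i.+1 | i <- iota 0 (k * m)].
pose Psi w : R := \prod_(x <- vals g es w) expR (2 * kappa * phi x).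
have aE w : a k w ^+ 2 = expR (2 * kappa * D) * Psi w.
  rewrite /a /Psi /vals -map_comp big_map -expR_sum -expRD -expRM_natl; congr expR.
  rewrite -big_distrr /= -(big_mkord xpredT (fun i => phi (g (Posz i.+1) w))).
  by rewrite /index_iota subn0; ring.
have mbB : measurable (before B k).
  by case: k @es @Psi {aE} => [|k]; [move=> *; exact: measurableT|have [] := cB k].
have Psi0 w : 0 <= Psi w by rewrite prodr_ge0// => x _; exact: expR_ge0.
have rk0 : 0 < r ^+ k by rewrite exprn_gt0.
apply: (@le_trans _ _ (\int[P]_w (((r ^+ k)^-1)%:E * (\1_(before B k) w)%:E +
    (r ^+ k * expR (2 * kappa * D))%:E * (Psi w)%:E))%E).
  apply: le_integral_nneg => w; first by rewrite lee_fin mulr_ge0 ?expR_ge0.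
  rewrite -!EFinM -EFinD lee_fin -[_ * Psi w]mulrA -aE indicE; case: (_ \in _); last first.
    by rewrite !mulr0 add0r mulr_ge0 ?sqr_ge0 ?(ltW rk0).
  rewrite !mulr1; set x := a k w; set t := r ^+ k in rk0 *.
  have x0 : 0 <= x by exact: expR_ge0.
  (* AM-GM *)
  rewrite -(@ler_pM2l _ t)// mulrDr mulfV ?gt_eqF//.
  have -> : t * (t * x ^+ 2) = (t * x) ^+ 2 by ring.
  have : 0 <= t * x by rewrite mulr_ge0// ltW.
  by have := sqr_ge0 (t * x - 1); move: (t * x) => y; nra.
have mPsi : measurable_fun setT Psi by exact: (measurable_prod_vals cG iid).
rewrite ge0_integralD//; last 4 first.
- by move=> w _; rewrite -EFinM lee_fin mulr_ge0// invr_ge0 ltW.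
- by apply: emeasurable_funM => //; apply/measurable_EFinP; exact: measurable_indic.
- by move=> w _; rewrite -EFinM lee_fin !mulr_ge0 ?expR_ge0// ltW.
- by apply: emeasurable_funM => //; exact/measurable_EFinP.
rewrite !ge0_integralZl//; last 5 first.
- exact/measurable_EFinP.
- by move=> w _; rewrite lee_fin.
- by rewrite lee_fin mulr_ge0 ?expR_ge0 ?(ltW rk0).
- by apply/measurable_EFinP; exact: measurable_indic.
- by rewrite lee_fin invr_ge0 ltW.
rewrite integral_indic// setIT.
have ues : uniq es by rewrite map_inj_uniq ?iota_uniq// => i j [].
have h1 := expectation_window cG mu0 iid (fun a => expR_ge0 (2 * kappa * phi a)) psiM ues.
rewrite size_map size_iota in h1.
have h2 : (P (before B k) <= (C' * rho ^+ k)%:E)%E.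
  have [_ /(_ [::] (fun=> 1%g) isT)] := controlled_before C0 rho0 cB k.
  rewrite (_ : [set w | _] = setT); last by apply/seteqP; split.
  by rewrite setIT probability_setT mule1.
apply: (@le_trans _ _ (((r ^+ k)^-1)%:E * (C' * rho ^+ k)%:E +
   (r ^+ k * expR (2 * kappa * D))%:E * (M ^+ (k * m))%:E)%E).
  apply: leeD; rewrite lee_wpmul2l// lee_fin ?invr_ge0 ?mulr_ge0 ?expR_ge0 ?(ltW rk0)//.
rewrite -!EFinM -EFinD lee_fin rhoE -/r exprMn.
rewrite (_ : (r ^+ k)^-1 * _ = C' * r ^+ k); last by field; rewrite gt_eqF.
rewrite [leRHS]mulrDl lerD// ?ler_wpM2l//.
  by apply: lerXn2r; rewrite ?nnegrE// ltW.
rewrite mulrAC [leLHS]mulrC ler_wpM2l ?expR_ge0//; exact: Mr.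
Qed.

End Moments.

(** * Application to the forward and the backward walk *)

Lemma large_alphabet (b e : nat) :
  exists n, forall q k, (q <= e * k -> b.+1 ^ q <= n.+1 ^ k)%N.
Proof.
exists (b.+1 ^ e).-1 => q k qk.
by rewrite prednK ?expn_gt0// -expnM leq_pexp2l.
Qed.

Section Axes.
Local Open Scope ring_scope.
Variables (R : realType) (X : Type) (d : X -> X -> R) (G : groupType).
Variables (act : G -> X -> X) (o : X).

Lemma orbit_seqV (a : G) i : orbit_seq act o (a^-1)%g i = orbit_seq act o a (- i).
Proof.
rewrite /orbit_seq; congr (act _ o); case: i => [[|i]|i] //=.
- by rewrite expVgn.
- by rewrite expVgn invgK.
Qed.

Lemma contracting_axis_le K K' (a : G) : 0 < K -> K <= K' ->
  contracting_axisZ d K (orbit_seq act o a) -> contracting_axisZ d K' (orbit_seq act o a).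
Proof.
move=> K0 KK' [qa [ex ca]]; split.
  move=> s t; have /andP[h1 h2] := qa s t; apply/andP; split.
    apply: le_trans h1; apply: lerB => //.
    by rewrite ler_wpM2l// lef_pV2// posrE; lra.
  apply: le_trans h2 _; apply: lerD => //.
  by rewrite ler_wpM2r.
split=> // x y xy u v hu hv; apply: (le_trans _ KK'); apply: (ca x y) => //.
by apply: le_trans xy _; rewrite lerD2l lerN2.
Qed.

Lemma contracting_axisV K (a : G) : contracting_axisZ d K (orbit_seq act o a) ->
  contracting_axisZ d K (orbit_seq act o (a^-1)%g).
Proof.
move=> [qg ct]; split => [s t|].
  rewrite !orbit_seqV; have := qg (- s) (- t).
  by rewrite -opprD mulrNz normrN.
rewrite (_ : range _ = range (orbit_seq act o a))//.
apply/seteqP; split => _ [i _ <-].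
  by rewrite orbit_seqV; exists (- i).
by exists (- i) => //; rewrite orbit_seqV opprK.
Qed.

Lemma independent_isometriesV (a b : G) : independent_isometries d act o a b ->
  independent_isometries d act o (a^-1)%g (b^-1)%g.
Proof.
move=> ab M M0; have [N hN] := ab M M0; exists N => i j.
by rewrite !orbit_seqV => /hN; rewrite !abszN.
Qed.

End Axes.

Section Domination.
Local Open Scope ring_scope.
Context dd (Omega : measurableType dd) (R : realType) (P : probability Omega R).
Variables (X : Type) (d : X -> X -> R) (G : groupType).
Variables (act : G -> X -> X) (o : X).
Hypotheses (dM : is_metric d) (dG : geodesic_space d) (actP : isometric_faithful_action d act).
Hypothesis cG : countable [set: G].

Definition dominated (g : int -> Omega -> G) (C rho D : R) m (J : Type)
    (v : J -> Omega -> R) : Prop :=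
  exists B, controlled P g B C rho /\
    forall k w, ~ B k w -> forall j, v j w <= D + path_length d act o g (k * m) w.

Definition one_sided (g : int -> Omega -> G) x (n : nat) w : R :=
  gromov d o (act (fwd_walk g n w) o) x.

Definition two_sided (g : int -> Omega -> G) (nn : nat * nat) w : R :=
  gromov d o (act (bwd_walk g nn.2 w) o) (act (fwd_walk g nn.1 w) o).

Lemma walk_dominated (mu : G -> R) (g : int -> Omega -> G) la lb K :
  (forall x, 0 <= mu x) -> iid_steps P mu g ->
  (0 < size la)%N -> (0 < size lb)%N -> 0 < weight mu la -> 0 < weight mu lb -> 1 <= K ->
  contracting_axisZ d K (orbit_seq act o (gprod la)) ->
  contracting_axisZ d K (orbit_seq act o (gprod lb)) ->
  independent_isometries d act o (gprod la) (gprod lb) ->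
  exists C rho D m, [/\ 0 <= C, 0 < rho < 1, 0 < D, (0 < m)%N &
    (forall x, dominated g C rho D m (one_sided g x)) /\ dominated g C rho D m (two_sided g)].
Proof.
move=> mu0 iid la0 lb0 wa wb K1 aK bK ab.
have [n nB] := large_alphabet 11 8.
have [m1 [m2 [pw [sw [U [Up [V [D [sch sepD]]]]]]]]] :=
  schottky_exists dM dG actP n.+1 la0 lb0 wa wb K1 aK bK ab.
exists (2 * rare_const mu m1 m2 pw sw), (decay mu pw sw), (`|D| + 1), (m1 + m2)%N; split.
- by rewrite mulr_ge0// (rare_const_ge0 sch iid).
- by rewrite (decay_gt0 sch iid) (decay_lt1 sch).
- by rewrite ltr_wpDl.
- exact: sch_size_gt0 sch.
split => [x|].
  have [B [cB hB]] := controlled_point dM actP sch nB cG mu0 iid sepD x.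
  exists B; split => // k w /hB h j; apply: le_trans (h j) _.
  by rewrite lerD2r lerDl.
have [B [cB hB]] := controlled_two_sided dM actP sch nB cG mu0 iid sepD.
exists B; split => // k w /hB h [i j]; apply: le_trans (h j i) _.
by rewrite lerD2r lerDl.
Qed.

Lemma controlled_reversed (g : int -> Omega -> G) B (C rho : R) :
  controlled P (reversed g 0) B C rho -> controlled P g B C rho.
Proof.
move=> cB k; have [mB hB] := cB k; split => // es gam es2.
by rewrite -(prescribed_reversed g 0); apply: hB; rewrite size_map.
Qed.

Lemma controlled_union (g : int -> Omega -> G) B B' (C C' rho rho' : R) :
  (forall es gam, measurable [set w | prescribed g es gam w]) ->
  0 <= C -> 0 <= C' -> 0 <= rho -> 0 <= rho' ->
  controlled P g B C rho -> controlled P g B' C' rho' ->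
  controlled P g (fun k => B k `|` B' k) (C + C') (Num.max rho rho').
Proof.
move=> mH C0 C'0 r0 r'0 cB cB' k; have [mB hB] := cB k; have [mB' hB'] := cB' k.
split; first exact: measurableU.
move=> es gam es2; rewrite setIUl.
have h (r : R) : 0 <= r -> r <= Num.max rho rho' -> r ^+ k <= Num.max rho rho' ^+ k.
  by move=> r0' le; apply: lerXn2r; rewrite ?nnegrE// (le_trans r0').
apply: le_trans (measureU2 _ _ _) _; try exact: measurableI.
rewrite mulrDl EFinD ge0_muleDl ?lee_fin ?mulr_ge0 ?exprn_ge0// ?le_max ?r0//.
apply: leeD; [apply: le_trans (hB es gam es2) _|apply: le_trans (hB' es gam es2) _];
  by rewrite lee_wpmul2r// lee_fin ler_wpM2l// h// le_max lexx ?orbT.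
Qed.

(** The extra block of [m] steps guarantees a summand to carry [D] when [k = 0]; with [D] in every
    summand they stay away from [0], as the divergence argument requires. *)
Lemma path_power_le (g : int -> Omega -> G) (p D : R) k m w : 0 < p -> 0 < D -> (0 < m)%N ->
  (D + path_length d act o g (k * m) w) `^ p <= (k.+1 * m)%:R `^ p *
    \sum_(i <- iota 0 (k.+1 * m)) (d o (act (g (Posz i.+1) w) o) + D) `^ p.
Proof.
move=> p0 D0 m0; pose x i := d o (act (g (Posz i.+1) w) o) + D.
have x0 i : 0 <= x i by rewrite addr_ge0 ?(d_ge0 dM)// ltW.
have := powR_sum_le (iota 0 (k.+1 * m)) p0 x0; rewrite size_iota; apply: le_trans.
have pl n : path_length d act o g n w = \sum_(i <- iota 0 n) d o (act (g (Posz i.+1) w) o).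
  rewrite /path_length -(big_mkord xpredT (fun i => d o (act (g (Posz i.+1) w) o))).
  by rewrite /index_iota subn0.
have le : D + path_length d act o g (k * m) w <= \sum_(i <- iota 0 (k.+1 * m)) x i.
  rewrite big_split /= -pl [leLHS]addrC lerD//.
    by apply: (le_path_length act o dM); rewrite mulSn leq_addl.
  rewrite big_const_seq count_predT size_iota iter_addr_0 -mulr_natl.
  by apply: ler_peMl; [exact: ltW|rewrite ler1n muln_gt0].
apply: ge0_ler_powR le; rewrite ?(ltW p0) ?nnegrE ?sumr_ge0//.
by rewrite addr_ge0 ?(path_length_ge0 _ _ dM)// ltW.
Qed.

End Domination.

Section PowerMoments.
Local Open Scope ring_scope.
Context dd (Omega : measurableType dd) (R : realType) (P : probability Omega R).
Variables (X : Type) (d : X -> X -> R) (G : groupType).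
Variables (act : G -> X -> X) (o : X).
Hypotheses (dM : is_metric d) (actP : isometric_faithful_action d act).
Hypothesis cG : countable [set: G].
Variables (mu : G -> R) (g : int -> Omega -> G).
Hypotheses (mu0 : forall x, 0 <= mu x) (iid : iid_steps P mu g).
Hypothesis mass1 : (\esum_(a in [set: G]) (mu a)%:E = 1)%E.
Variable p : R.
Hypotheses (p0 : 0 < p) (fin : finite_pth_moment d act o mu p).

Let phi (D : R) (a : G) : R := (d o (act a o) + D) `^ p.

Lemma phi_ge D a : 0 < D -> D `^ p <= phi D a.
Proof.
move=> D0; apply: ge0_ler_powR; rewrite ?nnegrE ?addr_ge0 ?(d_ge0 dM) ?(ltW p0) ?(ltW D0)//.
by rewrite lerDr d_ge0.
Qed.

Lemma phi_moment D : 0 < D ->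
  exists M : R, (\esum_(a in [set: G]) (phi D a * mu a)%:E <= M%:E)%E.
Proof.
move=> D0.
have F0 : (0 <= \esum_(a in [set: G]) (mu a * (d o (act a o)) `^ p)%:E)%E.
  by apply: esum_ge0 => a _; rewrite lee_fin mulr_ge0 ?powR_ge0.
pose F := fine (\esum_(a in [set: G]) (mu a * (d o (act a o)) `^ p)%:E)%E.
have FE : (\esum_(a in [set: G]) (mu a * (d o (act a o)) `^ p)%:E = F%:E)%E.
  by rewrite fineK// ge0_fin_numE.
have two0 : 0 <= 2 `^ p by exact: powR_ge0.
exists (2 `^ p * (F + D `^ p)).
apply: (@le_trans _ _ (\esum_(a in [set: G]) ((2 `^ p)%:E *
    ((mu a * (d o (act a o)) `^ p)%:E + (D `^ p)%:E * (mu a)%:E)))%E).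
  apply: le_esum => a _; rewrite -[((D `^ p)%:E * _)%E]EFinM -EFinD -EFinM lee_fin.
  have := powR_add_le p0 (d_ge0 dM o (act a o)) (ltW D0).
  by move/(ler_wpM2r (mu0 a)) => h; apply: le_trans h _; rewrite le_eqVlt; apply/orP; left; apply/eqP; ring.
rewrite esumZl//; last first.
  by move=> a; rewrite adde_ge0// ?mule_ge0// lee_fin ?mulr_ge0 ?powR_ge0.
rewrite esumD; last 2 first.
- by move=> a _; rewrite lee_fin mulr_ge0 ?powR_ge0.
- by move=> a _; rewrite mule_ge0// lee_fin ?powR_ge0.
rewrite esumZl ?powR_ge0//.
by rewrite mass1 mule1 FE -EFinD -EFinM.
Qed.

Lemma one_sided_moment C rho D m : 0 <= C -> 0 < rho < 1 -> 0 < D -> (0 < m)%N ->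
  (forall x, dominated P d act o g C rho D m (one_sided d act o g x)) ->
  exists2 K : R, 0 < K & forall x,
  (\int[P]_w ereal_sup [set ((one_sided d act o g x n w) `^ p)%:E | n in [set: nat]] < K%:E)%E.
Proof.
move=> C0 /andP[r0 r1] D0 m0 hdom; have [M hM] := phi_moment D0.
have b0 : 0 < D `^ p by rewrite powR_gt0.
have [K K0 hK] := moment_series cG mu0 iid C0 r0 r1 m0 (q := 1) p0 b0
  (fun a => phi_ge a D0) isT hM.
exists K => // x; have [B [cB hB]] := hdom x.
apply: (hK B nat (fun n w => one_sided d act o g x n w `^ p)
  (fun k => [seq [:: Posz i.+1] | i <- iota 0 (k.+1 * m)])) => //.
- by move=> k _ /mapP[i _ ->].
- by move=> k; rewrite size_map size_iota expn1.
- by move=> n w; exact: powR_ge0.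
move=> k w /hB h n; rewrite expr1 big_map.
under eq_bigr => i _ do rewrite /vals /= big_seq1.
apply: le_trans (path_power_le act o dM g k w p0 D0 m0).
apply: ge0_ler_powR (h n); rewrite ?nnegrE ?(ltW p0) ?gromov_ge0//.
by rewrite addr_ge0 ?(ltW D0) ?(path_length_ge0 _ _ dM).
Qed.

Lemma measurable_prescribed_steps es gam : measurable [set w | prescribed g es gam w].
Proof.
rewrite (_ : [set w | _] = [set w | [set cs | cs = [seq gam e | e <- es]] (vals g es w)]).
  exact: (measurable_window cG iid.1).
by apply/seteqP; split => w /=; rewrite /vals => /eq_in_map.
Qed.

(** The same Gromov product is bounded by the forward path and, through the reversed walk, by the
    backward one; the power [2 * p] is the product of both [p]-th powers. Expanded, each term
    involves one positive and one nonpositive step, which are always distinct. *)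
Lemma two_sided_moment C rho D m C' rho' D' m' :
  0 <= C -> 0 < rho < 1 -> 0 < D -> (0 < m)%N ->
  0 <= C' -> 0 < rho' < 1 -> 0 < D' -> (0 < m')%N ->
  dominated P d act o g C rho D m (two_sided d act o g) ->
  dominated P d act o (reversed g 0) C' rho' D' m' (two_sided d act o (reversed g 0)) ->
  exists2 K : R, 0 < K &
  (\int[P]_w ereal_sup [set ((two_sided d act o g nn w) `^ (2 * p))%:E
     | nn in [set: nat * nat]] < K%:E)%E.
Proof.
move=> C0 /andP[r0 r1] D0 m0 C'0 /andP[r'0 r'1] D'0 m'0 [B [cB hB]] [B' [cB' hB']].
pose E := Num.max D D'; have E0 : 0 < E by rewrite lt_max D0.
have [M hM] := phi_moment E0.
have b0 : 0 < E `^ p by rewrite powR_gt0.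
(* The two alphabets may have different cell lengths; [m * m'] serves both. *)
have mm0 : (0 < m * m')%N by rewrite muln_gt0 m0.
have rr0 : 0 < Num.max rho rho' by rewrite lt_max r0.
have rr1 : Num.max rho rho' < 1 by rewrite gt_max r1.
have CC0 : 0 <= C + C' by rewrite addr_ge0.
have [K K0 hK] := moment_series cG mu0 iid CC0 rr0 rr1 mm0 (q := 2) p0 b0
  (fun a => phi_ge a E0) isT hM.
exists K => //.
have cBB := controlled_union measurable_prescribed_steps C0 C'0 (ltW r0) (ltW r'0) cB
  (controlled_reversed cB').
apply: (hK _ _ (fun nn w => two_sided d act o g nn w `^ (2 * p))
  (fun k => [seq [:: Posz i.+1; - Posz j] |
     i <- iota 0 (k.+1 * (m * m')), j <- iota 0 (k.+1 * (m * m'))]) (0%N, 0%N) cBB).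
- move=> k _ /allpairsP[[i j] [_ _ ->]]; split => //=.
  by rewrite inE andbT; case: j.
- by move=> k; rewrite size_allpairs size_iota.
- by move=> nn w; exact: powR_ge0.
move=> k w /not_orP[/hB h /hB' h'] [i j].
set N := (k.+1 * (m * m'))%N.
have -> : \sum_(s <- [seq [:: Posz i.+1; - Posz j] | i <- iota 0 N, j <- iota 0 N])
      \prod_(a <- vals g s w) (d o (act a o) + E) `^ p =
    (\sum_(i <- iota 0 N) (d o (act (g (Posz i.+1) w) o) + E) `^ p) *
    (\sum_(j <- iota 0 N) (d o (act (reversed g 0 (Posz j.+1) w) o) + E) `^ p).
  rewrite big_allpairs_dep big_distrl /=; apply: eq_bigr => a _.
  rewrite big_distrr /=; apply: eq_bigr => b _.
  rewrite /vals /= big_cons big_seq1; congr (_ * (_ + _) `^ p).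
  rewrite /reversed (_ : Posz 0 + 1 - Posz b.+1 = - Posz b); last by clear; lia.
  by rewrite -(act_isoV actP) (dC dM).
have dist0 nn v : 0 <= two_sided d act o v nn w by exact: gromov_ge0.
have bound v D1 m1 : 0 < D1 -> D1 <= E -> (m1 %| m * m')%N ->
    two_sided d act o g (i, j) w <= D1 + path_length d act o v (k * m1) w ->
    two_sided d act o g (i, j) w `^ p <= N%:R `^ p *
      \sum_(i <- iota 0 N) (d o (act (v (Posz i.+1) w) o) + E) `^ p.
  move=> D10 D1E m1d le; apply: le_trans (path_power_le act o dM v k w p0 E0 mm0).
  apply: ge0_ler_powR; rewrite ?nnegrE ?(ltW p0)//.
    by rewrite addr_ge0 ?(ltW E0) ?(path_length_ge0 _ _ dM).
  apply: le_trans le _; apply: lerD => //; apply: (le_path_length act o dM).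
  by rewrite leq_mul2l (dvdn_leq mm0 m1d) orbT.
rewrite mulrC powRrM (powR_mulrn 2) ?powR_ge0// !expr2 mulrACA.
apply: ler_pM; rewrite ?powR_ge0//.
  by apply: (bound g D m) => //; rewrite ?le_max ?lexx ?dvdn_mulr.
apply: (bound (reversed g 0) D' m') => //; rewrite ?le_max ?lexx ?orbT ?dvdn_mull//.
have := h' (j, i); rewrite /two_sided /= fwd_reversed -bwd_reversed.
by rewrite gromovC.
Qed.

End PowerMoments.

Unset Implicit Arguments.

Theorem theorem1p2 (R : realType) (X : Type) (d : X -> X -> R)
  (G : groupType) (act : G -> X -> X) (o : X) (mu : G -> R)
  (dd : measure_display) (Omega : measurableType dd) (P : probability Omega R)
  (g : int -> Omega -> G) :
  is_metric d -> geodesic_space d ->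
  isometric_faithful_action d act -> countable [set: G] ->
  (exists h1 h2 : G, [/\ contracting_isometry d act o h1,
      contracting_isometry d act o h2 & independent_isometries d act o h1 h2]) ->
  prob_mass mu -> non_elementary d act o mu ->
  iid_steps P mu g ->
  (forall p : R, 0 < p -> finite_pth_moment d act o mu p ->
     exists K : R, 0 < K /\ forall x : X,
       (\int[P]_w ereal_sup [set ((gromov d o (act (fwd_walk g n w) o) x) `^ p)%:E
                            | n in [set: nat]] < K%:E)%E /\
       (\int[P]_w ereal_sup
           [set ((gromov d o (act (bwd_walk g nn.2 w) o) (act (fwd_walk g nn.1 w) o))
                   `^ (2 * p))%:E
           | nn in [set: nat * nat]] < K%:E)%E) /\
  (finite_exp_moment d act o mu ->
     exists kappa K : R, [/\ 0 < kappa, 0 < K & forall x : X,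
       (\int[P]_w ereal_sup [set (expR (kappa * gromov d o x (act (fwd_walk g n w) o)))%:E
                            | n in [set: nat]] < K%:E)%E /\
       (\int[P]_w ereal_sup
           [set (expR (kappa * gromov d o (act (bwd_walk g nn.2 w) o)
                                        (act (fwd_walk g nn.1 w) o)))%:E
           | nn in [set: nat * nat]] < K%:E)%E]).
Proof.
move=> dM dG actP cG _ [mu0 mass1] [a [b [sa sb [Ka [Ka0 aK]] [Kb [Kb0 bK]] ab]]] iid.
have [la [la0 wa ea]] := semigroup_word sa.
have [lb [lb0 wb eb]] := semigroup_word sb.
pose K : R := 1 + Ka + Kb.
have K1 : 1 <= K by rewrite /K -addrA lerDl addr_ge0// ltW.
have {}aK : contracting_axisZ d K (orbit_seq act o a).
  by apply: contracting_axis_le Ka0 _ aK; rewrite /K; lra.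
have {}bK : contracting_axisZ d K (orbit_seq act o b).
  by apply: contracting_axis_le Kb0 _ bK; rewrite /K; lra.
subst a b.
have [C [rho [D [m [C0 r01 D0 m0 [one two]]]]]] :=
  walk_dominated dM dG actP cG mu0 iid la0 lb0 wa wb K1 aK bK ab.
have weightV s : 0 < weight mu s -> 0 < weight (fun g => mu g^-1)%g (inv_word s).
  by rewrite weight_inv_word.
(* The inverted words give independent contracting elements for the reflected law, so the reversed
   walk has a domination of its own; it bounds the same two-sided product by the backward path
   length. *)
have [C' [rho' [D' [m' [C'0 r'01 D'0 m'0 [_ two']]]]]] :
    exists C rho D m, [/\ 0 <= C, 0 < rho < 1, 0 < D, (0 < m)%N &
    (forall x, dominated P d act o (reversed g 0) C rho D m
      (one_sided d act o (reversed g 0) x)) /\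
    dominated P d act o (reversed g 0) C rho D m (two_sided d act o (reversed g 0))].
  apply: (@walk_dominated _ _ _ _ _ _ _ _ o dM dG actP cG _ _ (inv_word la) (inv_word lb) K
    (fun x => mu0 x^-1%g) (iid_reversed iid 0)) => //.
  - by rewrite size_inv_word.
  - by rewrite size_inv_word.
  - exact: weightV.
  - exact: weightV.
  - by rewrite gprod_inv; exact: contracting_axisV.
  - by rewrite gprod_inv; exact: contracting_axisV.
  - by rewrite !gprod_inv; exact: independent_isometriesV.
split => [p p0 fin|[c [c0 fin]]].
  have [K1' K1'0 h1] := one_sided_moment dM cG mu0 iid mass1 p0 fin C0 r01 D0 m0 one.
  have [K2 K20 h2] := two_sided_moment dM actP cG mu0 iid mass1 p0 fin
    C0 r01 D0 m0 C'0 r'01 D'0 m'0 two two'.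
  exists (K1' + K2); rewrite addr_gt0//; split => // x; split.
    by apply: lt_trans (h1 x) _; rewrite lte_fin ltrDl.
  by apply: lt_trans h2 _; rewrite lte_fin ltrDr.
have /andP[r0 r1] := r01.
have [kappa [L [k0 L0 hL]]] := exp_moment_series cG mu0 iid m C0 r0 r1 D0 c0
  (fun a => d_ge0 dM o (act a o)) mass1 fin.
exists kappa, L; split => // x; split.
  have [B [cB hB]] := one x.
  have e : (fun w => ereal_sup [set (expR (kappa * gromov d o x (act (fwd_walk g n w) o)))%:E
        | n in [set: nat]]) =
      (fun w => ereal_sup [set (expR (kappa * one_sided d act o g x n w))%:E | n in [set: nat]]).
    apply/funext => w; congr ereal_sup.
    by apply/seteqP; split => _ [j _ <-]; exists j => //; rewrite /one_sided (gromovC dM).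
  by rewrite e; exact: (hL B nat (one_sided d act o g x) 0%N cB hB).
have [B [cB hB]] := two.
exact: hL B _ (two_sided d act o g) (0%N, 0%N) cB hB.
Qed.
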